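(* Let $$P(X)=c\prod_{i=1}^s f_i(X)^{m_i}\in\mathbb Z[X],\qquad s\ge1,$$ where $c\in\mathbb Q^\times$, the polynomials $f_1,\dots,f_s\in\mathbb Z[X]$ are nonconstant and pairwise coprime over $\mathbb Q[X]$, and $m_1,\dots,m_s\ge1$ are integers. Put $d_i=\deg f_i$, $d=\sum_{i=1}^s m_id_i$, and $L=\operatorname{lcm}(m_1,\dots,m_s)$. For $I\subseteq\{1,\dots,s\}$ define $$\mathcal R(I)=\{v\in\mathbb Z/L\mathbb Z:\ m_i\mid v\ \text{for at least one } i\in I\}.$$ If the equation $P(x)=n!$ has infinitely many integral solutions $(x,n)$ with $n\ge1$, then for every subset $I\subseteq\{1,\dots,s\}$, $$\frac{\sum_{i\in I}m_id_i}{d}\le\frac{|\mathcal R(I)|}{L}.$$ Thus, if for some subset $I$ one has $\frac{1}{d}\sum_{i\in I}m_id_i>\frac{|\mathcal R(I)|}{L}$, then $P(x)=n!$ has only finitely many integral solutions $(x,n)$ with $n\ge1$.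
   Context: Since $m_i\mid L$, the condition $m_i\mid v$ is well defined for a residue class $v$ modulo $L$. *)

(* Defs.v *)
From HB Require Import structures.
From mathcomp Require Import all_boot all_order all_algebra.
From mathcomp Require Import classical_sets cardinality.

Set Implicit Arguments.
Unset Strict Implicit.
Unset Printing Implicit Defensive.

Import Order.TTheory GRing.Theory Num.Theory.
Local Open Scope ring_scope.

Definition polyQ (p : {poly int}) : {poly rat} := map_poly intr p.

Definition degp (R : nzSemiRingType) (p : {poly R}) : nat := (size p).-1.

Definition lcm_fam (s : nat) (m : 'I_s -> nat) : nat :=
  (\big[lcmn/1]_(i < s) m i)%N.

(* Z/LZ is represented by 'I_L (least residues): unlike 'Z_L this is also
   right for L = 1, and m i %| v does not depend on the representative
   because m i divides L. *)
Definition resid_set (s : nat) (m : 'I_s -> nat) (I : {set 'I_s}) :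
    {set 'I_(lcm_fam m)} :=
  [set v : 'I_(lcm_fam m) | [exists i in I, (m i %| v)%N]]%SET.

Definition wdeg (s : nat) (f : 'I_s -> {poly int}) (m : 'I_s -> nat)
    (I : {set 'I_s}) : nat :=
  (\sum_(i in I) m i * degp (f i))%N.

Definition fact_solutions (P : {poly int}) : set (int * nat) :=
  [set xn : int * nat | (1 <= xn.2)%N /\ P.[xn.1] = (xn.2)`!%:Z]%classic.

(* Main.v *)
Require Import Defs.
From HB Require Import structures.
From mathcomp Require Import all_boot all_order all_algebra.
From mathcomp Require Import classical_sets cardinality.
From mathcomp Require Import Rstruct reals topology normedtype sequences derive realfun exp trigo complex.
From mathcomp Require Import ring lra zify.

(** If [P(x) = n!], then by Bezout over the integers a prime beyond some constant
    divides at most one of the values [f_i(x)]. When it divides [f_i(x)], its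
    exponent in [n!] is [m_i] times its exponent in [f_i(x)]; so this exponent,
    reduced modulo [L], lies in [R(I)] as soon as [i] is in [I]. Writing [ln n!]
    as the sum of [v_p(n!) ln p] over the primes, one sees that the sum over [I]
    of [m_i ln |f_i(x)|] is at most the part of [ln n!] carried by the primes
    with [v_p(n!) mod L] in [R(I)], up to an error [O(n)] due to the small primes
    ([ln_values_le]). Infinitely many solutions force [n] and [|x|] to be
    unbounded ([large_solutions]); then the first quantity is asymptotic to
    [(wdeg I / d) ln n!], and the theorem follows from an equidistribution
    property of factorials, [legendre_residues]: the part of [ln n!] carried by
    the primes whose exponent lies in a set [A] of residues modulo [L] is at most
    [(|A| / L + o(1)) ln n!].

    For this property, cut the primes into dyadic blocks [N < p <= 2 N]. If
    [N ^ J.+1 >= n], then [v_p(n!)] is the sum of [n %/ p ^ j] for [j <= J], and the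
    residue of [n %/ p ^ j] modulo [L] depends on which interval of length [1 / L]
    contains the fractional part of [n / (L p ^ j)]. Replacing the indicator
    functions of these intervals by trigonometric polynomials that majorize them
    ([trig_majorant]) leaves the expected main term and sums over the primes of
    the block of [ln p * e(F(p))], where [e(x) = exp(2 i pi x)] and [F(p)] is a
    combination of the numbers [n / (L p ^ j)], [j <= J]. Such a sum is small as
    long as [n] exceeds [N ^ J] by a small power of [n] ([prime_phase_sum]): Vaughan's
    identity ([vaughan]) reduces it to sums over intervals of integers, with
    phases of the same shape, and these are estimated by repeated Weyl
    differencing down to the Kusmin-Landau inequality ([power_sum_le]). The blocks
    in which [n] is too close above a power of [N], or in which [N] itself is too
    small, form a small proportion of all the blocks; by Chebyshev's upper bound
    each block carries [O(n)] of [ln n!], so that these are negligible. *)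

Set Implicit Arguments.
Unset Strict Implicit.
Unset Printing Implicit Defensive.

Import Order.TTheory GRing.Theory Num.Theory numFieldNormedType.Exports.
Local Open Scope ring_scope.

(** * Complex numbers of modulus one, and finite differences *)

Section ComplexNorm.
Variable R : rcfType.
Implicit Types (x y : R) (z w : R[i]).

(** The norm of [R[i]] takes its values in [R[i]]; this is the same modulus as an
    element of [R], where it can be compared with real bounds. *)
Definition cnorm z : R := complex.Re `|z|.

Lemma cnormE z : (cnorm z)%:C%C = `|z|.
Proof. by rewrite /cnorm RRe_real// normr_real. Qed.

Lemma cnorm_ge0 z : 0 <= cnorm z.
Proof. by rewrite -ler0c cnormE. Qed.

Lemma cnorm0 : cnorm 0 = 0.
Proof. by rewrite /cnorm normr0. Qed.

Lemma cnorm1 : cnorm 1 = 1.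
Proof. by rewrite /cnorm normr1. Qed.

Lemma cnormN z : cnorm (- z) = cnorm z.
Proof. by rewrite /cnorm normrN. Qed.

Lemma cnormM z w : cnorm (z * w) = cnorm z * cnorm w.
Proof. by apply: complexI; rewrite rmorphM !cnormE normrM. Qed.

Lemma cnormD z w : cnorm (z + w) <= cnorm z + cnorm w.
Proof. by rewrite -lecR rmorphD !cnormE ler_normD. Qed.

Lemma cnorm_conj z : cnorm (conjc z) = cnorm z.
Proof. by rewrite /cnorm normcJ. Qed.

Lemma cnorm_sqr z : ((cnorm z) ^+ 2)%:C%C = z * conjc z.
Proof. by rewrite rmorphXn /= cnormE sqr_normc. Qed.

Lemma cnorm_real x : cnorm x%:C%C = `|x|.
Proof.
by apply: complexI; rewrite cnormE normc_def /= expr0n /= addr0 sqrtr_sqr.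
Qed.

Lemma cnorm_sum (I : Type) (r : seq I) (P : pred I) (F : I -> R[i]) :
  cnorm (\sum_(i <- r | P i) F i) <= \sum_(i <- r | P i) cnorm (F i).
Proof.
elim/big_rec2: _ => [|i y z _ le_zy]; first by rewrite cnorm0.
by apply: le_trans (cnormD _ _) _; rewrite lerD2l.
Qed.

Lemma Re_le_cnorm z : complex.Re z <= cnorm z.
Proof.
apply: le_trans (ler_norm _) _.
by rewrite -lecR cnormE normc_ge_Re.
Qed.

Lemma cnormE2 z : cnorm z ^+ 2 = complex.Re z ^+ 2 + complex.Im z ^+ 2.
Proof. by apply: complexI; rewrite add_Re2_Im2 rmorphXn /= cnormE. Qed.

Lemma conjc_sum (I : Type) (r : seq I) (P : pred I) (F : I -> R[i]) :
  conjc (\sum_(i <- r | P i) F i) = \sum_(i <- r | P i) conjc (F i).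
Proof. exact: rmorph_sum. Qed.

Lemma conjcM z w : conjc (z * w) = conjc z * conjc w.
Proof. exact: rmorphM. Qed.

(** Cauchy-Schwarz against the constant function 1. *)
Lemma sqr_sum_le_nat (a b : nat) (F : nat -> R) :
  (\sum_(a <= i < b) F i) ^+ 2 <= (b - a)%:R * \sum_(a <= i < b) F i ^+ 2.
Proof.
have [leba|/ltnW] := leqP b a.
  by rewrite !big_geq// expr0n mulr0.
elim: b => [|b IHb]; first by rewrite leqn0 => /eqP ->; rewrite !big_geq// expr0n mulr0.
rewrite leq_eqVlt => /predU1P[->|]; first by rewrite !big_geq// expr0n mulr0.
rewrite ltnS => leab; rewrite !big_nat_recr//= subSn//.
set S := \sum_(_ <= _ < _) _; set Q := \sum_(_ <= _ < _) _.
have {IHb} := IHb leab; rewrite -/S -/Q => SQ.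
set k : R := (b - a)%:R in SQ *.
have k0 : 0 <= k by rewrite /k.
have Q0 : 0 <= Q by apply: sumr_ge0 => i _; rewrite sqr_ge0.
rewrite -natr1 -/k.
case: (ltgtP k 0) k0 => // [k_gt0 _|k_eq0 _]; last first.
  have : S ^+ 2 <= 0 by move: SQ; rewrite k_eq0 mul0r.
  rewrite le_eqVlt ltNge sqr_ge0 orbF sqrf_eq0 => /eqP ->.
  by rewrite k_eq0 !add0r mul1r lerDr.
set c := F b.
have : 0 <= (S - k * c) ^+ 2 by rewrite sqr_ge0.
rewrite sqrrB => h.
have : 0 <= k * ((k + 1) * (Q + c ^+ 2) - (S + c) ^+ 2) by nra.
by rewrite pmulr_rge0// subr_ge0.
Qed.

End ComplexNorm.

Section Exponential.
Variable R : realType.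
Implicit Types (x y : R).

(** The additive character usually written [e(x)]. *)
Definition cexp x : R[i] := Complex (cos (2 * pi * x)) (sin (2 * pi * x)).

Lemma cexpD x y : cexp (x + y) = cexp x * cexp y.
Proof.
rewrite /cexp mulrDr cosD sinD.
by apply/eqP; rewrite eq_complex /=; apply/andP; split; apply/eqP; ring.
Qed.

Lemma cexp0 : cexp 0 = 1.
Proof. by rewrite /cexp mulr0 cos0 sin0. Qed.

Lemma cexpN x : cexp (- x) = conjc (cexp x).
Proof. by rewrite /cexp mulrN cosN sinN. Qed.

Lemma cnorm_cexp x : cnorm (cexp x) = 1.
Proof.
apply/eqP; rewrite -(@eqrXn2 _ 2%N)// ?cnorm_ge0//.
by rewrite cnormE2 expr1n /= cos2Dsin2.
Qed.

Lemma cexp_nat (n : nat) : cexp n%:R = 1.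
Proof.
elim: n => [|n IHn]; first exact: cexp0.
rewrite -natr1 cexpD IHn mul1r /cexp mulr1 mulr_natl.
by rewrite cos2pi sin2pi.
Qed.

Lemma sin_le_id (t : R) : 0 <= t -> sin t <= t.
Proof.
move=> t0; have [|c _] := @MVT_segment _ sin cos _ _ t0 (fun x _ => is_derive_sin x).
  exact/continuous_subspaceT/continuous_sin.
rewrite sin0 !subr0 => ->.
by rewrite ler_piMl// cos_le1.
Qed.

Lemma cnorm_1Bcexp x : cnorm (1 - cexp x) = 2 * `|sin (pi * x)|.
Proof.
apply/eqP; rewrite -(@eqrXn2 _ 2%N)// ?cnorm_ge0// ?mulr_ge0//; apply/eqP.
rewrite cnormE2 /= sub0r sqrrN exprMn real_normK ?num_real// (sin2cos2 (pi * x)).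
have -> : 2 * pi * x = (pi * x) *+ 2 by rewrite mulr2n; ring.
have := cos2Dsin2 ((pi * x) *+ 2); rewrite cos_mulr2n mulr2n.
move: (cos (pi * x)) (sin (pi * x *+ 2)) => c s h; have -> : s ^+ 2 = 1 - (c ^+ 2 + c ^+ 2 - 1) ^+ 2.
  by apply/eqP; rewrite eq_sym subr_eq addrC h.
by ring.
Qed.

Lemma cnorm_1Bcexp_le x : 0 <= x -> cnorm (1 - cexp x) <= 8 * x.
Proof.
move=> x0; rewrite cnorm_1Bcexp.
have px0 : 0 <= pi * x by rewrite mulr_ge0// pi_ge0.
have h : `|sin (pi * x)| <= pi * x.
  have [p1|p1] := leP (pi * x) pi.
    by rewrite ger0_norm ?sin_le_id// sin_ge0_pi// px0 p1.
  apply: le_trans (sin_max _) _.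
  by have := @pi_ge2 R; lra.
have := @pihalf_lt2 R; nra.
Qed.

(** Doubling the argument at most doubles [|1 - e(x)|], and [cos] is
    nonpositive once the argument has reached [1/4, 1/2]. *)
Lemma cnorm_1Bcexp_ge x : 0 <= x -> x <= 2^-1 -> 2 * x <= cnorm (1 - cexp x).
Proof.
move=> x0 x1.
have [->|xN0] := eqVneq x 0; first by rewrite mulr0 cnorm_ge0.
have {x0 xN0} x0 : 0 < x by rewrite lt0r xN0.
have [k hk] : exists k : nat, 4^-1 <= 2 ^+ k * x.
  have [k hk] : exists k : nat, 4^-1 / x <= k%:R.
    exists (Num.truncn (4^-1 / x)).+1; apply/ltW/truncnS_gt.
    
  exists k; rewrite -ler_pdivrMr//; apply: le_trans hk _.
  by rewrite -natrX ler_nat ltnW// ltn_expl.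
elim: k x x0 x1 hk => [|k IHk] x x0 x1.
  rewrite expr0 mul1r => x4; rewrite -(@ler_pXn2r _ 2%N)// ?nnegrE ?cnorm_ge0//; last lra.
  rewrite cnormE2 /= sub0r sqrrN.
  have c0 : cos (2 * pi * x) <= 0.
    have -> : 2 * pi * x = (2 * pi * x - pi / 2) + pi / 2 :> R by lra.
    rewrite cosDpihalf oppr_le0 sin_ge0_pi//.
    have := @pi_ge2 R; nra.
  have := cos2Dsin2 (2 * pi * x); nra.
rewrite exprSr -mulrA => hk.
have [x4|x4] := leP 4^-1 x.
  by apply: (IHk x) => //; rewrite (le_trans x4)// ler_peMl ?(ltW x0)// exprn_ege1// ler1n.
have := IHk (2 * x); rewrite mulr_gt0// => /(_ isT) h.
have {h} : 2 * (2 * x) <= cnorm (1 - cexp (2 * x)) by apply: h => //; lra.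
have -> : 1 - cexp (2 * x) = (1 - cexp x) * (1 + cexp x).
  have -> : 2 * x = x + x by ring.
  by rewrite cexpD; ring.
rewrite cnormM => h.
have : cnorm (1 + cexp x) <= 2.
  by apply: le_trans (cnormD _ _) _; rewrite cnorm1 cnorm_cexp.
have := cnorm_ge0 (1 - cexp x); nra.
Qed.

Lemma cnorm_cexpB x y : y <= x -> cnorm (cexp x - cexp y) <= 8 * (x - y).
Proof.
move=> yx; have -> : cexp x - cexp y = - (cexp y * (1 - cexp (x - y))).
  by rewrite mulrBr mulr1 -cexpD [y + _]addrC subrK opprB.
by rewrite cnormN cnormM cnorm_cexp mul1r cnorm_1Bcexp_le// subr_ge0.
Qed.

End Exponential.

Section Differences.
Variable R : zmodType.
Implicit Types (f : nat -> R).

Definition fdiff f : nat -> R := fun m => f m.+1 - f m.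

(** A difference with shift [h] is the sum of [h] consecutive differences with
    shift 1, which is why Weyl differencing raises the order of differences by
    one. *)
Lemma fdiff_iter_shift (k h m : nat) f :
  iter k fdiff (fun j => f (j + h)%N - f j) m =
    \sum_(i < h) iter k.+1 fdiff f (m + i)%N.
Proof.
elim: k m => [|k IHk] m.
  rewrite /= /fdiff.
  elim: h => [|h IHh]; first by rewrite addn0 subrr big_ord0.
  by rewrite big_ord_recr /= -IHh addnS addrC subrKA.
rewrite iterS {1}/fdiff !IHk -sumrB; apply: eq_bigr => i _.
by rewrite addSn.
Qed.

End Differences.

(** * The Kusmin-Landau inequality and Weyl differencing *)

Section KusminLandau.
Variable R : realType.

(** On an interval where the increments [u m] of the phase decrease inside
    [[lam, Lam]], one has [e(f m) = c m (e(f m) - e(f m.+1))] with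
    [c m = 1 / (1 - e(u m))] of bounded variation; summation by parts then
    leaves only the end terms. *)
Lemma kusmin_landau (f : nat -> R) (a b : nat) (lam Lam : R) :
  0 < lam -> lam <= Lam -> Lam <= 2^-1 ->
  (forall m, (a <= m < b)%N -> lam <= fdiff f m <= Lam) ->
  (forall m, (a <= m)%N -> (m.+1 < b)%N -> fdiff f m.+1 <= fdiff f m) ->
  cnorm (\sum_(a <= m < b) cexp (f m)) <= 3 * Lam / lam ^+ 2.
Proof.
move=> lam0 lamLam Lam2 hu hdec.
have Lam0 : 0 < Lam by apply: lt_le_trans lamLam.
have [leba|ltab] := leqP b a.
  by rewrite big_geq// cnorm0 divr_ge0// ?sqr_ge0// mulr_ge0// ltW.
pose c m : R[i] := (1 - cexp (fdiff f m))^-1.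
have den m : (a <= m < b)%N -> 2 * lam <= cnorm (1 - cexp (fdiff f m)).
  move=> /hu /andP[h1 h2]; apply: le_trans (cnorm_1Bcexp_ge _ _); lra.
have den0 m : (a <= m < b)%N -> 1 - cexp (fdiff f m) != 0.
  move=> /den h; apply/negP => /eqP z; move: h; rewrite z cnorm0; lra.
have cE m : (a <= m < b)%N -> cexp (f m) = c m * cexp (f m) - c m * cexp (f m.+1).
  move=> hm; rewrite -mulrBr /c.
  have -> : cexp (f m.+1) = cexp (f m) * cexp (fdiff f m).
    by rewrite -cexpD /fdiff addrC subrK.
  by rewrite -{2}[cexp (f m)]mulr1 -mulrBr mulrCA mulVf ?mulr1// den0.
have cn m : (a <= m < b)%N -> cnorm (c m) <= (2 * lam)^-1.
  move=> hm; have h := den _ hm.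
  have -> : cnorm (c m) = (cnorm (1 - cexp (fdiff f m)))^-1.
    apply: (mulfI (_ : cnorm (1 - cexp (fdiff f m)) != 0)); first by lra.
    rewrite -cnormM /c mulfV ?den0// cnorm1 mulfV//; lra.
  by rewrite lef_pV2// ?posrE; lra.
have cv m : (a <= m)%N -> (m.+1 < b)%N ->
    cnorm (c m - c m.+1) <= 2 / lam ^+ 2 * (fdiff f m - fdiff f m.+1).
  move=> am mb.
  have hm : (a <= m < b)%N by lia.
  have hm1 : (a <= m.+1 < b)%N by lia.
  have -> : c m - c m.+1 =
      c m * c m.+1 * (cexp (fdiff f m) - cexp (fdiff f m.+1)).
    have := den0 _ hm; have := den0 _ hm1; rewrite /c => d1 d2.
    by field; rewrite d1 d2.
  rewrite !cnormM.
  have h1 := cn _ hm; have h2 := cn _ hm1.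
  have h3 : cnorm (cexp (fdiff f m) - cexp (fdiff f m.+1)) <= 8 * (fdiff f m - fdiff f m.+1).
    by apply: cnorm_cexpB; apply: hdec.
  have -> : 2 / lam ^+ 2 * (fdiff f m - fdiff f m.+1) =
    (2 * lam)^-1 * (2 * lam)^-1 * (8 * (fdiff f m - fdiff f m.+1)).
    by field; lra.
  apply: ler_pM; rewrite ?mulr_ge0 ?cnorm_ge0//.
  by apply: ler_pM; rewrite ?cnorm_ge0.
(* Summation by parts on an initial segment: apart from the two end terms, only
   the variation of [c] is left, and it telescopes because [fdiff f] decreases. *)
have key d : (a + d < b)%N ->
    cnorm (\sum_(a <= m < (a + d).+1) cexp (f m)
           + c (a + d)%N * cexp (f (a + d).+1) - c a * cexp (f a))
      <= 2 / lam ^+ 2 * (fdiff f a - fdiff f (a + d)%N).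
  elim: d => [|d IHd] hd.
    rewrite addn0 big_nat1 {1}cE ?leqnn//.
    by rewrite subrK addrN !subrr cnorm0 mulr0.
  rewrite addnS big_nat_recr/=; last by lia.
  have /cE {1}-> : (a <= (a + d).+1 < b)%N by lia.
  rewrite addnS in hd.
  have {}IHd := IHd (ltnW hd).
  have h := cv (a + d)%N (leq_addr _ _) hd.
  set S := \sum_(_ <= _ < _) _ in IHd *.
  set E := cexp (f (a + d).+1) in IHd *.
  have -> : S + (c (a + d).+1 * E - c (a + d).+1 * cexp (f (a + d).+2)) +
    c (a + d).+1 * cexp (f (a + d).+2) - c a * cexp (f a) =
    (S + c (a + d)%N * E - c a * cexp (f a)) - (c (a + d)%N - c (a + d).+1) * E.
    by ring.
  apply: le_trans (cnormD _ _) _; rewrite cnormN cnormM cnorm_cexp mulr1.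
  apply: le_trans (lerD IHd h) _.
  by rewrite -mulrDr addrA subrK.
have [d bE] : exists d, b = (a + d).+1 by exists (b - a).-1; lia.
have := key d; rewrite -bE leqnn => /(_ isT) {}key.
have hua : (a <= a < b)%N by lia.
have hub : (a <= a + d < b)%N by lia.
have -> : \sum_(a <= m < b) cexp (f m) =
  (\sum_(a <= m < b) cexp (f m) + c (a + d)%N * cexp (f b) - c a * cexp (f a)) +
  (c a * cexp (f a) - c (a + d)%N * cexp (f b)) by ring.
apply: le_trans (cnormD _ _) _.
have h2 : cnorm (c a * cexp (f a) - c (a + d)%N * cexp (f b)) <= lam^-1.
  apply: le_trans (cnormD _ _) _; rewrite cnormN !cnormM !cnorm_cexp !mulr1.
  have -> : lam^-1 = (2 * lam)^-1 + (2 * lam)^-1 by field; lra.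
  by apply: lerD; apply: cn.
apply: le_trans (lerD key h2) _.
have /hu /andP[h3 h4] := hua; have /hu /andP[h5 h6] := hub.
have -> : 3 * Lam / lam ^+ 2 = 2 / lam ^+ 2 * (Lam - 0) + Lam / lam ^+ 2.
  by field; lra.
apply: lerD.
  apply: ler_wpM2l; last by lra.
  by rewrite divr_ge0// sqr_ge0.
by rewrite ler_pdivlMr ?exprn_gt0// expr2 mulKf//; lra.
Qed.

End KusminLandau.

Section VanDerCorput.
Variable R : realType.

(** Weyl differencing: averaging the sum over [H] shifts and applying
    Cauchy-Schwarz turns it into autocorrelations of length at most [N]. *)
Lemma van_der_corput (u : nat -> R[i]) (N H : nat) :
  H%:R * cnorm (\sum_(i < N) u i) ^+ 2 <=
    2 * (N + H)%:R * \sum_(h < H) cnorm (\sum_(i < N - h) u (i + h)%N * conjc (u i)).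
Proof.
have [->|H0] := posnP H.
  by rewrite mul0r big_ord0 mulr0.
(* The sum of the shifted copies of [u] at the point [j]; the shifts range over
   [H] values, so the copies live on [N + H] points. *)
pose A (j : nat) : R[i] := \sum_(h < H) \sum_(i < N | (i + h == j)%N) u i.
pose G (h : nat) : R := cnorm (\sum_(i < N - h) u (i + h)%N * conjc (u i)).
have sumA : \sum_(0 <= j < N + H) A j = H%:R * \sum_(i < N) u i.
  rewrite /A big_mkord exchange_big /= -[H in H%:R]card_ord mulr_natl -sumr_const.
  apply: eq_bigr => h _.
  rewrite (exchange_big_dep xpredT) //=; apply: eq_bigr => i _.
  have hi : (i + h < N + H)%N by have := ltn_ord i; have := ltn_ord h; lia.
  by rewrite (big_pred1 (Ordinal hi)).
have cs : (H%:R * cnorm (\sum_(i < N) u i)) ^+ 2 <=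
    (N + H)%:R * \sum_(0 <= j < N + H) cnorm (A j) ^+ 2.
  rewrite -{1}[H%:R]ger0_norm ?ler0n// -cnorm_real -cnormM rmorph_nat -sumA.
  apply: le_trans (_ : (\sum_(0 <= j < N + H) cnorm (A j)) ^+ 2 <= _).
    by rewrite lerXn2r ?nnegrE ?cnorm_ge0 ?sumr_ge0// ?cnorm_sum// => *; apply: cnorm_ge0.
  by have := @sqr_sum_le_nat R 0 (N + H) (fun j => cnorm (A j)); rewrite subn0.
(* The correlation of the copies shifted by [h1] and [h2] depends, up to
   conjugation, on the distance between the shifts only. *)
pose C (h1 h2 : nat) : R[i] :=
  \sum_(i1 < N) \sum_(i2 < N | (i1 + h1 == i2 + h2)%N) u i1 * conjc (u i2).
have sqA : (\sum_(0 <= j < N + H) cnorm (A j) ^+ 2)%:C%C =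
    \sum_(h1 < H) \sum_(h2 < H) C h1 h2.
  rewrite rmorph_sum /= big_mkord.
  transitivity (\sum_(j < N + H) \sum_(h1 < H) \sum_(h2 < H)
     \sum_(i1 < N | (i1 + h1 == j)%N) \sum_(i2 < N | (i2 + h2 == j)%N) u i1 * conjc (u i2)).
    apply: eq_bigr => j _; rewrite cnorm_sqr /A conjc_sum mulr_suml.
    apply: eq_bigr => h1 _; rewrite mulr_sumr; apply: eq_bigr => h2 _.
    rewrite conjc_sum mulr_suml; apply: eq_bigr => i1 _.
    by rewrite mulr_sumr.
  rewrite exchange_big /=; apply: eq_bigr => h1 _.
  rewrite exchange_big /=; apply: eq_bigr => h2 _.
  rewrite /C (exchange_big_dep xpredT) //=; apply: eq_bigr => i1 _.
  have hi : (i1 + h1 < N + H)%N by have := ltn_ord i1; have := ltn_ord h1; lia.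
  rewrite (big_pred1 (Ordinal hi))//=.
  by apply: eq_bigl => i2; rewrite eq_sym.
have CG h1 h2 : (h1 <= h2)%N -> cnorm (C h1 h2) = G (h2 - h1)%N.
  move=> h12; rewrite /C /G; congr cnorm.
  rewrite (exchange_big_dep xpredT)//=.
  have -> : \sum_(i < N - (h2 - h1)) u (i + (h2 - h1))%N * conjc (u i) =
    \sum_(i < N | (i < N - (h2 - h1))%N) u (i + (h2 - h1))%N * conjc (u i).
    by apply: (big_ord_widen N (fun i => u (i + (h2 - h1))%N * conjc (u i))); lia.
  rewrite [RHS]big_mkcond; apply: eq_bigr => i2 _.
  case: ifPn => hi2.
    have hi : (i2 + (h2 - h1) < N)%N by lia.
    rewrite (big_pred1 (Ordinal hi))// => i1 /=.
    by rewrite -val_eqE /=; apply/idP/idP => /eqP ?; apply/eqP; lia.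
  by rewrite big_pred0// => i1; apply/negP => /eqP; have := ltn_ord i1; lia.
have Cconj h1 h2 : cnorm (C h1 h2) = cnorm (C h2 h1).
  rewrite -cnorm_conj; congr cnorm; rewrite /C conjc_sum.
  under eq_bigr => i1 _ do rewrite conjc_sum.
  rewrite (exchange_big_dep xpredT)//=; apply: eq_bigr => i1 _.
  apply: eq_big => i2; first by rewrite eq_sym.
  by move=> _; rewrite conjcM conjcK mulrC.
have G0 h : 0 <= G h by apply: cnorm_ge0.
have row h1 : (h1 < H)%N -> \sum_(h2 < H) cnorm (C h1 h2) <= 2 * \sum_(h < H) G h.
  move=> h1H.
  have h1H' := ltnW h1H.
  have -> : \sum_(h2 < H) cnorm (C h1 h2) = \sum_(0 <= h2 < h1) cnorm (C h1 h2) +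
      \sum_(h1 <= h2 < H) cnorm (C h1 h2).
    by rewrite -big_cat_nat// big_mkord.
  rewrite mulr_natl mulr2n; apply: lerD.
    rewrite big_mkord.
    apply: le_trans (_ : \sum_(i < h1) G i.+1 <= _).
      rewrite [leRHS](reindex_inj rev_ord_inj) /=.
      apply: ler_sum => i _; rewrite Cconj CG; last by have := ltn_ord i; lia.
      rewrite le_eqVlt; apply/orP; left; apply/eqP; congr G.
      by have := ltn_ord i; lia.
    rewrite -(big_mkord xpredT G) -(big_mkord xpredT (fun i => G i.+1)).
    rewrite -(big_add1 _ _ 0%N h1.+1 xpredT G) (@big_cat_nat _ _ _ h1.+1 0 H)//=.
    by rewrite [X in _ <= X + _]big_ltn// -addrA [leRHS]addrCA lerDl addr_ge0// sumr_ge0.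
  rewrite -{1}[h1]add0n big_addn.
  rewrite -(big_mkord xpredT G) (@big_cat_nat _ _ _ (H - h1) 0 H)//= ?leq_subr//.
  rewrite -[leLHS]addr0; apply: lerD; last by rewrite sumr_ge0.
  apply: ler_sum => i _; rewrite CG ?leq_addl//.
  by rewrite addnK.
have tot : \sum_(0 <= j < N + H) cnorm (A j) ^+ 2 <= H%:R * (2 * \sum_(h < H) G h).
  rewrite -[leLHS]ger0_norm; last by rewrite sumr_ge0// => i _; rewrite sqr_ge0.
  rewrite -cnorm_real sqA.
  apply: le_trans (cnorm_sum _ _ _) _.
  rewrite -[H in H%:R]card_ord mulr_natl -sumr_const.
  apply: ler_sum => h1 _; apply: le_trans (cnorm_sum _ _ _) _.
  exact: row.
have {}cs := le_trans cs (ler_wpM2l (ler0n _ _) tot).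
have HR : (0 : R) < H%:R by rewrite ltr0n.
rewrite -(ler_pM2l HR).
move: cs; rewrite exprMn expr2 -!mulrA => /le_trans; apply.
rewrite le_eqVlt; apply/orP; left; apply/eqP; rewrite /G; ring.
Qed.

End VanDerCorput.

(** * The test by higher differences *)

Section DerivativeTest.
Variable R : realType.

Lemma sum_nat_lt_le (H : nat) (x : R) : 0 <= x ->
  \sum_(h < H) (h%:R < x)%R%:R <= x + 1.
Proof.
move=> x0; elim: H => [|H IHH]; first by rewrite big_ord0 addr_ge0.
rewrite big_ord_recr /=; have [Hx|_] := ltP; last by rewrite addr0.
apply: le_trans (_ : H%:R + 1 <= _); last by rewrite lerD2r ltW.
rewrite lerD2r -[H in leRHS]card_ord -sumr_const.
by apply: ler_sum => i _; rewrite lern1; case: (_ < _).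
Qed.

(** One Weyl differencing with shift [h] replaces the difference of order [k.+2]
    of the phase by a sum of [h] of its values, seen as a difference of order
    [k.+1]. Thus [k] differencings with shifts below [H] lead to a phase with
    monotonic first difference of size at most [H ^ k Lam], to which
    [kusmin_landau] applies. The parameter [Y] is the saving; the shifts
    [h < H / Y ^ 2] are estimated trivially, and the square in [van_der_corput]
    turns a saving [Y ^ 2] into a saving [Y]. *)
Lemma difference_test (c0 : R) (k : nat) : exists2 C : R, 0 < C &
  forall (f : nat -> R) (a b M H : nat) (Y lam Lam : R),
  (b - a <= M)%N -> (0 < H <= M)%N -> 1 <= Y -> Y ^+ (2 ^ k) <= H%:R ->
  0 < lam -> lam <= Lam -> Lam <= c0 * lam -> H%:R ^+ k * Lam <= 2^-1 ->
  Y ^+ (6 * 2 ^ k) <= lam * H%:R ^+ k * M%:R * Y ^+ 2 ->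
  (forall m, (a <= m < b)%N -> lam <= iter k.+1 (@fdiff R) f m <= Lam) ->
  (forall m, (a <= m)%N -> (m.+1 < b)%N ->
     iter k.+1 (@fdiff R) f m.+1 <= iter k.+1 (@fdiff R) f m) ->
  cnorm (\sum_(a <= m < b) cexp (f m)) <= C * M%:R / Y.
Proof.
elim: k => [|k [C C0 IHk]].
  exists (3 * (1 + `|c0|)); first by rewrite mulr_gt0// ltr_pwDl.
  move=> f a b M H Y lam Lam bM /andP[H0 HM] Y1 _ lam0 lamL Lc.
  rewrite !expr0 !mul1r mulr1 => L2 hY hu hdec.
  have Y0 : 0 < Y by lra.
  apply: le_trans (kusmin_landau lam0 lamL L2 hu hdec) _.
  have {}hY : Y ^+ 4 <= lam * M%:R.
    rewrite -(ler_pM2r (exprn_gt0 2 Y0)) -exprD; exact: hY.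
  have hY1 : Y <= lam * M%:R by apply: le_trans hY; apply: ler_eXnr.
  apply: le_trans (_ : 3 * (1 + `|c0|) / lam <= _).
    rewrite ler_pdivrMr ?exprn_gt0// expr2 mulrA divfK ?gt_eqF//.
    rewrite -mulrA ler_wpM2l//; apply: le_trans Lc _; rewrite ler_wpM2r ?(ltW lam0)//.
    by apply: le_trans (ler_norm _) _; rewrite lerDr.
  rewrite ler_pdivrMr// -!mulrA ler_wpM2l//.
  rewrite ler_peMr ?addr_ge0//.
  by rewrite mulrCA ler_pdivlMl// mulr1 mulrC.
exists (4 * C + 8); first by lra.
move=> f a b M H Y lam Lam bM /andP[H0 HM] Y1 hH lam0 lamL Lc L2 hY hu hdec.
have Y0 : 0 < Y by lra.
have M0 : (0 < M)%N by apply: leq_trans HM.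
have HR : (0 : R) < H%:R by rewrite ltr0n.
have MR : (0 : R) < M%:R by rewrite ltr0n.
have Y2 : Y ^+ 2 <= H%:R.
  apply: le_trans hH; apply: ler_weXn2l => //.
  by rewrite expnS leq_pmulr// expn_gt0.
pose N := (b - a)%N.
pose u i := cexp (f (a + i)%N).
have SE : \sum_(a <= m < b) cexp (f m) = \sum_(i < N) u i.
  by rewrite -{1}[a]add0n big_addn big_mkord; apply: eq_bigr => i _; rewrite addnC.
rewrite SE.
have vdc := van_der_corput u N H.
(* The induction hypothesis for the differenced phase, with [Y ^ 2] for [Y]; the
   indicator accounts for the shifts that are estimated trivially. *)
have GE h : (h < H)%N -> cnorm (\sum_(i < N - h) u (i + h)%N * conjc (u i)) <=
    C * M%:R / Y ^+ 2 + (h%:R < H%:R / Y ^+ 2)%R%:R * M%:R.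
  move=> hH'; have [hs|hs] := ltP.
    rewrite mul1r; apply: le_trans (_ : M%:R <= _); last first.
      by rewrite lerDr// divr_ge0// ?mulr_ge0 ?sqr_ge0// ltW.
    apply: le_trans (cnorm_sum _ _ _) _.
    rewrite (eq_bigr (fun=> 1)); last first.
      by move=> i _; rewrite cnormM cnorm_conj !cnorm_cexp mulr1.
    rewrite sumr_const card_ord -[_ *+ _]/(_%:R) ler_nat.
    by apply: leq_trans (leq_subr _ _) bM.
  rewrite mul0r addr0.
  have h0 : (0 : R) < h%:R by apply: lt_le_trans hs; rewrite divr_gt0// exprn_gt0.
  have -> : \sum_(i < N - h) u (i + h)%N * conjc (u i) =
      \sum_(a <= m < b - h) cexp ((fun m => f (m + h)%N - f m) m).
    rewrite -{1}[a]add0n big_addn big_mkord.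
    have -> : (b - h - a = N - h)%N by rewrite /N subnAC.
    apply: eq_bigr => i _; rewrite cexpD cexpN /u.
    by rewrite [(i + a)%N]addnC addnA.
  apply: (IHk _ _ _ _ H _ (h%:R * lam) (h%:R * Lam)) => //; rewrite -/(iter _ _ _).
  - by apply: leq_trans bM; rewrite leq_sub2r// leq_subr.
  - by rewrite H0 HM.
  - by rewrite exprn_ege1.
  - by rewrite -exprM -expnS.
  - by rewrite mulr_gt0.
  - by rewrite ler_wpM2l// ltW.
  - by rewrite mulrCA ler_wpM2l// ltW.
  - apply: le_trans L2; rewrite mulrA exprSr -!mulrA ler_wpM2l ?exprn_ge0 ?ler0n//.
    by rewrite ler_wpM2r ?ler_nat ?(ltnW hH')//; lra.
  - rewrite -exprM mulnCA -expnS; apply: le_trans hY _.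
    rewrite -[(Y ^+ 2) ^+ 2]/(Y ^+ 2 * Y ^+ 2) exprSr.
    rewrite ler_pdivrMr ?exprn_gt0// in hs.
    have -> : lam * (H%:R ^+ k * H%:R) * M%:R * Y ^+ 2 =
       (lam * H%:R ^+ k * M%:R * Y ^+ 2) * H%:R by ring.
    have -> : h%:R * lam * H%:R ^+ k * M%:R * (Y ^+ 2 * Y ^+ 2) =
       (lam * H%:R ^+ k * M%:R * Y ^+ 2) * (h%:R * Y ^+ 2) by ring.
    by rewrite ler_wpM2l// !mulr_ge0// ?sqr_ge0 ?exprn_ge0//; lra.
  - move=> m hm; rewrite fdiff_iter_shift.
    have hm' i : (i < h)%N -> (a <= m + i < b)%N by clear -hm; lia.
    by rewrite ![h%:R * _]mulr_natl -[h in _ *+ h <= _]card_ord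
       -[h in _ <= _ *+ h]card_ord -!sumr_const !ler_sum// => i _;
       have /hu /andP[] := hm' i (ltn_ord i).
  - move=> m am mb; rewrite !fdiff_iter_shift; apply: ler_sum => i _.
    by rewrite addSn; apply: hdec; have := ltn_ord i; clear -am mb; lia.
have sumG : \sum_(h < H) cnorm (\sum_(i < N - h) u (i + h)%N * conjc (u i)) <=
    \sum_(h < H) (C * M%:R / Y ^+ 2 + (h%:R < H%:R / Y ^+ 2)%R%:R * M%:R).
  by apply: ler_sum => h _; apply: GE.
have {sumG}vdc := le_trans vdc (ler_wpM2l (mulr_ge0 (ler0n _ 2) (ler0n _ _)) sumG).
move: vdc; rewrite big_split /= sumr_const card_ord -mulr_suml => vdc.
have cnt : \sum_(h < H) (h%:R < H%:R / Y ^+ 2)%R%:R <= 2 * (H%:R / Y ^+ 2).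
  apply: le_trans (sum_nat_lt_le _ _) _; first by rewrite divr_ge0 ?sqr_ge0// ltW.
  have : 1 <= H%:R / Y ^+ 2 by rewrite ler_pdivlMr ?exprn_gt0// mul1r.
  lra.
set S := cnorm _ in vdc *.
have S0 : 0 <= S by apply: cnorm_ge0.
have : H%:R * S ^+ 2 <= H%:R * ((4 * C + 8) * M%:R ^+ 2 / Y ^+ 2).
  apply: le_trans vdc _.
  apply: le_trans (_ : 2 * (M + M)%:R * ((C * M%:R / Y ^+ 2) *+ H + 2 * (H%:R / Y ^+ 2) * M%:R) <= _).
    apply: ler_pM; rewrite ?mulr_ge0//.
    - apply: addr_ge0; last by apply: mulr_ge0 => //; apply: sumr_ge0.
      apply: mulrn_wge0; apply: divr_ge0; last exact: sqr_ge0.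
      by apply: mulr_ge0 => //; apply: ltW.
    - by rewrite ler_wpM2l// ler_nat leq_add// -/N.
    - by rewrite lerD2l ler_wpM2r// cnt.
  rewrite -[X in X <= _]mulr1 -mulr_natr natrD le_eqVlt; apply/orP; left; apply/eqP.
  by field; rewrite gt_eqF.
rewrite ler_pM2l// => hS.
rewrite -(@ler_pXn2r _ 2%N) ?nnegrE//; last first.
  by rewrite divr_ge0 ?mulr_ge0//; lra.
apply: le_trans hS _; rewrite exprMn exprVn ler_wpM2r ?invr_ge0 ?sqr_ge0//.
rewrite exprMn ler_wpM2r ?sqr_ge0// expr2 ler_peMr//; lra.
Qed.

End DerivativeTest.

(** * Phases that are combinations of inverse powers *)

Section InversePowers.
Variable R : realType.

Definition invpow (j t : nat) : R := (t%:R ^+ j)^-1.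

(** The sign is chosen so that all the differences of [invpow j] are nonnegative. *)
Definition alt_diff (k : nat) (f : nat -> R) (t : nat) : R :=
  (-1) ^+ k * iter k (@fdiff R) f t.

Lemma alt_diffS k f t : alt_diff k.+1 f t = alt_diff k f t - alt_diff k f t.+1.
Proof. by rewrite /alt_diff iterS /fdiff exprS; ring. Qed.

Lemma alt_diff_sum k J (z : 'I_J -> R) (g : 'I_J -> nat -> R) t :
  alt_diff k (fun t => \sum_(j < J) z j * g j t) t =
    \sum_(j < J) z j * alt_diff k (g j) t.
Proof.
elim: k t => [|k IHk] t.
  by rewrite /alt_diff expr0 mul1r; apply: eq_bigr => j _; rewrite mul1r.
rewrite alt_diffS !IHk -sumrB; apply: eq_bigr => j _.
by rewrite alt_diffS mulrBr.
Qed.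

Lemma alt_diffZ k (c : R) f t : alt_diff k (fun t => c * f t) t = c * alt_diff k f t.
Proof.
elim: k t => [|k IHk] t; first by rewrite /alt_diff !expr0 !mul1r.
by rewrite !alt_diffS !IHk mulrBr.
Qed.

(** The Leibniz rule for the product [t * t ^ -(j + 1) = t ^ -j]. *)
Lemma alt_diff_invpowS k j t : (0 < t)%N ->
  t%:R * alt_diff k (invpow j.+1) t =
    alt_diff k (invpow j) t + k%:R * alt_diff k.-1 (invpow j.+1) t.+1.
Proof.
elim: k t => [|k IHk] t t0.
  rewrite /alt_diff /= mul0r addr0 !expr0 !mul1r /invpow exprS invfM mulrA.
  by rewrite mulfV ?mul1r// pnatr_eq0 -lt0n.
rewrite !alt_diffS mulrBr IHk//=.
have := IHk t.+1 isT; rewrite -{1}[t.+1]addn1 natrD.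
case: k {IHk} => [|k] /=; first by rewrite !mul0r !addr0; lra.
rewrite (alt_diffS k (invpow j.+1) t.+1) mulrDl mul1r => h.
set v := alt_diff k _ t.+1 - _ in h *.
have -> : t%:R * v = alt_diff k.+1 (invpow j) t.+1
    + k.+1%:R * alt_diff k (invpow j.+1) t.+2 - v by rewrite -h addrK.
by rewrite /v; ring.
Qed.

Lemma alt_diff_invpow0 k t : alt_diff k (invpow 0) t = (k == 0%N)%:R.
Proof.
case: k => [|k]; first by rewrite /alt_diff /= /invpow !expr0 invr1 mul1r.
rewrite /=; elim: k t => [|k IHk] t.
  by rewrite alt_diffS /alt_diff /= /invpow !expr0 !mul1r subrr.
by rewrite alt_diffS (IHk t) (IHk t.+1) subrr.
Qed.

(** The upper bound is the size of the derivative of order [k]; [alt_diff_invpowS]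
    gives it, together with the sign, by induction on [j] and then on [k]. *)
Lemma alt_diff_invpow_le k j t : (0 < t)%N ->
  0 <= alt_diff k (invpow j) t <= (j + k)`!%:R / t%:R ^+ (j + k).
Proof.
elim: j k t => [|j IHj] k t t0.
  rewrite alt_diff_invpow0; case: k => [|k] /=; last by rewrite lexx divr_ge0// exprn_ge0.
  by rewrite expr0 divr1 ler01 lexx.
elim: k t t0 => [|k IHk] t t0;
  have tR : (0 : R) < t%:R by rewrite ltr0n.
  rewrite addn0 /alt_diff /= expr0 mul1r /invpow invr_ge0 exprn_ge0//=.
  by rewrite ler_pdivlMr ?exprn_gt0// mulVf ?expf_neq0 ?gt_eqF// ler1n fact_gt0.
have E := alt_diff_invpowS k.+1 j t0.
have /andP[h1 h2] := IHj k.+1 t t0.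
have /andP[h3 h4] := IHk t.+1 isT.
apply/andP; split.
  by rewrite -(pmulr_rge0 _ tR) E /= addr_ge0// mulr_ge0.
rewrite -(ler_pM2l tR) E /=.
have -> : t%:R * ((j.+1 + k.+1)`!%:R / t%:R ^+ (j.+1 + k.+1)) =
   (j.+1 + k.+1)`!%:R / t%:R ^+ (j + k.+1) :> R.
  by rewrite addSn exprS invfM mulrCA mulVKf ?gt_eqF.
apply: le_trans (_ : (j + k.+1)`!%:R / t%:R ^+ (j + k.+1) + k.+1%:R * ((j + k.+1)`!%:R / t%:R ^+ (j + k.+1)) <= _).
  apply: lerD => //; rewrite ler_wpM2l//; apply: le_trans h4 _.
  rewrite addSnnS ler_wpM2l// lef_pV2 ?posrE ?exprn_gt0 ?ltr0n//.
  by rewrite lerXn2r ?nnegrE// ler_nat.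
rewrite mulrA -mulrDl ler_wpM2r ?invr_ge0 ?exprn_ge0//.
rewrite addSn factS mulSn natrD lerD2l -natrM ler_nat leq_mul2r.
by rewrite leq_addl orbT.
Qed.

Lemma alt_diff_invpow_ge k j t : (0 < t)%N ->
  ((t + k)%:R ^+ (j.+1 + k))^-1 <= alt_diff k (invpow j.+1) t.
Proof.
have tkR t' k' : (0 < t')%N -> (0 : R) < (t' + k')%:R by move=> ?; rewrite ltr0n; lia.
have step (A B : R) k' j' t' : (0 < t')%N -> ((t' + k')%:R ^+ j')^-1 <= A ->
    t'%:R * B >= A -> ((t' + k')%:R ^+ j'.+1)^-1 <= B.
  move=> t0 hA hB; have tR : (0 : R) < t'%:R by rewrite ltr0n.
  rewrite -(ler_pM2l tR); apply: le_trans hB; apply: le_trans hA.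
  rewrite exprS invfM mulrA ler_piMl ?invr_ge0 ?exprn_ge0//.
  by rewrite ler_pdivrMr ?mul1r ?ler_nat ?leq_addr// tkR.
elim: j k t => [|j IHj] k t t0; last first.
  have := alt_diff_invpowS k j.+1 t0 => E.
  apply: (step (alt_diff k (invpow j.+1) t) _ k (j.+1 + k)%N t t0); first exact: IHj.
  rewrite E lerDl mulr_ge0//.
  by have /andP[] := alt_diff_invpow_le k.-1 j.+2 (isT : 0 < t.+1)%N.
elim: k t t0 => [|k IHk] t t0.
  by rewrite addn0 /alt_diff /= mul1r addn0 expr1.
apply: (step (alt_diff k (invpow 1) t.+1) _ k.+1 k.+1 t t0).
  by have := IHk t.+1 isT; rewrite addSnnS.
rewrite alt_diff_invpowS// alt_diff_invpow0 add0r /=.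
rewrite ler_peMl ?ler1n//.
by have /andP[] := alt_diff_invpow_le k 1 (isT : 0 < t.+1)%N.
Qed.

End InversePowers.

Section PowerSums.
Variable R : realType.

Definition phase (J : nat) (z : 'I_J -> R) (t : nat) : R :=
  \sum_(j < J) z j * invpow R j.+1 t.

(** The terms other than the dominating one contribute at most [J] times a
    multiple of [T / Y], which a large [Y] makes less than half of the lower bound
    [alt_diff_invpow_ge] for that one. *)
Lemma alt_diff_phase (J K : nat) : exists2 C : R, 1 <= C &
  forall (z : 'I_J -> R) (j0 : 'I_J) (M t k : nat) (Y T : R),
  C <= Y -> (K <= M)%N -> (k <= K)%N -> (0 < M)%N -> (M <= t < 2 * M)%N ->
  0 <= z j0 -> T = z j0 / M%:R ^+ j0.+1 ->
  (forall j, j != j0 -> `|z j| / M%:R ^+ j.+1 <= T / Y) ->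
  C^-1 * (T / M%:R ^+ k) <= alt_diff k (phase z) t <= C * (T / M%:R ^+ k).
Proof.
pose F : R := (J + K)`!%:R.
have F1 : 1 <= F by rewrite ler1n fact_gt0.
pose C : R := 2 * (J.+1)%:R * F * 3 ^+ (J + K).
have E1 : 1 <= 3 ^+ (J + K) :> R by rewrite exprn_ege1// ler1n.
have J1 : 1 <= J.+1%:R :> R by rewrite ler1n.
have C1 : 1 <= C.
  rewrite /C; have : 1 <= 2 * J.+1%:R :> R by lra.
  by move=> h; apply: mulr_ege1 => //; apply: mulr_ege1.
exists C => // z j0 M t k Y T CY KM kK M0 /andP[Mt tM] z0 TE dom.
have t0 : (0 < t)%N by apply: leq_trans Mt.
have MR : (0 : R) < M%:R by rewrite ltr0n.
have Y0 : 0 < Y by lra.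
have T0 : 0 <= T by rewrite TE divr_ge0// exprn_ge0.
have up (j : 'I_J) : M%:R ^+ j.+1 * alt_diff k (invpow R j.+1) t <= F / M%:R ^+ k.
  have /andP[_ h] := alt_diff_invpow_le R k j.+1 t0.
  apply: le_trans (_ : M%:R ^+ j.+1 * (F / M%:R ^+ (j.+1 + k)) <= _).
    rewrite ler_wpM2l ?exprn_ge0//; apply: le_trans h _.
    apply: ler_pM; rewrite ?invr_ge0 ?exprn_ge0//.
      by rewrite ler_nat leq_fact// leq_add.
    rewrite lef_pV2 ?posrE ?exprn_gt0 ?ltr0n//.
    by rewrite lerXn2r ?nnegrE ?ler_nat.
  by rewrite exprD invfM mulrCA mulVKf ?expf_neq0 ?gt_eqF.
have nn (j : 'I_J) : 0 <= alt_diff k (invpow R j.+1) t.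
  by have /andP[] := alt_diff_invpow_le R k j.+1 t0.
have lo : 3 ^- (J + K) * (T / M%:R ^+ k) <= z j0 * alt_diff k (invpow R j0.+1) t.
  have h := alt_diff_invpow_ge R k j0 t0.
  have zE : z j0 = T * M%:R ^+ j0.+1 by rewrite TE mulfVK// expf_neq0 ?gt_eqF.
  rewrite zE -mulrA [leLHS]mulrCA ler_wpM2l//.
  apply: le_trans (_ : M%:R ^+ j0.+1 * ((3 * M)%:R ^+ (j0.+1 + k))^-1 <= _).
    have -> : M%:R ^+ j0.+1 * ((3 * M)%:R ^+ (j0.+1 + k))^-1 =
        3 ^- (j0.+1 + k) * M%:R ^- k :> R.
      rewrite natrM exprMn invfM mulrCA (exprD M%:R) invfM.
      by rewrite mulVKf ?expf_neq0 ?gt_eqF.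
    rewrite ler_wpM2r ?invr_ge0 ?exprn_ge0//.
    rewrite lef_pV2 ?posrE ?exprn_gt0//.
    by rewrite ler_weXn2l ?ler1n// leq_add.
  rewrite ler_wpM2l ?exprn_ge0//; apply: le_trans h.
  rewrite lef_pV2 ?posrE ?exprn_gt0 ?ltr0n ?muln_gt0 ?addn_gt0 ?t0//.
  rewrite lerXn2r ?nnegrE ?ler_nat//.
  by clear -Mt tM KM kK; lia.
(* The other terms, each smaller by the factor [Y]. *)
have rest : `|\sum_(j < J | j != j0) z j * alt_diff k (invpow R j.+1) t| <=
    J%:R * (F / Y) * (T / M%:R ^+ k).
  apply: le_trans (ler_norm_sum _ _ _) _.
  apply: le_trans (_ : \sum_(j < J) (F / Y) * (T / M%:R ^+ k) <= _); last first.
    by rewrite sumr_const card_ord -[leLHS]mulr_natl [leLHS]mulrA.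
  rewrite big_mkcond; apply: ler_sum => j _; case: ifPn => [jj0|_]; last first.
    by rewrite mulr_ge0 ?divr_ge0 ?exprn_ge0//; lra.
  have d := dom _ jj0.
  rewrite normrM [X in _ * X]ger0_norm//.
  have -> : `|z j| = (`|z j| / M%:R ^+ j.+1) * M%:R ^+ j.+1.
    by rewrite mulfVK// expf_neq0 ?gt_eqF.
  rewrite -(mulrA (`|z j| / M%:R ^+ j.+1)).
  have -> : F / Y * (T / M%:R ^+ k) = T / Y * (F / M%:R ^+ k) by rewrite mulrACA [F * T]mulrC -mulrACA.
  apply: ler_pM => //.
    by rewrite divr_ge0 ?exprn_ge0.
  by rewrite mulr_ge0 ?exprn_ge0.
rewrite /phase alt_diff_sum (bigD1 j0)//=.
set A := z j0 * _ in lo *; set B := \sum_(_ < _ | _) _ in rest *.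
set X := T / M%:R ^+ k in lo rest *.
have X0 : 0 <= X by rewrite divr_ge0// exprn_ge0.
have hA : A <= F * X.
  rewrite /A; have -> : z j0 = T * M%:R ^+ j0.+1 by rewrite TE mulfVK// expf_neq0 ?gt_eqF.
  by rewrite -mulrA /X [leRHS]mulrCA ler_wpM2l.
pose G : R := 3 ^+ (J + K).
have G0 : 0 < G by rewrite /G; lra.
have JY : J%:R * (F / Y) <= (2 * G)^-1.
  rewrite mulrA ler_pdivrMr// ler_pdivlMl ?mulr_gt0//; apply: le_trans CY.
  rewrite /C -natr1 -/G; have : 0 <= J%:R :> R by []. 
  have : 0 < F by lra.
  by move=> *; nra.
have hB : `|B| <= (2 * G)^-1 * X by apply: le_trans rest _; rewrite ler_wpM2r.
have : - (2 * G)^-1 * X <= B <= (2 * G)^-1 * X by rewrite mulNr -ler_norml.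
move=> /andP[hB1 hB2].
have GV : G^-1 = 2 * (2 * G)^-1 by field; rewrite gt_eqF.
have lo' : G^-1 * X <= A by [].
have CG : C^-1 <= (2 * G)^-1.
  rewrite lef_pV2 ?posrE ?mulr_gt0//; try lra.
  rewrite /C -/G ler_wpM2r ?(ltW G0)// -mulrA ler_peMr// mulr_ege1//.
have CF : F + (2 * G)^-1 <= C.
  have h1 : (2 * G)^-1 <= 1.
    rewrite -[leRHS]invr1 lef_pV2 ?posrE ?mulr_gt0//.
    have : 1 <= G by []. 
    lra.
  apply: le_trans (_ : 2 * F <= _); first lra.
  have h2 : 1 <= G * J.+1%:R by rewrite mulr_ege1.
  have -> : C = (2 * F) * (G * J.+1%:R) by rewrite /C -/G; ring.
  by rewrite ler_peMr//; lra.
apply/andP; split.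
  apply: le_trans (_ : (2 * G)^-1 * X <= _); first by rewrite ler_wpM2r.
  move: lo'; rewrite GV; lra.
apply: le_trans (_ : (F + (2 * G)^-1) * X <= _); last by rewrite ler_wpM2r.
rewrite mulrDl lerD//.
Qed.

End PowerSums.

(** * Exponential sums over integers *)

Section PowerSumBound.
Variable R : realType.

Lemma cnorm_cexp_sumN (f : nat -> R) (a b : nat) :
  cnorm (\sum_(a <= m < b) cexp (- f m)) = cnorm (\sum_(a <= m < b) cexp (f m)).
Proof.
rewrite -cnorm_conj conjc_sum; congr cnorm.
by apply: eq_bigr => m _; rewrite -cexpN opprK.
Qed.

(** The shifts of Weyl differencing will be shorter than [M] by the factor
    [Y ^ r]; dividing the total phase [T] by [(Y ^ r) ^ K] must give a number
    between [Y ^ E] and [M / Y]. The least [r] for the second bound also satisfies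
    the first one. *)
Lemma choose_shift (K E : nat) (Y M T : R) : (0 < K)%N -> 2 <= Y ->
  let D := (E + K.+1 + K * (2 ^ K).+1)%N in
  Y ^+ D <= M -> Y ^+ D <= T -> T <= M ^+ K.-1 ->
  exists r : nat, [/\ Y ^+ E * (Y ^+ r) ^+ K <= T, T <= M / Y * (Y ^+ r) ^+ K &
     Y ^+ (2 ^ K).+1 * Y ^+ r <= M].
Proof.
move=> K0 Y2 D DM DT TM.
have Y0 : 0 < Y by lra.
have Y1 : 1 <= Y by lra.
have M0 : 0 < M by apply: lt_le_trans DM; apply: exprn_gt0.
have M1 : 1 <= M by apply: le_trans DM; apply: exprn_ege1.
have wm n : (n <= D)%N -> Y ^+ n <= M.
  by move=> nD; apply: le_trans DM; apply: ler_weXn2l.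
(* Some power of [Y] is large enough, as [Y ^ r >= 2 ^ r > r]. *)
have exr : exists r, T <= M / Y * (Y ^+ r) ^+ K.
  pose r := Num.truncn (T / (M / Y)); exists r.+1.
  rewrite -ler_pdivrMl ?divr_gt0// mulrC.
  apply: le_trans (ltW (truncnS_gt _)) _; rewrite -/r.
  apply: le_trans (_ : 2 ^+ r.+1 <= _).
    by rewrite -natrX ler_nat ltnW// ltn_expl.
  apply: le_trans (_ : Y ^+ r.+1 <= _); first by rewrite lerXn2r ?nnegrE; lra.
  by apply: ler_eXnr => //; apply: exprn_ege1.
case: (ex_minnP exr) => r hr rmin; exists r; split => //.
  case: r hr rmin => [|r] hr rmin.
    rewrite expr0 expr1n mulr1; apply: le_trans DT; apply: ler_weXn2l => //.
    by rewrite /D -addnA leq_addr.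
  have {}rmin : M / Y * (Y ^+ r) ^+ K < T.
    by rewrite ltNge; apply/negP => /rmin; rewrite ltnn.
  apply: le_trans (ltW rmin).
  rewrite exprSr exprMn mulrCA [leRHS]mulrC ler_wpM2l ?exprn_ge0 ?(ltW Y0)//.
  rewrite ler_pdivlMr// -exprD -exprSr; apply: wm.
  by rewrite /D addnS leq_addr.
case: r hr rmin => [|r] hr rmin.
  rewrite expr0 mulr1; apply: wm; rewrite /D.
  by apply: leq_trans (leq_addl _ _); rewrite leq_pmull.
have {}rmin : M / Y * (Y ^+ r) ^+ K < T.
  by rewrite ltNge; apply/negP => /rmin; rewrite ltnn.
have h1 : M / Y * (Y ^+ r) ^+ K <= M ^+ K.-1 by apply: le_trans (ltW rmin) TM.
rewrite -(@ler_pXn2r _ K)// ?nnegrE ?mulr_ge0 ?exprn_ge0 ?(ltW Y0) ?(ltW M0)//.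
have -> : M ^+ K = M * M ^+ K.-1 by rewrite -exprS prednK.
apply: le_trans (ler_wpM2l (ltW M0) h1).
set A := Y ^+ (2 ^ K).+1.
have -> : (A * Y ^+ r.+1) ^+ K = A ^+ K * Y ^+ K * (Y ^+ r) ^+ K.
  by rewrite exprSr !exprMn mulrA mulrAC.
rewrite [leRHS]mulrA ler_wpM2r ?exprn_ge0 ?(ltW Y0)//.
rewrite [leRHS]mulrA ler_pdivlMr//.
apply: le_trans (_ : M <= _); last by rewrite ler_peMl// ltW.
rewrite /A -exprM -exprD -exprSr; apply: wm.
by rewrite /D mulnC; clear; lia.
Qed.

(** The differences of the phase are comparable to those of its dominating term
    ([alt_diff_phase]), so that [difference_test] applies. Its order [K = B.+1] is
    such that the size of the phase, at most [M ^ B], is reduced below [M] by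
    shifts that are still long; the exact length of the shifts comes from
    [choose_shift]. *)
Lemma power_sum_le (J B : nat) : exists (D : nat) (C : R), 2 <= C /\
  forall (z : 'I_J -> R) (j0 : 'I_J) (M Y a b : nat),
  C <= Y%:R -> (Y ^ D <= M)%N -> (M <= a)%N -> (b <= 2 * M)%N ->
  let T := `|z j0| / M%:R ^+ j0.+1 in
  Y%:R ^+ D <= T -> T <= M%:R ^+ B ->
  (forall j, j != j0 -> `|z j| / M%:R ^+ j.+1 <= T / Y%:R) ->
  cnorm (\sum_(a <= t < b) cexp (phase z t)) <= C * M%:R / Y%:R.
Proof.
pose K := B.+1.
have [C1 C11 hC1] := alt_diff_phase R J K.+2.
have [C2 C20 hC2] := @difference_test R (C1 ^+ 2) K.
pose E := (6 * 2 ^ K)%N.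
pose D := (E + K.+1 + K * (2 ^ K).+1)%N.
pose C : R := 2 ^+ K.+1 * C1 + C2 + 2.
have p2 : 2 <= 2 ^+ K.+1 :> R.
  by rewrite exprS ler_pMr// exprn_ege1// ler1n.
exists D, C; split.
  by rewrite /C; have : 0 <= 2 ^+ K.+1 * C1 by [rewrite mulr_ge0//; lra]; lra.
move=> z j0 M Y a b CY DM Ma bM T DT TM dom.
have CY1 : 2 ^+ K.+1 * C1 <= Y%:R by move: CY; rewrite /C; lra.
have Y2 : (2 : R) <= Y%:R.
  by apply: le_trans CY; rewrite /C; have : 0 <= 2 ^+ K.+1 * C1 by [rewrite mulr_ge0//; lra]; lra.
have CY2 : C2 * M%:R / Y%:R <= C * M%:R / Y%:R.
  rewrite ler_wpM2r ?invr_ge0// ler_wpM2r// /C.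
  by have : 0 <= 2 ^+ K.+1 * C1 by [rewrite mulr_ge0//; lra]; lra.
apply: le_trans CY2.
suff main z' : 0 <= z' j0 -> (forall j, `|z' j| = `|z j|) ->
    cnorm (\sum_(a <= t < b) cexp (phase z' t)) <= C2 * M%:R / Y%:R.
  have [zj0|/ltW zj0] := leP 0 (z j0); first exact: main.
  rewrite -cnorm_cexp_sumN.
  have -> : \sum_(a <= m < b) cexp (- phase z m) =
      \sum_(a <= t < b) cexp (phase (fun j => - z j) t).
    apply: eq_bigr => t _; congr cexp; rewrite /phase -sumrN.
    by apply: eq_bigr => j _; rewrite mulNr.
  by apply: main => [|j]; rewrite ?oppr_ge0// normrN.
move=> z0 zn.
have TE : T = z' j0 / M%:R ^+ j0.+1 by rewrite /T -zn ger0_norm.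
have {}dom j : j != j0 -> `|z' j| / M%:R ^+ j.+1 <= T / Y%:R.
  by move=> jj0; rewrite zn dom.
have DM' : Y%:R ^+ D <= M%:R :> R by rewrite -natrX ler_nat.
have [r [r1 r2 r3]] := @choose_shift K E Y%:R M%:R T isT Y2 DM' DT TM.
have Y0 : (0 : R) < Y%:R by lra.
have Y1 : (1 : R) <= Y%:R by lra.
have Yn : (2 <= Y)%N by rewrite -(ler_nat R).
have M0 : (0 < M)%N by apply: leq_trans DM; rewrite expn_gt0; apply/orP; left; apply: ltnW.
have MR : (0 : R) < M%:R by rewrite ltr0n.
have T0 : 0 < T by apply: lt_le_trans DT; apply: exprn_gt0.
have KM : (K.+2 <= M)%N.
  apply: leq_trans DM; apply: leq_trans (_ : 2 ^ D <= _)%N; last by rewrite leq_exp2r// /D addnS addSn.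
  apply: leq_trans (ltnW (ltn_expl K.+2 (ltnSn 1))) _.
  rewrite leq_exp2l// /D /E; clear.
  by have := expn_gt0 2 K; lia.
have CY1' : C1 <= Y%:R.
  by apply: le_trans CY1; rewrite ler_peMl//; lra.
have diff t k : (k <= K.+2)%N -> (M <= t < 2 * M)%N ->
    C1^-1 * (T / M%:R ^+ k) <= alt_diff k (phase z') t <= C1 * (T / M%:R ^+ k).
  by move=> kK ht; apply: hC1 dom.
(* [difference_test] needs a positive difference of order [K.+1]: conjugate the
   sum when this order is odd. *)
pose s : R := (-1) ^+ K.+1.
have iterE t : iter K.+1 (@fdiff R) (fun t => s * phase z' t) t = alt_diff K.+1 (phase z') t.
  apply: (mulfI (_ : s != 0)); first by rewrite /s signr_eq0.
  exact: (alt_diffZ K.+1 s (phase z') t).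
have -> : cnorm (\sum_(a <= t < b) cexp (phase z' t)) =
    cnorm (\sum_(a <= t < b) cexp (s * phase z' t)).
  rewrite /s -signr_odd; case: odd; rewrite ?expr1 ?expr0.
    rewrite -cnorm_cexp_sumN; congr cnorm; apply: eq_bigr => t _.
    by rewrite mulN1r.
  by congr cnorm; apply: eq_bigr => t _; rewrite mul1r.
pose rho := (Y ^ r)%N.
have rhoE : rho%:R = Y%:R ^+ r :> R by rewrite natrX.
have rho0 : (0 < rho)%N by rewrite expn_gt0 (ltnW Yn).
have rhoR : (0 : R) < rho%:R by rewrite ltr0n.
rewrite -rhoE in r1 r2 r3.
pose H := (M %/ rho)%N.
have Hup : H%:R <= M%:R / rho%:R :> R.
  by rewrite ler_pdivlMr// -natrM ler_nat leq_divM.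
have rM : Y%:R ^+ (2 ^ K) * 2 <= M%:R / rho%:R :> R.
  rewrite ler_pdivlMr//; apply: le_trans r3; rewrite ler_wpM2r// exprSr.
  by rewrite ler_wpM2l// exprn_ge0.
have Hlo : M%:R / rho%:R <= 2 * H%:R :> R.
  have h : M%:R / rho%:R < H.+1%:R :> R.
    by rewrite ltr_pdivrMr// -natrM ltr_nat ltn_ceil.
  have h2 : 2 <= M%:R / rho%:R :> R.
    by apply: le_trans rM; rewrite ler_peMl// exprn_ege1.
  have : 1 < H.+1%:R :> R by lra.
  rewrite ltr1n ltnS => h3; have h4 : 1 <= H%:R :> R by rewrite ler1n.
  by move: h; rewrite -natr1; lra.
have HY : Y%:R ^+ (2 ^ K) <= H%:R :> R by lra.
have H1 : 1 <= H%:R :> R by apply: le_trans HY; apply: exprn_ege1.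
have HM : (0 < H <= M)%N.
  by rewrite -(ltr_nat R) (lt_le_trans ltr01 H1) leq_div.
have C1C1 : C1^-1 * C1 = 1 by rewrite mulVf ?gt_eqF//; lra.
have TM0 k : 0 < T / M%:R ^+ k by rewrite divr_gt0// exprn_gt0.
have C10 : 0 < C1 by apply: lt_le_trans C11.
have C1V : C1^-1 <= C1 by apply: le_trans (_ : 1 <= _) => //; rewrite invf_le1.
apply: (hC2 _ _ _ _ H _ (C1^-1 * (T / M%:R ^+ K.+1)) (C1 * (T / M%:R ^+ K.+1))) => //.
- by rewrite leq_subLR; apply: leq_trans bM _; rewrite mul2n -addnn leq_add2r.
- by rewrite mulr_gt0// invr_gt0; lra.
- by rewrite ler_wpM2r// ltW.
- by rewrite [leRHS]mulrA expr2 mulfK// gt_eqF.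
- apply: le_trans (_ : (M%:R / rho%:R) ^+ K * (C1 * (T / M%:R ^+ K.+1)) <= _).
    apply: ler_wpM2r; first by rewrite mulr_ge0 ?(ltW (TM0 _)) ?(ltW C10).
    by rewrite lerXn2r ?nnegrE// divr_ge0.
  apply: le_trans (_ : (M%:R / rho%:R) ^+ K * (C1 * ((M%:R / Y%:R * rho%:R ^+ K) / M%:R ^+ K.+1)) <= _).
    apply: ler_wpM2l; first by rewrite exprn_ge0 ?divr_ge0.
    apply: ler_wpM2l; first exact: ltW.
    by apply: ler_wpM2r => //; rewrite invr_ge0 exprn_ge0.
  have -> : (M%:R / rho%:R) ^+ K * (C1 * ((M%:R / Y%:R * rho%:R ^+ K) / M%:R ^+ K.+1)) = C1 / Y%:R.
    rewrite expr_div_n exprS; field.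
    by rewrite !expf_neq0 ?gt_eqF.
  rewrite ler_pdivrMr// ler_pdivlMl//; apply: le_trans CY1; rewrite ler_wpM2r//; lra.
- apply: le_trans (_ : C1^-1 * (T / M%:R ^+ K.+1) * ((M%:R / rho%:R) / 2) ^+ K * M%:R * Y%:R ^+ 2 <= _); last first.
    rewrite ler_wpM2r ?exprn_ge0// ler_wpM2r// ler_wpM2l//.
      by rewrite mulr_ge0 ?invr_ge0 ?(ltW (TM0 _)) ?(ltW C10).
    by rewrite lerXn2r ?nnegrE ?divr_ge0//; lra.
  have -> : C1^-1 * (T / M%:R ^+ K.+1) * ((M%:R / rho%:R) / 2) ^+ K * M%:R * Y%:R ^+ 2 =
      (T / rho%:R ^+ K) * (Y%:R ^+ 2 / (C1 * 2 ^+ K)).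
    rewrite !expr_div_n exprS; field.
    by rewrite !expf_neq0 ?gt_eqF//; lra.
  apply: le_trans (_ : T / rho%:R ^+ K <= _).
    by rewrite ler_pdivlMr// exprn_gt0.
  rewrite ler_peMr ?divr_ge0 ?exprn_ge0 ?(ltW T0)//.
  rewrite ler_pdivlMr ?mul1r ?mulr_gt0 ?exprn_gt0//.
  apply: le_trans (_ : Y%:R <= _); last by apply: ler_eXnr.
  apply: le_trans CY1; rewrite mulrC ler_wpM2r ?(ltW C10)//.
  by rewrite exprS ler_peMl ?exprn_ge0// ler1n.
- move=> m /andP[am mb]; rewrite iterE; apply: diff => //.
  by rewrite (leq_trans Ma am) (leq_trans mb bM).
- move=> m am mb; rewrite !iterE -subr_ge0 -alt_diffS.
  have /andP[h _] : C1^-1 * (T / M%:R ^+ K.+2) <= alt_diff K.+2 (phase z') m <= C1 * (T / M%:R ^+ K.+2).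
    by apply: diff => //; rewrite (leq_trans Ma am) (leq_trans (ltnW mb) bM).
  by apply: le_trans h; rewrite mulr_ge0 ?invr_ge0 ?(ltW (TM0 _))//; lra.
Qed.

End PowerSumBound.

(** * Arithmetic functions and Vaughan's identity *)

Section DivisorSums.

Lemma sum_multiples (V : nmodType) (d a b : nat) (F : nat -> V) : (0 < d)%N ->
  \sum_(a.+1 <= n < b.+1 | (d %| n)%N) F n =
    \sum_((a %/ d).+1 <= k < (b %/ d).+1) F (d * k)%N.
Proof.
move=> d0; have [ba|/ltnW] := leqP b a.
  by rewrite !big_geq// ltnS// leq_div2r.
elim: b => [|b IHb]; first by rewrite leqn0 => /eqP ->; rewrite !big_geq.
rewrite leq_eqVlt => /predU1P[->|]; first by rewrite !big_geq.
rewrite ltnS => ab; rewrite big_mkcond big_nat_recr// -big_mkcond /= IHb//.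
rewrite [(b.+1 %/ d)%N]divnS//; case: ifPn => db; last by rewrite add0n addr0.
rewrite add1n [in RHS]big_nat_recr ?ltnS ?leq_div2r//=.
congr (_ + F _); rewrite -[LHS](divnK db) mulnC; congr (_ * _)%N.
by rewrite divnS// db add1n.
Qed.

Lemma sum_divisors_widen (V : nmodType) (n N : nat) (F : nat -> V) :
  (0 < n)%N -> (n <= N)%N ->
  \sum_(1 <= d < N.+1 | (d %| n)%N) F d = \sum_(1 <= d < n.+1 | (d %| n)%N) F d.
Proof.
move=> n0 nN; rewrite (@big_cat_nat _ _ _ n.+1)//= [X in _ + X]big_nat_cond.
rewrite [X in _ + X]big_pred0 ?addr0// => d.
by apply/negP => /andP[/andP[nd _] /(dvdn_leq n0)]; rewrite leqNgt nd.
Qed.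

End DivisorSums.

Section Moebius.

Definition moebius (n : nat) : int :=
  if all (fun p => logn p n == 1%N) (primes n) then (-1) ^+ size (primes n) else 0.

Lemma moebius_norm n : `|moebius n| <= 1.
Proof. by rewrite /moebius; case: ifP => _; rewrite ?normr0// normrX normrN1 expr1n. Qed.

Lemma moebiusMp p d : prime p -> (0 < d)%N -> ~~ (p %| d)%N ->
  moebius (p * d) = - moebius d.
Proof.
move=> pp d0 pd; have p0 := prime_gt0 pp.
have ppd : p \notin primes d by rewrite mem_primes pp d0.
have per : perm_eq (primes (p * d)) (p :: primes d).
  apply: uniq_perm; rewrite /= ?ppd ?primes_uniq//.
  by move=> q; rewrite primesM// primes_prime// !inE.
rewrite /moebius (perm_all _ per) (perm_size per) /= exprS mulN1r.
rewrite lognM// (logn_prime _ pp) eqxx lognE pp d0 (negPf pd) addn0 eqxx /=.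
have -> : all (fun q => logn q (p * d) == 1%N) (primes d) =
   all (fun q => logn q d == 1%N) (primes d).
  apply: eq_in_all => q qd; rewrite lognM// (logn_prime _ pp).
  case: (eqVneq q p) qd => [->|_] qd; last by rewrite add0n.
  by rewrite qd in ppd.
by case: ifP => // _; rewrite oppr0.
Qed.

Lemma moebius_sqr p d : prime p -> (0 < d)%N -> (p ^ 2 %| d)%N -> moebius d = 0.
Proof.
move=> pp d0 pd; rewrite /moebius; case: ifPn => // /allP /(_ p).
rewrite mem_primes pp d0 (dvdn_trans (dvdn_exp2l p (isT : 1 <= 2)%N) pd) => /(_ isT).
by move=> /eqP h; move: pd; rewrite pfactor_dvdn// h.
Qed.

(** Pair each divisor prime to [p] with its multiple by [p]. *)
Lemma sum_moebius n : (0 < n)%N ->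
  \sum_(1 <= d < n.+1 | (d %| n)%N) moebius d = (n == 1%N)%:R.
Proof.
move=> n0; have [->|n1] := eqVneq n 1%N; first by rewrite big_mkcond big_nat1.
have n1' : (1 < n)%N by case: n n0 n1 => [|[]].
pose p := pdiv n; have pp : prime p by apply: pdiv_prime.
have p0 := prime_gt0 pp.
have pn : (p %| n)%N := pdiv_dvd n.
rewrite (bigID (fun d => (p %| d)%N)) /=.
have -> : \sum_(1 <= d < n.+1 | (d %| n)%N && (p %| d)%N) moebius d =
   - \sum_(1 <= d < n.+1 | (d %| n)%N && ~~ (p %| d)%N) moebius d; last exact: addNr.
rewrite big_mkcondl sum_multiples// div0n.
rewrite -sumrN [RHS](@big_cat_nat _ _ _ (n %/ p).+1)//=; last by rewrite ltnS leq_div.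
have np0 : (0 < n %/ p)%N by rewrite divn_gt0// dvdn_leq.
rewrite [X in _ = _ + X]big_nat_cond [X in _ = _ + X]big_pred0 ?addr0; last first.
  move=> d; apply/negP => /andP[/andP[h1 h2] /andP[dn pd]].
  have : (d %| n %/ p)%N.
    by rewrite -(@Gauss_dvdr d p) 1?mulnC ?divnK// coprime_sym prime_coprime.
  by move/(dvdn_leq np0); rewrite leqNgt h1.
rewrite [RHS]big_mkcond; apply: eq_big_nat => k /andP[k0 _].
have [pk|pk] := boolP (p %| k)%N; rewrite ?andbF ?andbT.
  rewrite (@moebius_sqr p)//; first by rewrite if_same.
    by rewrite muln_gt0 p0.
  by rewrite expnS expn1 dvdn_pmul2l.
rewrite Gauss_dvd ?prime_coprime// pn /=.
by case: ifP => // kn; rewrite moebiusMp.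
Qed.

End Moebius.

Section VonMangoldt.
Variable R : realType.

(** At most one pair [(p, j)] contributes, the one with [n = p ^ j.+1]. In this
    form the function can be summed over divisors by exchanging sums. *)
Definition vonMangoldt (n : nat) : R :=
  \sum_(0 <= p < n.+1 | prime p) \sum_(0 <= j < n | (p ^ j.+1 == n)%N) ln p%:R.

Lemma ln_nat_ge0 n : 0 <= ln n%:R :> R.
Proof. by case: n => [|n]; [rewrite ln0 | rewrite ln_ge0// ler1n]. Qed.

Lemma vonMangoldt_ge0 n : 0 <= vonMangoldt n.
Proof. by apply: sumr_ge0 => p _; apply: sumr_ge0 => j _; apply: ln_nat_ge0. Qed.

Lemma vonMangoldt_widen n N : (n <= N)%N -> vonMangoldt n =
  \sum_(0 <= p < N.+1 | prime p) \sum_(0 <= j < N | (p ^ j.+1 == n)%N) ln p%:R.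
Proof.
move=> nN; rewrite [RHS](@big_cat_nat _ _ _ n.+1)//=.
rewrite [X in _ = _ + X]big_nat_cond [X in _ = _ + X]big1 ?addr0; last first.
  move=> p /andP[/andP[np _] pp]; rewrite big1// => j /eqP pj.
  have : (p ^ 1 <= p ^ j.+1)%N by rewrite leq_exp2l// prime_gt1.
  by rewrite pj expn1 leqNgt np.
apply: eq_bigr => p pp.
rewrite [RHS](@big_cat_nat _ _ _ n)//= [X in _ = _ + X]big_nat_cond.
rewrite [X in _ = _ + X]big_pred0 ?addr0// => j.
apply/negP => /andP[/andP[nj _]] /eqP pj.
have := ltn_expl j.+1 (prime_gt1 pp); rewrite pj ltnNge => /negP; apply.
exact: leqW.
Qed.

Lemma ln_prod_nat (I : Type) (r : seq I) (P : pred I) (F : I -> nat) :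
  (forall i, P i -> (0 < F i)%N) ->
  ln (\prod_(i <- r | P i) F i)%N%:R = \sum_(i <- r | P i) ln (F i)%:R :> R.
Proof.
move=> F0.
suff [] : (0 < \prod_(i <- r | P i) F i)%N /\
  ln (\prod_(i <- r | P i) F i)%N%:R = \sum_(i <- r | P i) ln (F i)%:R :> R by [].
elim/big_rec2: _ => [|i x y Pi [y0 IH]]; first by rewrite ln1.
by rewrite muln_gt0 F0// y0 natrM lnM ?posrE ?ltr0n ?F0// IH.
Qed.

Lemma ln_prime_sum n N : (0 < n)%N -> (n <= N)%N ->
  ln n%:R = \sum_(0 <= p < N.+1 | prime p) (logn p n)%:R * ln p%:R :> R.
Proof.
move=> n0 nN; rewrite -{1}(partnT n0) /partn.
have -> : (\prod_(0 <= p < n.+1 | p \in predT) p ^ logn p n)%N =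
    (\prod_(0 <= p < N.+1 | prime p) p ^ logn p n)%N.
  rewrite [RHS](@big_cat_nat _ _ _ n.+1)//= [X in _ = (_ * X)%N]big_nat_cond.
  rewrite [X in _ = (_ * X)%N]big1 ?muln1.
    rewrite [RHS]big_mkcond; apply: eq_bigr => p _.
    by case: ifPn => // pp; rewrite lognE (negPf pp).
  move=> p /andP[/andP[np _] pp]; rewrite lognE pp n0 gtnNdvd//.
rewrite ln_prod_nat => [|p pp]; last by rewrite expn_gt0 prime_gt0.
apply: eq_bigr => p pp.
by rewrite natrX lnXn ?ltr0n ?prime_gt0// mulr_natl.
Qed.

Lemma sum_dvdn_prime_pow p n N : prime p -> (0 < n)%N -> (n <= N)%N ->
  (\sum_(0 <= j < N) (p ^ j.+1 %| n) = logn p n)%N.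
Proof.
move=> pp n0 nN; have lN : (logn p n <= N)%N.
  by apply: leq_trans nN; apply: ltnW; apply: ltn_logl.
rewrite (@big_cat_nat _ _ _ (logn p n))//= [X in (_ + X)%N]big_nat_cond.
rewrite [X in (_ + X)%N]big1 ?addn0; last first.
  move=> j /andP[/andP[lj _] _]; rewrite pfactor_dvdn//.
  by rewrite ltnNge lj.
rewrite (eq_big_nat _ _ (F2 := fun=> 1%N)); last first.
  by move=> j /andP[_ jl]; rewrite pfactor_dvdn// jl.
by rewrite sum_nat_const_nat muln1 subn0.
Qed.

Lemma sum_vonMangoldt n : (0 < n)%N ->
  \sum_(1 <= d < n.+1 | (d %| n)%N) vonMangoldt d = ln n%:R.
Proof.
move=> n0; rewrite (ln_prime_sum n0 (leqnn n)).
transitivity (\sum_(1 <= d < n.+1 | (d %| n)%N)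
   \sum_(0 <= p < n.+1 | prime p) \sum_(0 <= j < n | (p ^ j.+1 == d)%N) (ln p%:R : R)).
  rewrite [LHS]big_nat_cond [RHS]big_nat_cond; apply: eq_bigr => d /andP[/andP[_ dn] _].
  by rewrite (@vonMangoldt_widen _ n).
rewrite exchange_big /=; apply: eq_bigr => p pp.
rewrite -(sum_dvdn_prime_pow pp n0 (leqnn n)) natr_sum mulr_suml.
rewrite (exchange_big_dep xpredT) //=; apply: eq_bigr => j _.
have p0 : (0 < p ^ j.+1)%N by rewrite expn_gt0 prime_gt0.
rewrite (eq_bigl (fun d => (d %| n)%N && (d == p ^ j.+1)%N)); last first.
  by move=> d; rewrite [in RHS]eq_sym.
rewrite big_nat1_cond_eq p0 /= ltnS.
have [pn|] := boolP (p ^ j.+1 %| n)%N; last by rewrite andbF mul0r.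
by rewrite dvdn_leq// mul1r.
Qed.

Lemma vonMangoldt_le n : (0 < n)%N -> vonMangoldt n <= ln n%:R.
Proof.
move=> n0; rewrite -sum_vonMangoldt// big_mkcond big_nat_recr//= dvdnn lerDr.
by apply: sumr_ge0 => d _; case: ifP => // _; apply: vonMangoldt_ge0.
Qed.

Lemma sum_if_lt_le (m n t : nat) (c : R) : 0 <= c ->
  \sum_(m <= j < n) (if (j < t)%N then c else 0) <= t%:R * c.
Proof.
move=> c0; apply: le_trans (_ : (minn n t)%:R * c <= _); last first.
  by rewrite ler_wpM2r// ler_nat geq_minr.
elim: n => [|n IHn]; first by rewrite big_geq// mulr_ge0.
have [mn|nm] := leqP m n; last by rewrite big_geq// mulr_ge0.
rewrite big_nat_recr//=; case: ifPn => nt.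
  have -> : (minn n.+1 t = (minn n t).+1)%N by rewrite (minn_idPl nt) (minn_idPl (ltnW nt)).
  by rewrite -natr1 mulrDl mul1r lerD2r.
rewrite addr0; apply: le_trans IHn _; rewrite ler_wpM2r// ler_nat.
by rewrite leq_min (leq_trans (geq_minl n t) (leqnSn n)) geq_minr.
Qed.

(** There are at most [ln N / ln p] powers; none but the first is in the range
    when [p] exceeds the square root of [N], a fortiori when [p > N / Y]. *)
Lemma sum_prime_pow_le (p N Y : nat) : prime p -> (0 < N)%N -> (Y ^ 2 <= N)%N ->
  \sum_(1 <= j < N) (if (p ^ j.+1 <= N)%N then ln p%:R else 0 : R) <=
    if (p * Y <= N)%N then ln N%:R else 0.
Proof.
move=> pp N0 YN; have p1 := prime_gt1 pp.
case: leqP => pY; last first.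
  rewrite big_nat_cond big1// => j /andP[/andP[j1 _] _]; case: leqP => // h.
  have h1 : (p ^ 2 <= N)%N by apply: leq_trans h; rewrite leq_exp2l.
  have : (N ^ 2 < (p * Y) ^ 2)%N by rewrite ltn_exp2r.
  by rewrite expnMn ltnNge -[(N ^ 2)%N]mulnn leq_mul.
pose t := trunc_log p N.
have tN : (p ^ t <= N)%N by apply: trunc_logP.
have h : t%:R * ln p%:R <= ln N%:R :> R.
  rewrite mulr_natl -lnXn ?ltr0n ?(ltnW p1)// -natrX.
  by rewrite ler_ln ?posrE ?ltr0n ?ler_nat// expn_gt0 (ltnW p1).
apply: le_trans h; apply: le_trans (sum_if_lt_le 1 N t (ln_nat_ge0 p)).
apply: ler_sum => j _; case: (leqP (p ^ j.+1) N) => [pj|_]; last by case: ifP => // _; apply: ln_nat_ge0.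
by rewrite ifT// -/t; apply: (trunc_log_max p1 pj).
Qed.

(** The prime powers with exponent at least two contribute little: there are
    few of their bases, and for each base the logarithms add up to at most the
    logarithm of the end of the range. *)
Lemma vonMangoldt_primes (g : nat -> R[i]) (N N' Y : nat) :
  (forall n, cnorm (g n) <= 1) -> (0 < Y)%N -> (Y ^ 2 <= N')%N ->
  cnorm (\sum_(N.+1 <= n < N'.+1) (vonMangoldt n)%:C%C * g n
    - \sum_(N.+1 <= p < N'.+1 | prime p) (ln p%:R)%:C%C * g p)
  <= N'%:R / Y%:R * ln N'%:R.
Proof.
move=> g1 Y0 YN.
have N0 : (0 < N')%N by apply: leq_trans YN; rewrite expn_gt0 Y0.
pose T n : R := \sum_(0 <= p < N'.+1 | prime p) \sum_(1 <= j < N' | (p ^ j.+1 == n)%N) ln p%:R.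
have T0 n : 0 <= T n.
  by apply: sumr_ge0 => p _; apply: sumr_ge0 => j _; apply: ln_nat_ge0.
have vT n : (0 < n <= N')%N -> vonMangoldt n = (if prime n then ln n%:R else 0) + T n.
  move=> /andP[n0 nN]; rewrite (vonMangoldt_widen nN) /T.
  have -> : (if prime n then ln n%:R else 0) =
      \sum_(0 <= p < N'.+1 | prime p && (p == n)%N) ln p%:R :> R.
    by rewrite big_nat1_cond_eq /= ltnS nN.
  rewrite big_mkcondr -big_split /=; apply: eq_bigr => p pp.
  by rewrite big_mkcond big_ltn// -big_mkcond expn1.
rewrite [X in _ - X]big_mkcond -sumrB.
apply: le_trans (cnorm_sum _ _ _) _.
apply: le_trans (_ : \sum_(N.+1 <= n < N'.+1) T n <= _).
  rewrite big_nat_cond [leRHS]big_nat_cond; apply: ler_sum => n /andP[/andP[Nn nN] _].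
  have n0 : (0 < n)%N by apply: leq_ltn_trans Nn.
  rewrite (vT n) ?n0//.
  have -> : (((if prime n then ln n%:R else 0) + T n)%:C%C * g n -
      (if prime n then (ln n%:R)%:C%C * g n else 0)) = (T n)%:C%C * g n.
    by case: ifP => _; rewrite ?add0r ?subr0// rmorphD /= mulrDl addrAC subrr add0r.
  by rewrite cnormM cnorm_real ger0_norm// ler_piMr.
rewrite /T exchange_big /=.
apply: le_trans (_ : \sum_(1 <= p < N'.+1) (if (p * Y <= N')%N then ln N'%:R else 0) <= _).
  rewrite big_ltn_cond//= [leRHS](eq_bigr (fun p => 0 + (if (p * Y <= N')%N then ln N'%:R else 0)) _)//; last first.
    by move=> p _; rewrite add0r.
  rewrite big_mkcond; apply: ler_sum => p _; rewrite add0r.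
  case: ifPn => pp; last by case: ifP => // _; apply: ln_nat_ge0.
  apply: le_trans (sum_prime_pow_le pp N0 YN).
  rewrite (exchange_big_dep xpredT) //=; apply: ler_sum => j _.
  rewrite (eq_bigl (fun n => (n == p ^ j.+1)%N)); last by move=> n; rewrite eq_sym.
  rewrite big_nat1_eq ltnS; case: ifP => [/andP[_ ->]//|_].
  by case: ifP => // _; apply: ln_nat_ge0.
rewrite big_add1 /=.
apply: le_trans (_ : (N' %/ Y)%:R * ln N'%:R <= _); last first.
  rewrite ler_wpM2r ?ln_nat_ge0// ler_pdivlMr ?ltr0n//.
  by rewrite -natrM ler_nat leq_divM.
apply: le_trans (sum_if_lt_le 0 N' _ (ln_nat_ge0 N')).
by apply: ler_sum => p _; rewrite leq_divRL.
Qed.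

(** The error in the Moebius inversion [sum_moebius] when only the divisors up to
    [X] are kept. It vanishes on [1 <= k <= X], which confines the last sum of
    [vaughan] to products of two large factors. *)
Definition moebius_tail (X k : nat) : R :=
  (k == 1%N)%:R - \sum_(1 <= b < X.+1 | (b %| k)%N) (moebius b)%:~R.

Lemma moebius_tail_eq0 X k : (0 < k)%N -> (k <= X)%N -> moebius_tail X k = 0.
Proof.
move=> k0 kX; rewrite /moebius_tail sum_divisors_widen//.
by rewrite -rmorph_sum /= sum_moebius// rmorph_nat subrr.
Qed.

(** Vaughan's identity: the divisor sum of the von Mangoldt function over
    divisors [c > X], convolved with the truncated Moebius function, is
    computed in the two possible orders. *)
Lemma vaughan (X n : nat) : (0 < n)%N -> (X < n)%N ->
  vonMangoldt n =
    \sum_(1 <= b < X.+1 | (b %| n)%N) (moebius b)%:~R * ln (n %/ b)%:R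
    - \sum_(1 <= b < X.+1 | (b %| n)%N) \sum_(1 <= c < X.+1 | (c %| n %/ b)%N)
        (moebius b)%:~R * vonMangoldt c
    + \sum_(X.+1 <= c < n.+1 | (c %| n)%N) vonMangoldt c * moebius_tail X (n %/ c).
Proof.
move=> n0 Xn.
have E b : (0 < b)%N -> (b %| n)%N ->
    \sum_(X.+1 <= c < n.+1 | (c %| n %/ b)%N) vonMangoldt c =
    ln (n %/ b)%:R - \sum_(1 <= c < X.+1 | (c %| n %/ b)%N) vonMangoldt c.
  move=> b0 bn; have m0 : (0 < n %/ b)%N by rewrite divn_gt0// dvdn_leq.
  rewrite -sum_vonMangoldt// -(@sum_divisors_widen _ _ n) ?leq_div//.
  by rewrite [X in X - _](@big_cat_nat _ _ _ X.+1)//=; [rewrite addrAC subrr add0r | apply: leqW].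
rewrite -sumrB.
have -> : \sum_(1 <= b < X.+1 | (b %| n)%N)
     ((moebius b)%:~R * ln (n %/ b)%:R - \sum_(1 <= c < X.+1 | (c %| n %/ b)%N)
        (moebius b)%:~R * vonMangoldt c) =
   \sum_(1 <= b < X.+1 | (b %| n)%N) \sum_(X.+1 <= c < n.+1 | (c %| n %/ b)%N)
      (moebius b)%:~R * vonMangoldt c.
  rewrite [LHS]big_nat_cond [RHS]big_nat_cond.
  apply: eq_bigr => b /andP[/andP[b0 _] bn].
  by rewrite -!mulr_sumr E// mulrBr.
rewrite (exchange_big_dep_nat (fun c => c %| n)%N) /=; last first.
  move=> b c /andP[b0 _] _ bn; rewrite dvdn_divRL//.
  by apply: dvdn_trans; apply: dvdn_mulr.
rewrite -big_split /= [RHS]big_nat_cond.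
transitivity (\sum_(X.+1 <= c < n.+1 | (c %| n)%N) vonMangoldt c * ((n %/ c)%N == 1%N)%:R).
  rewrite [RHS]big_mkcond big_nat_recr//= dvdnn divnn n0 mulr1.
  rewrite big_nat_cond big1 ?add0r// => c /andP[/andP[Xc cn] _].
  case: ifP => // cdvd; case: eqP => [h|_]; last by rewrite mulr0.
  by move: cn; rewrite -(divnK cdvd) h mul1n ltnn.
rewrite [LHS]big_nat_cond; apply: eq_bigr => c /andP[/andP[Xc cn] cdvd].
have c0 : (0 < c)%N by apply: leq_ltn_trans Xc.
rewrite -mulr_suml /moebius_tail mulrBr.
rewrite [_ * vonMangoldt c]mulrC addrCA -[LHS]addr0; congr (_ + _).
rewrite -mulrBr [X in _ * (X - _)](_ : _ = \sum_(1 <= b < X.+1 | (b %| n %/ c)%N) (moebius b)%:~R) ?subrr ?mulr0//.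
rewrite [LHS]big_nat_cond [RHS]big_nat_cond; apply: eq_bigl => b.
case: (ltnP 0 b) => //= b0; case: (b < X.+1)%N => //=.
have [bn|bn] := boolP (b %| n)%N => /=.
  by rewrite !dvdn_divRL// mulnC.
symmetry; apply: negbTE; apply: contra bn => h; exact: dvdn_trans h (dvdn_div cdvd).
Qed.

End VonMangoldt.

(** * Averages and summation by parts *)

Section Averages.
Variable R : realType.

Definition harmonic_sum (X : nat) : R := \sum_(1 <= b < X.+1) b%:R^-1.

Lemma harmonic_sum_ge0 X : 0 <= harmonic_sum X.
Proof. by apply: sumr_ge0 => b _; rewrite invr_ge0. Qed.

Lemma harmonic_sum_le X : (0 < X)%N -> harmonic_sum X <= 1 + ln X%:R.
Proof.
case: X => // X _; elim: X => [|X IHX].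
  by rewrite /harmonic_sum big_nat1 invr1 ln1 addr0.
rewrite /harmonic_sum big_nat_recr//= -/(harmonic_sum X.+1).
have X0 : (0 : R) < X.+1%:R by rewrite ltr0n.
have X1 : (0 : R) < X.+2%:R by rewrite ltr0n.
have h : ln X.+1%:R - ln X.+2%:R <= - X.+2%:R^-1 :> R.
  rewrite -ln_div ?posrE//.
  have -> : X.+1%:R / X.+2%:R = 1 + - X.+2%:R^-1 :> R.
    apply: (mulIf (lt0r_neq0 X1)).
    by rewrite mulfVK ?gt_eqF// mulrDl mul1r mulNr mulVf ?gt_eqF// -[X.+2%:R]natr1 addrK.
  by apply: le_ln1Dx; rewrite ltrN2 invf_lt1// ltr1n.
apply: le_trans (lerD IHX (lexx _)) _.
by rewrite -addrA lerD2l -lerBrDr addrC -lerBlDr.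
Qed.

(** Counting pairs of divisors through their least common multiple, and
    bounding [gcd] by the sum of the common divisors. *)
Lemma sum_divisor_count_sqr (X M : nat) :
  \sum_(1 <= k < M) (\sum_(1 <= b < X.+1 | (b %| k)%N) 1 : R) ^+ 2 <=
    M%:R * harmonic_sum X ^+ 3.
Proof.
set H := harmonic_sum X.
have -> : \sum_(1 <= k < M) (\sum_(1 <= b < X.+1 | (b %| k)%N) 1 : R) ^+ 2 =
  \sum_(1 <= b < X.+1) \sum_(1 <= c < X.+1)
     \sum_(1 <= k < M | (b %| k)%N && (c %| k)%N) 1.
  transitivity (\sum_(1 <= k < M) \sum_(1 <= b < X.+1 | (b %| k)%N)
      \sum_(1 <= c < X.+1 | (c %| k)%N) (1 : R)).
    apply: eq_bigr => k _; rewrite expr2 mulr_suml; apply: eq_bigr => b _.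
    by rewrite mul1r.
  rewrite (exchange_big_dep xpredT) //=; apply: eq_bigr => b _.
  rewrite (exchange_big_dep xpredT) //=.
have cnt b c : (0 < b)%N -> (0 < c)%N ->
    \sum_(1 <= k < M | (b %| k)%N && (c %| k)%N) (1 : R) <= M%:R * (gcdn b c)%:R / (b%:R * c%:R).
  move=> b0 c0.
  rewrite (eq_bigl (fun k => lcmn b c %| k)%N); last by move=> k; rewrite dvdn_lcm.
  case: M => [|M]; first by rewrite big_geq// mul0r mul0r.
  have l0 : (0 < lcmn b c)%N by rewrite lcmn_gt0 b0.
  rewrite sum_multiples// div0n sumr_const_nat subSS subn0.
  rewrite -mulrA; have -> : (gcdn b c)%:R / (b%:R * c%:R) = (lcmn b c)%:R^-1 :> R.
    rewrite -natrM -muln_lcm_gcd natrM invfM mulrCA mulfV ?mulr1// pnatr_eq0.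
    by rewrite -lt0n gcdn_gt0 b0.
  rewrite ler_pdivlMr ?ltr0n// -natrM ler_nat.
  by apply: leq_trans (leq_divM _ _) (leqnSn _).
(* The bound of the gcd by the sum of the common divisors makes the triple sum
   factor as a sum over [g] of a square. *)
have gcd_le b c : (0 < b <= X)%N -> (0 < c <= X)%N -> (gcdn b c)%:R <=
    \sum_(1 <= g < X.+1 | (g %| b)%N && (g %| c)%N) g%:R :> R.
  move=> /andP[b0 bX] /andP[c0 cX].
  have g0 : (0 < gcdn b c)%N by rewrite gcdn_gt0 b0.
  rewrite big_mkcond /= (bigD1_seq (gcdn b c)) ?iota_uniq//=; last first.
    by rewrite mem_index_iota g0 ltnS (leq_trans _ bX)// dvdn_leq// dvdn_gcdl.
  by rewrite dvdn_gcdl dvdn_gcdr /= lerDl sumr_ge0// => g _; case: ifP.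
apply: le_trans (_ : M%:R * \sum_(1 <= b < X.+1) \sum_(1 <= c < X.+1)
   \sum_(1 <= g < X.+1 | (g %| b)%N && (g %| c)%N) (g%:R / (b%:R * c%:R)) <= _).
  rewrite mulr_sumr big_nat_cond [leRHS]big_nat_cond.
  apply: ler_sum => b /andP[/andP[b0 bX] _].
  rewrite mulr_sumr big_nat_cond [leRHS]big_nat_cond.
  apply: ler_sum => c /andP[/andP[c0 cX] _].
  apply: le_trans (cnt _ _ b0 c0) _.
  rewrite -mulr_suml -mulrA ler_wpM2l// ler_wpM2r ?invr_ge0 ?mulr_ge0//.
  by apply: gcd_le; apply/andP.
rewrite ler_wpM2l//.
have -> : \sum_(1 <= b < X.+1) \sum_(1 <= c < X.+1)
   \sum_(1 <= g < X.+1 | (g %| b)%N && (g %| c)%N) (g%:R / (b%:R * c%:R)) =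
   \sum_(1 <= g < X.+1) g%:R * (\sum_(1 <= b < X.+1 | (g %| b)%N) b%:R^-1 : R) ^+ 2.
  transitivity (\sum_(1 <= b < X.+1) \sum_(1 <= g < X.+1 | (g %| b)%N)
     \sum_(1 <= c < X.+1 | (g %| c)%N) (g%:R / (b%:R * c%:R) : R)).
    apply: eq_bigr => b _; rewrite (exchange_big_dep (fun g => g %| b)%N) /=; last first.
      by move=> c g _ /andP[].
    apply: eq_bigr => g gb; apply: eq_bigl => c.
    by rewrite gb.
  rewrite (exchange_big_dep xpredT) //=; apply: eq_bigr => g _.
  rewrite expr2 mulr_suml mulr_sumr; apply: eq_bigr => b _.
  rewrite !mulr_sumr; apply: eq_bigr => c _.
  by rewrite invfM.
rewrite exprS -/H {1}/H /harmonic_sum mulr_suml big_nat_cond [leRHS]big_nat_cond.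
apply: ler_sum => g /andP[/andP[g0 gX] _].
have gR : (0 : R) < g%:R by rewrite ltr0n.
have h : \sum_(1 <= b < X.+1 | (g %| b)%N) b%:R^-1 <= g%:R^-1 * H :> R.
  rewrite sum_multiples// div0n /H /harmonic_sum mulr_sumr.
  rewrite [leRHS](@big_cat_nat _ _ _ (X %/ g).+1)//=; last by rewrite ltnS leq_div.
  apply: ler_wpDr; first by apply: sumr_ge0 => b _; rewrite mulr_ge0 ?invr_ge0.
  by apply: ler_sum => b _; rewrite natrM invfM.
have -> : g%:R^-1 * H ^+ 2 = g%:R * (g%:R^-1 * H) ^+ 2.
  by field; rewrite gt_eqF.
rewrite ler_wpM2l// lerXn2r ?nnegrE ?mulr_ge0 ?invr_ge0 ?harmonic_sum_ge0//.
by apply: sumr_ge0 => b _; rewrite invr_ge0.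
Qed.

(** Beyond 1 the tail is bounded by the number of divisors up to [X]. *)
Lemma moebius_tail_sqr_sum (X K : nat) : (1 < K)%N ->
  \sum_(K <= k < 2 * K) moebius_tail R X k ^+ 2 <= (2 * K)%:R * harmonic_sum X ^+ 3.
Proof.
move=> K1; apply: le_trans (sum_divisor_count_sqr X (2 * K)).
rewrite [leRHS](@big_cat_nat _ _ _ K)//=; [|exact: ltnW|by rewrite leq_pmull].
apply: ler_wpDl; first by apply: sumr_ge0 => k _; rewrite sqr_ge0.
rewrite big_nat_cond [leRHS]big_nat_cond; apply: ler_sum => k /andP[/andP[Kk _] _].
rewrite /moebius_tail gtn_eqF ?(leq_trans K1)// sub0r sqrrN -real_normK ?num_real//.
rewrite lerXn2r ?nnegrE ?sumr_ge0//.
apply: le_trans (ler_norm_sum _ _ _) _; apply: ler_sum => b _.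
by have := moebius_norm b; rewrite -(ler_int R) intr_norm.
Qed.

(** Summation by parts against nonnegative increasing weights. *)
Lemma abel_increasing (w : nat -> R) (x : nat -> R[i]) (a b : nat) (W E : R) :
  (forall k, (a <= k < b)%N -> 0 <= w k <= W) ->
  (forall k, (a <= k)%N -> (k.+1 < b)%N -> w k <= w k.+1) ->
  0 <= E -> 0 <= W ->
  (forall j, (a <= j < b)%N -> cnorm (\sum_(j <= k < b) x k) <= E) ->
  cnorm (\sum_(a <= k < b) (w k)%:C%C * x k) <= W * E.
Proof.
move=> hw hinc E0 W0 hE.
have [ba|/ltnW ab] := leqP b a; first by rewrite big_geq// cnorm0 mulr_ge0.
have [n bE] : exists n, b = (a + n)%N by exists (b - a)%N; rewrite subnKC.
rewrite {}bE in hw hinc hE *; move: hw hinc hE W0 {ab b}.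
elim: n a w W => [|n IHn] a w W hw hinc hE W0.
  by rewrite addn0 big_geq ?cnorm0 ?mulr_ge0.
have aan : (a <= a < a + n.+1)%N by rewrite leqnn addnS ltnS leq_addr.
have /andP[wa0 waW] := hw a aan.
pose v k := w k - w a.
have wge k : (a <= k < a + n.+1)%N -> w a <= w k.
  move=> /andP[/subnKC <-]; elim: (k - a)%N => [|j IHj]; first by rewrite addn0.
  rewrite addnS => hj; apply: le_trans (IHj (ltnW hj)) _.
  by apply: hinc; rewrite ?leq_addr.
have E1 : \sum_(a <= k < a + n.+1) (w k)%:C%C * x k =
    (w a)%:C%C * \sum_(a <= k < a + n.+1) x k + \sum_(a.+1 <= k < a.+1 + n) (v k)%:C%C * x k.
  rewrite [X in _ + X](_ : _ = \sum_(a <= k < a + n.+1) (v k)%:C%C * x k).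
    rewrite mulr_sumr -big_split /=; apply: eq_bigr => k _.
    by rewrite -mulrDl -rmorphD /= /v addrC subrK.
  by rewrite addSnnS [RHS]big_ltn; [rewrite /v subrr mul0r add0r|have /andP[] := aan].
rewrite E1; apply: le_trans (cnormD _ _) _.
have -> : W * E = w a * E + (W - w a) * E by rewrite -mulrDl addrC subrK.
apply: lerD; first by rewrite cnormM cnorm_real ger0_norm// ler_wpM2l// hE.
apply: IHn.
- move=> k; rewrite addSnnS => /andP[ak kn].
  have hk : (a <= k < a + n.+1)%N by rewrite (ltnW ak).
  by rewrite subr_ge0 wge// lerD2r; have /andP[] := hw k hk.
- move=> k ak; rewrite addSnnS => kn; rewrite lerD2r.
  by apply: hinc => //; apply: ltnW.
- move=> j; rewrite addSnnS => /andP[aj jn]; apply: hE.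
  by rewrite (ltnW aj).
- by rewrite subr_ge0.
Qed.

Lemma sum_dyadic (V : nmodType) (I : nat) (F : nat -> V) :
  \sum_(1 <= k < 2 ^ I) F k = \sum_(i < I) \sum_(2 ^ i <= k < 2 * 2 ^ i) F k.
Proof.
elim: I => [|I IHI]; first by rewrite big_ord0 big_geq.
rewrite big_ord_recr /= -IHI -expnS -big_cat_nat//; first by rewrite expn_gt0.
by rewrite leq_exp2l.
Qed.

Lemma sum_nat_cap (V : nmodType) (m n u v : nat) (F : nat -> V) :
  \sum_(m <= i < n | (u <= i < v)%N) F i = \sum_(maxn m u <= i < minn n v) F i.
Proof.
rewrite [RHS](big_nat_widen _ _ n) ?geq_minl// [RHS](big_nat_widenl _ m) ?leq_maxl//.
rewrite [LHS]big_nat_cond [RHS]big_nat_cond; apply: eq_bigl => i.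
rewrite geq_max leq_min; by case: (m <= i)%N; case: (i < n)%N; case: (u <= i)%N; case: (i < v)%N.
Qed.

Lemma count_close (c Q r N : nat) : (0 < r)%N -> (r <= N)%N ->
  \sum_(0 <= c' < Q.+1) (((c - c' + (c' - c)) * r < N)%N%:R : R) <= 4 * (N%:R / r%:R).
Proof.
move=> r0 rN.
have rR : (0 : R) < r%:R by rewrite ltr0n.
have q1 : (1 : R) <= N%:R / r%:R by rewrite ler_pdivlMr// mul1r ler_nat.
apply: le_trans (_ : \sum_(0 <= c' < c.+1 + Q) (((c - c' + (c' - c)) * r < N)%N%:R : R) <= _).
  rewrite [leRHS](@big_cat_nat _ _ _ Q.+1)//=; last by rewrite addSn ltnS leq_addl.
  by rewrite lerDl sumr_ge0.
rewrite (@big_cat_nat _ _ _ c.+1)//=; last by rewrite leq_addr.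
have half n (G : nat -> nat) : (forall j, (j < n)%N -> G j = j) ->
  \sum_(0 <= j < n) ((G j * r < N)%N%:R : R) <= 2 * (N%:R / r%:R).
  move=> hG; apply: le_trans (_ : N%:R / r%:R + 1 <= _); last by lra.
  apply: le_trans (sum_nat_lt_le n (ltW (lt_le_trans ltr01 q1))).
  rewrite -(big_mkord xpredT (fun h => (h%:R < N%:R / r%:R :> R)%R%:R)).
  by apply: ler_sum_nat => j /andP[_ jn]; rewrite hG// ltr_pdivlMr// -natrM ltr_nat.
have -> : 4 * (N%:R / r%:R) = 2 * (N%:R / r%:R) + 2 * (N%:R / r%:R) :> R by ring.
apply: lerD.
  rewrite big_nat_rev /= add0n; apply: (half _ (fun j => (c - (c.+1 - j.+1) + ((c.+1 - j.+1) - c)))%N).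
  by move=> j; rewrite ltnS subSS => jc; rewrite subKn// (eqP (leq_subr j c)) addn0.
rewrite -{1}[c.+1]add0n big_addn addKn.
apply: le_trans (half Q (fun j => j) (fun j _ => erefl)).
apply: ler_sum => j _; rewrite ler_nat.
case: (ltnP (j * r) N) => [_|h1]; first by case: (_ < _)%N.
rewrite ltnNge (leq_trans h1)// leq_mul2r; apply/orP; right.
by clear; lia.
Qed.

End Averages.

(** * The bilinear sums in Vaughan's identity *)

Section VaughanSums.
Variable R : realType.
Variables (g : nat -> R[i]) (N N' X : nat).

Lemma between_multiples (c k : nat) : (0 < c)%N ->
  ((N %/ c).+1 <= k < (N' %/ c).+1)%N = (N < c * k <= N')%N.
Proof. by move=> c0; rewrite ltn_divLR// ltnS leq_divRL// mulnC. Qed.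

(** Sum [vaughan] against [g] and exchange the order: each divisor becomes an
    outer variable. The last sum is arranged by the smooth cofactor [k], extended
    to an interval [2 ^ I] that splits into dyadic blocks. *)
Lemma vaughan_sum (I : nat) : (X <= N)%N -> (N' < 2 ^ I)%N ->
  \sum_(N.+1 <= n < N'.+1) (vonMangoldt R n)%:C%C * g n =
  \sum_(1 <= b < X.+1) ((moebius b)%:~R : R)%:C%C *
     \sum_((N %/ b).+1 <= k < (N' %/ b).+1) (ln k%:R)%:C%C * g (b * k)%N
  - \sum_(1 <= b < X.+1) \sum_(1 <= c < X.+1)
      ((moebius b)%:~R * vonMangoldt R c)%:C%C *
      \sum_((N %/ (b * c)).+1 <= k < (N' %/ (b * c)).+1) g (b * c * k)%N
  + \sum_(1 <= k < 2 ^ I) (moebius_tail R X k)%:C%C *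
      \sum_(X.+1 <= c < N'.+1 | (N < c * k <= N')%N) (vonMangoldt R c)%:C%C * g (c * k)%N.
Proof.
move=> XN NI.
have -> : \sum_(N.+1 <= n < N'.+1) (vonMangoldt R n)%:C%C * g n =
  \sum_(N.+1 <= n < N'.+1) \sum_(1 <= b < X.+1 | (b %| n)%N)
      ((moebius b)%:~R * ln (n %/ b)%:R : R)%:C%C * g n
  - \sum_(N.+1 <= n < N'.+1) \sum_(1 <= b < X.+1 | (b %| n)%N)
     \sum_(1 <= c < X.+1 | (c %| n %/ b)%N) ((moebius b)%:~R * vonMangoldt R c)%:C%C * g n
  + \sum_(N.+1 <= n < N'.+1) \sum_(X.+1 <= c < N'.+1 | (c %| n)%N)
      (vonMangoldt R c * moebius_tail R X (n %/ c))%:C%C * g n.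
  rewrite -sumrB -big_split /=; apply: eq_big_nat => n /andP[Nn nN].
  have n0 : (0 < n)%N by apply: leq_ltn_trans Nn.
  rewrite {1}(@vaughan _ X n n0 (leq_ltn_trans XN Nn)) rmorphD rmorphB /= mulrDl mulrBl.
  congr (_ - _ + _).
  - by rewrite rmorph_sum mulr_suml.
  - rewrite rmorph_sum mulr_suml; apply: eq_bigr => b _.
    by rewrite rmorph_sum mulr_suml.
  rewrite rmorph_sum mulr_suml [LHS](big_nat_widen _ _ N'.+1)//.
  apply: eq_bigl => c; have [cn|] := boolP (c %| n)%N; rewrite //= ltnS.
  by rewrite (dvdn_leq n0 cn).
congr (_ - _ + _).
- rewrite (exchange_big_dep xpredT) //=; apply: eq_big_nat => b /andP[b0 _].
  rewrite sum_multiples// mulr_sumr; apply: eq_bigr => k _.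
  by rewrite mulKn// rmorphM mulrA.
- rewrite (exchange_big_dep xpredT) //=; apply: eq_big_nat => b /andP[b0 _].
  rewrite sum_multiples//.
  have -> : \sum_((N %/ b).+1 <= k < (N' %/ b).+1)
      \sum_(1 <= c < X.+1 | (c %| b * k %/ b)%N)
        ((moebius b)%:~R * vonMangoldt R c)%:C%C * g (b * k)%N =
    \sum_((N %/ b).+1 <= k < (N' %/ b).+1) \sum_(1 <= c < X.+1 | (c %| k)%N)
        ((moebius b)%:~R * vonMangoldt R c)%:C%C * g (b * k)%N.
    by apply: eq_bigr => k _; apply: eq_bigl => c; rewrite mulKn.
  rewrite (exchange_big_dep xpredT) //=; apply: eq_big_nat => c /andP[c0 _].
  rewrite sum_multiples// [RHS]mulr_sumr -!divnMA; apply: eq_bigr => k _.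
  by rewrite mulnA.
rewrite (exchange_big_dep xpredT) //=.
transitivity (\sum_(X.+1 <= c < N'.+1) \sum_(1 <= k < 2 ^ I | (N < c * k <= N')%N)
   (moebius_tail R X k)%:C%C * ((vonMangoldt R c)%:C%C * g (c * k)%N)).
  apply: eq_big_nat => c /andP[Xc _].
  have c0 : (0 < c)%N by apply: leq_ltn_trans Xc.
  rewrite sum_multiples//.
  rewrite [RHS](eq_bigl (fun k => (N %/ c).+1 <= k < (N' %/ c).+1)%N); last first.
    by move=> k; rewrite between_multiples.
  rewrite sum_nat_cap (maxn_idPr _)//; have /minn_idPr -> : ((N' %/ c).+1 <= 2 ^ I)%N.
    by apply: leq_ltn_trans NI; apply: leq_div.
  apply: eq_bigr => k _; rewrite mulKn// rmorphM /=.
  by rewrite [_%:C%C * _%:C%C]mulrC mulrA.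
rewrite (exchange_big_dep xpredT) //=; apply: eq_bigr => k _.
by rewrite mulr_sumr.
Qed.

Hypothesis g1 : forall n, cnorm (g n) <= 1.
Hypothesis N'N : (N' <= 2 * N)%N.

Let l : R := 1 + ln (2 * N)%:R.

Lemma ln_le_l n : (n <= 2 * N)%N -> ln n%:R <= l.
Proof.
case: n => [|n] nN; first by rewrite ln0// addr_ge0// ln_nat_ge0.
apply: le_trans (_ : ln (2 * N)%:R <= _); last by rewrite lerDr.
by rewrite ler_ln ?posrE ?ltr0n ?ler_nat// (leq_trans _ nN).
Qed.

Lemma vonMangoldt_le_l n : (0 < n)%N -> (n <= 2 * N)%N -> vonMangoldt R n <= l.
Proof. by move=> n0 nN; apply: le_trans (vonMangoldt_le _ n0) (ln_le_l nN). Qed.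

(** Expanding the square of the inner sum [S k] and summing over [k] first leaves
    correlations of [g] along two progressions of ratios [c1] and [c2]. They are
    small by hypothesis unless [c1] and [c2] are close, and close pairs are few
    ([count_close]). The coefficients [moebius_tail] are then separated from [S k]
    by the inequality [2 a b <= t a ^ 2 + b ^ 2 / t], with [t] balancing the two
    sides. *)
Lemma type2_bound (K Y : nat) (C : R) : 1 <= C -> (0 < Y)%N -> (0 < N)%N ->
  (2 * Y ^ 2 <= X)%N -> (X < 2 * K)%N ->
  (forall c1 c2 a b, (X < c1)%N -> (X < c2)%N ->
     (N < c1 * (2 * K))%N -> (c1 * K <= N')%N -> (N < c2 * (2 * K))%N -> (c2 * K <= N')%N ->
     (N <= (c1 - c2 + (c2 - c1)) * (Y ^ 2 * K))%N -> (K <= a)%N -> (b <= 2 * K)%N ->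
     cnorm (\sum_(a <= k < b) g (c1 * k)%N * conjc (g (c2 * k)%N)) <= C * K%:R / Y%:R ^+ 2) ->
  cnorm (\sum_(K <= k < 2 * K) (moebius_tail R X k)%:C%C *
      \sum_(X.+1 <= c < N'.+1 | (N < c * k <= N')%N) (vonMangoldt R c)%:C%C * g (c * k)%N)
   <= (harmonic_sum R X ^+ 3 + (2 * C + 4) * l ^+ 2) * N%:R / Y%:R.
Proof.
move=> C1 Y0 N0 YX XK far.
have K1 : (1 < K)%N.
  rewrite -(ltn_pmul2l (isT : 0 < 2)%N); apply: leq_trans XK; rewrite ltnS.
  by apply: leq_trans YX; rewrite leq_pmulr// expn_gt0 Y0.
have K0 : (0 < K)%N by apply: ltnW.
have KR : (0 : R) < K%:R by rewrite ltr0n.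
have YR : (0 : R) < Y%:R by rewrite ltr0n.
have NR : (0 : R) < N%:R by rewrite ltr0n.
have l1 : 1 <= l by rewrite lerDl ln_nat_ge0.
(* All the [c] that occur satisfy [c * K <= N']. *)
pose Q := (N' %/ K)%N.
have QK : (Q * K <= N')%N by apply: leq_divM.
pose S k := \sum_(X.+1 <= c < Q.+1 | (N < c * k <= N')%N) (vonMangoldt R c)%:C%C * g (c * k)%N.
have SE k : (K <= k)%N ->
    \sum_(X.+1 <= c < N'.+1 | (N < c * k <= N')%N) (vonMangoldt R c)%:C%C * g (c * k)%N = S k.
  move=> Kk; rewrite /S [RHS](big_nat_widen _ _ N'.+1); last by rewrite ltnS leq_div.
  apply: eq_bigl => c; rewrite -andbA; case: (N < c * k)%N => //=.
  have [h|//] := boolP (c * k <= N')%N; rewrite ltnS leq_divRL//.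
  by rewrite (leq_trans _ h)// leq_mul2l Kk orbT.
have hS : \sum_(K <= k < 2 * K) cnorm (S k) ^+ 2 <= (4 * C + 8) * l ^+ 2 * (N%:R ^+ 2 / (K%:R * Y%:R ^+ 2)).
  have -> : \sum_(K <= k < 2 * K) cnorm (S k) ^+ 2 = cnorm (\sum_(X.+1 <= c1 < Q.+1)
      \sum_(X.+1 <= c2 < Q.+1) (vonMangoldt R c1 * vonMangoldt R c2)%:C%C *
        \sum_(K <= k < 2 * K | (N < c1 * k <= N')%N && (N < c2 * k <= N')%N)
           g (c1 * k)%N * conjc (g (c2 * k)%N)).
    rewrite -[LHS]ger0_norm; last by apply: sumr_ge0 => k _; rewrite sqr_ge0.
    rewrite -cnorm_real rmorph_sum /=; congr cnorm.
    transitivity (\sum_(K <= k < 2 * K) \sum_(X.+1 <= c1 < Q.+1 | (N < c1 * k <= N')%N)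
      \sum_(X.+1 <= c2 < Q.+1 | (N < c2 * k <= N')%N)
        (vonMangoldt R c1 * vonMangoldt R c2)%:C%C * (g (c1 * k)%N * conjc (g (c2 * k)%N))).
      apply: eq_bigr => k _; rewrite cnorm_sqr /S conjc_sum mulr_suml.
      apply: eq_bigr => c1 _; rewrite [LHS]mulr_sumr; apply: eq_bigr => c2 _.
      by rewrite conjcM conjc_real rmorphM /= mulrACA.
    rewrite (exchange_big_dep xpredT) //=; apply: eq_bigr => c1 _.
    rewrite (exchange_big_dep xpredT) //=; apply: eq_bigr => c2 _.
    by rewrite [RHS]mulr_sumr.
  (* The pairs excluded from the hypothesis. *)
  pose near c1 c2 : R := (((c1 - c2 + (c2 - c1)) * (Y ^ 2 * K) < N)%N)%:R.
  have inner c1 c2 : (X < c1 <= Q)%N -> (X < c2 <= Q)%N ->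
      cnorm (\sum_(K <= k < 2 * K | (N < c1 * k <= N')%N && (N < c2 * k <= N')%N)
           g (c1 * k)%N * conjc (g (c2 * k)%N)) <= C * K%:R / Y%:R ^+ 2 + near c1 c2 * K%:R.
    move=> /andP[Xc1 c1Q] /andP[Xc2 c2Q].
    have c10 : (0 < c1)%N by apply: leq_ltn_trans Xc1.
    have c20 : (0 < c2)%N by apply: leq_ltn_trans Xc2.
    have B0 : 0 <= C * K%:R / Y%:R ^+ 2.
      by rewrite divr_ge0 ?exprn_ge0 ?mulr_ge0// (le_trans ler01).
    have BB : 0 <= C * K%:R / Y%:R ^+ 2 + near c1 c2 * K%:R.
      by apply: addr_ge0 => //; apply: mulr_ge0.
    have [N1|N1] := leqP (c1 * (2 * K)) N.
      rewrite big_nat_cond big_pred0 ?cnorm0// => k.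
      apply/negP => /andP[/andP[_ kK] /andP[/andP[h _] _]].
      by move: h; rewrite ltnNge (leq_trans _ N1)// leq_mul2l (ltnW kK) orbT.
    have [N2|N2] := leqP (c2 * (2 * K)) N.
      rewrite big_nat_cond big_pred0 ?cnorm0// => k.
      apply/negP => /andP[/andP[_ kK] /andP[_ /andP[h _]]].
      by move: h; rewrite ltnNge (leq_trans _ N2)// leq_mul2l (ltnW kK) orbT.
    rewrite /near; case: ltnP => hnear; last first.
      rewrite mul0r addr0.
      rewrite (eq_bigl (fun k => (maxn (N %/ c1).+1 (N %/ c2).+1 <= k <
          minn (N' %/ c1).+1 (N' %/ c2).+1)%N)); last first.
        move=> k; rewrite -!between_multiples// geq_max leq_min.
        by rewrite andbACA.
      rewrite sum_nat_cap; apply: far => //.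
      - by apply: leq_trans QK; rewrite leq_mul2r c1Q orbT.
      - by apply: leq_trans QK; rewrite leq_mul2r c2Q orbT.
      - by rewrite leq_maxl.
      - by rewrite geq_minl.
    rewrite mul1r; apply: le_trans (_ : K%:R <= _); last by rewrite lerDr.
    apply: le_trans (cnorm_sum _ _ _) _.
    apply: le_trans (_ : \sum_(K <= k < 2 * K) 1 <= _).
      rewrite big_mkcond; apply: ler_sum => k _; case: ifP => // _.
      by rewrite cnormM cnorm_conj -[leRHS]mulr1 ler_pM ?cnorm_ge0.
    by rewrite sumr_const_nat mul2n -addnn addnK.
  apply: le_trans (cnorm_sum _ _ _) _.
  have [QX|XQ] := leqP Q X.
    rewrite big_geq//; apply: mulr_ge0.
      by rewrite mulr_ge0 ?sqr_ge0 ?addr_ge0 ?mulr_ge0// (le_trans ler01).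
    by rewrite divr_ge0 ?mulr_ge0 ?exprn_ge0.
  have Q2 : Q%:R <= 2 * (N%:R / K%:R) :> R.
    rewrite mulrA ler_pdivlMr// -!natrM ler_nat; exact: leq_trans QK N'N.
  have Q2N : (Q <= 2 * N)%N by apply: leq_trans N'N; apply: leq_div.
  have rN : (Y ^ 2 * K <= N)%N.
    rewrite -(leq_pmul2l (isT : 0 < 2)%N) mulnA; apply: leq_trans (leq_trans QK N'N).
    by rewrite leq_mul2r (leq_trans YX (ltnW XQ)) orbT.
  have L1 c : (X < c <= Q)%N -> 0 <= vonMangoldt R c <= l.
    move=> /andP[Xc cQ]; rewrite vonMangoldt_ge0 vonMangoldt_le_l ?(leq_trans cQ)//.
    exact: leq_ltn_trans Xc.
  have r0 : (0 < Y ^ 2 * K)%N by rewrite muln_gt0 expn_gt0 Y0.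
  apply: le_trans (_ : \sum_(X.+1 <= c1 < Q.+1) \sum_(X.+1 <= c2 < Q.+1)
     l ^+ 2 * (C * K%:R / Y%:R ^+ 2 + near c1 c2 * K%:R) <= _).
    apply: ler_sum_nat => c1 /andP[Xc1 c1Q].
    apply: le_trans (cnorm_sum _ _ _) _; apply: ler_sum_nat => c2 /andP[Xc2 c2Q].
    rewrite ltnS in c1Q; rewrite ltnS in c2Q.
    have h1 : (X < c1 <= Q)%N by rewrite Xc1.
    have h2 : (X < c2 <= Q)%N by rewrite Xc2.
    have /andP[v1 v1'] := L1 _ h1; have /andP[v2 v2'] := L1 _ h2.
    rewrite cnormM cnorm_real ger0_norm ?mulr_ge0// ler_pM ?mulr_ge0 ?cnorm_ge0//.
      by rewrite expr2 ler_pM.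
    exact: inner.
  have nr c1 : \sum_(X.+1 <= c2 < Q.+1) near c1 c2 <= 4 * (N%:R / (Y ^ 2 * K)%:R).
    apply: le_trans (count_close R c1 Q r0 rN).
    rewrite [leRHS](@big_cat_nat _ _ _ X.+1)//=; last by rewrite ltnS ltnW.
    by rewrite lerDr sumr_ge0.
  apply: le_trans (_ : \sum_(X.+1 <= c1 < Q.+1) l ^+ 2 *
     (Q%:R * (C * K%:R / Y%:R ^+ 2) + 4 * (N%:R / (Y ^ 2 * K)%:R) * K%:R) <= _).
    apply: ler_sum => c1 _; rewrite -mulr_sumr ler_wpM2l ?sqr_ge0// big_split /=.
    rewrite -[X in _ + X <= _]mulr_suml; apply: lerD; last by rewrite ler_wpM2r.
    rewrite sumr_const_nat -[leLHS]mulr_natl ler_wpM2r ?ler_nat ?subSS ?leq_subr//.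
    by rewrite divr_ge0 ?exprn_ge0 ?mulr_ge0// (le_trans ler01).
  rewrite sumr_const_nat -[leLHS]mulr_natl.
  apply: le_trans (_ : (2 * (N%:R / K%:R)) * (l ^+ 2 * ((2 * (N%:R / K%:R)) * (C * K%:R / Y%:R ^+ 2)
      + 4 * (N%:R / (Y ^ 2 * K)%:R) * K%:R)) <= _).
    have B0 : 0 <= C * K%:R / Y%:R ^+ 2.
      by rewrite divr_ge0 ?exprn_ge0 ?mulr_ge0// (le_trans ler01).
    apply: ler_pM => //.
    - apply: mulr_ge0; first exact: sqr_ge0.
      by apply: addr_ge0; [exact: mulr_ge0 | rewrite !mulr_ge0 ?invr_ge0].
    - by apply: le_trans Q2; rewrite ler_nat subSS leq_subr.
    by rewrite ler_wpM2l ?sqr_ge0// lerD2r ler_wpM2r.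
  rewrite le_eqVlt; apply/orP; left; apply/eqP; rewrite natrM natrX.
  by field; rewrite !gt_eqF.
have hb := moebius_tail_sqr_sum R X K1.
apply: le_trans (cnorm_sum _ _ _) _.
pose t : R := N%:R / (K%:R * Y%:R).
have t0 : 0 < t by rewrite divr_gt0 ?mulr_gt0.
apply: le_trans (_ : \sum_(K <= k < 2 * K) 2^-1 * (t * moebius_tail R X k ^+ 2 + cnorm (S k) ^+ 2 / t) <= _).
  apply: ler_sum_nat => k /andP[Kk _]; rewrite SE// cnormM cnorm_real.
  set u := `|_|; set v := cnorm _.
  have -> : moebius_tail R X k ^+ 2 = u ^+ 2 by rewrite real_normK ?num_real.
  have : 0 <= (t * u - v) ^+ 2 / t by rewrite divr_ge0 ?sqr_ge0 ?(ltW t0).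
  have -> : (t * u - v) ^+ 2 / t = t * u ^+ 2 - 2 * (u * v) + v ^+ 2 / t.
    by field; rewrite gt_eqF.
  by clear; lra.
have -> : \sum_(K <= k < 2 * K) 2^-1 * (t * moebius_tail R X k ^+ 2 + cnorm (S k) ^+ 2 / t) =
    2^-1 * (t * (\sum_(K <= k < 2 * K) moebius_tail R X k ^+ 2) +
      (\sum_(K <= k < 2 * K) cnorm (S k) ^+ 2) / t).
  rewrite -[LHS]mulr_sumr big_split /= -[X in _ * (X + _)]mulr_sumr.
  by rewrite -[X in _ * (_ + X) = _]mulr_suml.
apply: le_trans (_ : 2^-1 * (t * ((2 * K)%:R * harmonic_sum R X ^+ 3) +
   ((4 * C + 8) * l ^+ 2 * (N%:R ^+ 2 / (K%:R * Y%:R ^+ 2))) / t) <= _).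
  apply: ler_wpM2l; first by rewrite invr_ge0.
  apply: lerD; first by apply: ler_wpM2l => //; apply: ltW.
  by apply: ler_wpM2r => //; rewrite invr_ge0 ltW.
rewrite le_eqVlt; apply/orP; left; apply/eqP; rewrite /t natrM.
by field; rewrite !gt_eqF.
Qed.

End VaughanSums.

(** * Vaughan's bound for sums over prime powers *)

Section VaughanBound.
Variable R : realType.

Lemma ln2_ge_half : 2^-1 <= ln 2 :> R.
Proof.
have h : ln (1 + - 2^-1) <= - 2^-1 :> R by apply: le_ln1Dx; lra.
have -> : 2 = (2^-1)^-1 :> R by rewrite invrK.
rewrite lnV ?posrE ?invr_gt0// invrK.
have e : 1 + - 2^-1 = 2^-1 :> R by lra.
by rewrite e in h; lra.
Qed.

(** In [vaughan_sum], the first sum has the monotonic weight [ln k], removed by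
    summation by parts, and together with the second one it is covered by the
    hypothesis on sums over a single variable (type I); the third one is covered,
    in each dyadic block, by [type2_bound] (type II). The outer sums over [b] and
    [c] cost the logarithms. *)
Lemma vaughan_bound (g : nat -> R[i]) (N N' X Y : nat) (C : R) :
  (forall n, cnorm (g n) <= 1) -> (N <= N')%N -> (N' <= 2 * N)%N ->
  1 <= C -> (0 < Y)%N -> (2 * Y ^ 2 <= X)%N -> (X <= N)%N ->
  (forall d a b, (0 < d <= X ^ 2)%N -> (N < d * a)%N -> (d * b <= N' + d)%N ->
     cnorm (\sum_(a <= k < b) g (d * k)%N) <= C * (N%:R / d%:R) / Y%:R ^+ 2) ->
  (forall K c1 c2 a b, (X < 2 * K)%N -> (X < c1)%N -> (X < c2)%N ->
     (N < c1 * (2 * K))%N -> (c1 * K <= N')%N -> (N < c2 * (2 * K))%N -> (c2 * K <= N')%N ->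
     (N <= (c1 - c2 + (c2 - c1)) * (Y ^ 2 * K))%N -> (K <= a)%N -> (b <= 2 * K)%N ->
     cnorm (\sum_(a <= k < b) g (c1 * k)%N * conjc (g (c2 * k)%N)) <= C * K%:R / Y%:R ^+ 2) ->
  cnorm (\sum_(N.+1 <= n < N'.+1) (vonMangoldt R n)%:C%C * g n) <=
    20 * C * (1 + ln (2 * N)%:R) ^+ 4 * N%:R / Y%:R.
Proof.
move=> g1 NN' N'N C1 Y0 YX XN typeI typeII.
have X0 : (0 < X)%N.
  by apply: leq_trans YX; rewrite muln_gt0 expn_gt0 Y0.
have N0 : (0 < N)%N by apply: leq_trans XN.
pose l : R := 1 + ln (2 * N)%:R; rewrite -/l.
have l1 : 1 <= l by rewrite lerDl ln_nat_ge0.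
have l0 : 0 <= l by apply: le_trans l1.
have YR : (1 : R) <= Y%:R by rewrite ler1n.
have Y0R : (0 : R) < Y%:R by apply: lt_le_trans YR.
have NR : (0 : R) < N%:R by rewrite ltr0n.
have C0 : 0 < C by apply: lt_le_trans C1.
have X2N : (X <= 2 * N)%N by apply: leq_trans XN _; rewrite leq_pmull.
have Hl : harmonic_sum R X <= l.
  apply: le_trans (harmonic_sum_le R X0) _; rewrite lerD2l.
  by rewrite ler_ln ?posrE ?ltr0n ?muln_gt0 ?ler_nat.
have H0 := harmonic_sum_ge0 R X.
pose I := (trunc_log 2 N').+1.
have NI : (N' < 2 ^ I)%N by apply: trunc_log_ltn.
have Il : I%:R <= 2 * l :> R.
  have t : (trunc_log 2 N')%:R * ln 2 <= ln (2 * N)%:R :> R.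
    rewrite mulr_natl -lnXn// -natrX ler_ln ?posrE ?ltr0n ?expn_gt0 ?muln_gt0 ?N0//.
    by rewrite ler_nat (leq_trans _ N'N)// trunc_logP// (leq_trans N0).
  have t' := le_trans (ler_wpM2l (ler0n R (trunc_log 2 N')) ln2_ge_half) t.
  rewrite /I -natr1 /l; move: t'.
  by move: (ln (2 * N)%:R) => L; move: (_%:R : R) => T'; clear; lra.
have mu1 b : cnorm (((moebius b)%:~R : R)%:C%C) <= 1.
  by rewrite cnorm_real -intr_norm -[leRHS]/(1%:~R) ler_int moebius_norm.
rewrite (vaughan_sum g XN NI).
apply: le_trans (cnormD _ _) _; apply: le_trans (lerD (cnormD _ _) (lexx _)) _.
rewrite cnormN.
set S1 := cnorm _; set S2 := cnorm _; set S3 := cnorm _.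
have hb d : (0 < d <= X ^ 2)%N -> (N < d * (N %/ d).+1)%N /\ (d * (N' %/ d).+1 <= N' + d)%N.
  move=> /andP[d0 _]; split; first by rewrite mulnC ltn_ceil.
  by rewrite mulnS addnC leq_add2r mulnC leq_divM.
have XX b : (0 < b <= X)%N -> (0 < b <= X ^ 2)%N.
  by move=> /andP[b0 bX]; rewrite b0 (leq_trans bX)// leq_pmulr.
have Y2 (A : R) : 0 <= A -> A / Y%:R ^+ 2 <= A / Y%:R.
  move=> A0; rewrite ler_wpM2l// lef_pV2 ?posrE ?exprn_gt0//.
  by apply: ler_eXnr.
have h1 : S1 <= C * l ^+ 4 * N%:R / Y%:R.
  apply: le_trans (cnorm_sum _ _ _) _.
  apply: le_trans (_ : \sum_(1 <= b < X.+1) l * (C * (N%:R / b%:R) / Y%:R ^+ 2) <= _).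
    apply: ler_sum_nat => b /andP[b0 bX].
    rewrite cnormM -[leRHS]mul1r; apply: ler_pM; rewrite ?cnorm_ge0//.
    have hbX : (0 < b <= X)%N by rewrite b0.
    have [e1 e2] := hb b (XX _ hbX).
    apply: abel_increasing => //.
    - move=> k /andP[kN kN']; rewrite ln_nat_ge0 /= ln_le_l//.
      by rewrite (leq_trans _ N'N)// (leq_trans (_ : k <= N' %/ b)%N)// leq_div.
    - move=> k kN _; rewrite ler_ln ?posrE ?ltr0n ?ler_nat//.
      exact: leq_ltn_trans kN.
    - by rewrite divr_ge0 ?exprn_ge0 ?mulr_ge0 ?invr_ge0 ?(ltW C0).
    move=> j /andP[Nj jN]; apply: typeI => //; first exact: XX.
    by apply: leq_trans e1 _; rewrite leq_mul2l Nj orbT.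
  have -> : \sum_(1 <= b < X.+1) l * (C * (N%:R / b%:R) / Y%:R ^+ 2) =
     (l * C * N%:R * harmonic_sum R X) / Y%:R ^+ 2.
    rewrite [in RHS]/harmonic_sum [in RHS]mulr_sumr [in RHS]mulr_suml.
    by apply: eq_bigr => b _; ring.
  apply: le_trans (Y2 _ _) _; first by rewrite !mulr_ge0 ?(ltW C0).
  rewrite ler_wpM2r ?invr_ge0//.
  apply: le_trans (_ : l * C * N%:R * l <= _).
    by rewrite ler_wpM2l// !mulr_ge0 ?(ltW C0).
  have -> : l * C * N%:R * l = C * N%:R * l ^+ 2 by ring.
  rewrite [leRHS]mulrAC ler_wpM2l ?mulr_ge0 ?(ltW C0)//.
  by apply: ler_weXn2l.
have h2 : S2 <= C * l ^+ 4 * N%:R / Y%:R.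
  apply: le_trans (cnorm_sum _ _ _) _.
  apply: le_trans (_ : \sum_(1 <= b < X.+1) \sum_(1 <= c < X.+1)
      l * (C * (N%:R / (b * c)%:R) / Y%:R ^+ 2) <= _).
    apply: ler_sum_nat => b /andP[b0 bX]; apply: le_trans (cnorm_sum _ _ _) _.
    apply: ler_sum_nat => c /andP[c0 cX]; rewrite !ltnS in bX cX.
    have hbc : (0 < b * c <= X ^ 2)%N.
      by rewrite muln_gt0 b0 c0 -mulnn leq_mul.
    have [e1 e2] := hb _ hbc.
    rewrite cnormM rmorphM cnormM; apply: ler_pM; rewrite ?mulr_ge0 ?cnorm_ge0//; last exact: typeI.
    rewrite -[leRHS]mul1r; apply: ler_pM; [exact: cnorm_ge0|exact: cnorm_ge0|exact: mu1|].
    rewrite cnorm_real ger0_norm ?vonMangoldt_ge0// vonMangoldt_le_l//.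
    exact: leq_trans X2N.
  have -> : \sum_(1 <= b < X.+1) \sum_(1 <= c < X.+1)
      l * (C * (N%:R / (b * c)%:R) / Y%:R ^+ 2) =
      (l * C * N%:R * (harmonic_sum R X * harmonic_sum R X)) / Y%:R ^+ 2.
    rewrite {1}/harmonic_sum mulr_suml [in RHS]mulr_sumr [in RHS]mulr_suml.
    apply: eq_bigr => b _; rewrite /harmonic_sum mulr_sumr [in RHS]mulr_sumr [in RHS]mulr_suml.
    by apply: eq_bigr => c _; rewrite natrM invfM; ring.
  apply: le_trans (Y2 _ _) _; first by rewrite !mulr_ge0 ?(ltW C0).
  rewrite ler_wpM2r ?invr_ge0//.
  apply: le_trans (_ : l * C * N%:R * (l * l) <= _).
    by rewrite ler_wpM2l ?ler_pM// !mulr_ge0 ?(ltW C0).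
  have -> : l * C * N%:R * (l * l) = C * N%:R * l ^+ 3 by ring.
  rewrite [leRHS]mulrAC ler_wpM2l ?mulr_ge0 ?(ltW C0)//.
  by apply: ler_weXn2l.
have h3 : S3 <= 2 * l * ((l ^+ 3 + (2 * C + 4) * l ^+ 2) * N%:R / Y%:R).
  rewrite /S3 sum_dyadic; apply: le_trans (cnorm_sum _ _ _) _.
  set E := _ * N%:R / Y%:R.
  have E0 : 0 <= E.
    rewrite /E divr_ge0 ?mulr_ge0//.
    by rewrite addr_ge0 ?mulr_ge0 ?exprn_ge0// addr_ge0// mulr_ge0// ltW.
  apply: le_trans (_ : \sum_(i < I) E <= _); last first.
    by rewrite sumr_const card_ord -[leLHS]mulr_natl ler_wpM2r.
  apply: ler_sum => i _; have [Xi|Xi] := leqP (2 * 2 ^ i) X.+1.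
    rewrite big_nat_cond big1 ?cnorm0// => k /andP[/andP[ik ki] _].
    rewrite moebius_tail_eq0 ?mul0r//; first by apply: leq_trans ik; rewrite expn_gt0.
    by rewrite -ltnS (leq_trans ki).
  apply: le_trans (type2_bound g1 N'N C1 Y0 N0 YX (ltnW Xi) _) _.
    by move=> c1 c2 a b; apply: typeII; apply: ltnW.
  rewrite /E ler_wpM2r ?invr_ge0// ler_wpM2r// lerD2r.
  by rewrite lerXn2r ?nnegrE.
apply: le_trans (lerD (lerD h1 h2) h3) _.
have -> : 20 * C * l ^+ 4 * N%:R / Y%:R = 20 * C * l ^+ 4 * (N%:R / Y%:R) by rewrite -[LHS]mulrA.
have -> : C * l ^+ 4 * N%:R / Y%:R + C * l ^+ 4 * N%:R / Y%:R +
  2 * l * ((l ^+ 3 + (2 * C + 4) * l ^+ 2) * N%:R / Y%:R) =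
  (2 * C * l ^+ 4 + 2 * l ^+ 4 + (4 * C + 8) * l ^+ 3) * (N%:R / Y%:R).
  by field; rewrite gt_eqF.
rewrite ler_wpM2r ?divr_ge0//.
have l34 : l ^+ 3 <= l ^+ 4 by apply: ler_weXn2l.
have l4 : 0 <= l ^+ 4 by apply: exprn_ge0.
have l3 : 0 <= l ^+ 3 by apply: exprn_ge0.
move: l34 l4 l3 C1; move: (l ^+ 4) (l ^+ 3) => u v; clear.
by move=> *; nra.
Qed.

End VaughanBound.

(** * Exponential sums over primes *)

Section PrimePhases.
Variable R : realType.

(** The mean value theorem for the function [x ^ -(j + 1)], made explicit. *)
Lemma invpow_diff_bounds (j c1 c2 : nat) (u : R) : 0 < u ->
  u / 2 < c1%:R -> c1%:R <= 2 * u -> u / 2 < c2%:R -> c2%:R <= 2 * u ->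
  let delta : R := (c1 - c2 + (c2 - c1))%:R in
  delta / (u ^+ j.+2 * 2 ^+ j.+2) <= `|invpow R j.+1 c1 - invpow R j.+1 c2|
    <= j.+1%:R * 2 ^+ j.+2 * delta / u ^+ j.+2.
Proof.
move=> u0.
wlog c12 : c1 c2 / (c1 <= c2)%N.
  move=> wl a1 b1 a2 b2; have [h|/ltnW h] := leqP c1 c2; first exact: wl.
  by rewrite distrC addnC; apply: wl.
move=> a1 b1 a2 b2 /=.
have -> : (c1 - c2 = 0)%N by apply/eqP.
rewrite add0n natrB//; set d : R := c2%:R - c1%:R.
have d0 : 0 <= d by rewrite subr_ge0 ler_nat.
have c1R : (0 : R) < c1%:R by apply: le_lt_trans a1; rewrite divr_ge0// ltW.
have c2R : (0 : R) < c2%:R by apply: le_lt_trans a2; rewrite divr_ge0// ltW.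
pose x : R := c1%:R^-1; pose y : R := c2%:R^-1.
have E : invpow R j.+1 c1 - invpow R j.+1 c2 = (x - y) * \sum_(i < j.+1) x ^+ (j - i) * y ^+ i.
  by rewrite /invpow -!exprVn subrXX.
have xy : x - y = d / (c1%:R * c2%:R).
  by rewrite /x /y /d; field; rewrite !gt_eqF.
have bx : (2 * u)^-1 <= x <= 2 / u.
  rewrite /x lef_pV2 ?posrE ?mulr_gt0// b1 /=.
  by rewrite -[2 / u]invrK invf_div lef_pV2 ?posrE ?divr_gt0// ltW.
have by' : (2 * u)^-1 <= y <= 2 / u.
  rewrite /y lef_pV2 ?posrE ?mulr_gt0// b2 /=.
  by rewrite -[2 / u]invrK invf_div lef_pV2 ?posrE ?divr_gt0// ltW.
have x0 : 0 <= x by rewrite invr_ge0.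
have y0 : 0 <= y by rewrite invr_ge0.
have uV : 0 <= (2 * u)^-1 by rewrite invr_ge0 mulr_ge0// ltW.
have u2 : 0 <= 2 / u by rewrite divr_ge0// ltW.
move/andP: bx => [bx1 bx2]; move/andP: by' => [by1 by2].
have xy0 : 0 <= x - y by rewrite xy divr_ge0// mulr_ge0// ltW.
have S0 : 0 <= \sum_(i < j.+1) x ^+ (j - i) * y ^+ i.
  by apply: sumr_ge0 => i _; rewrite mulr_ge0 ?exprn_ge0.
rewrite E ger0_norm ?mulr_ge0//.
have xyl : d / (4 * u ^+ 2) <= x - y.
  rewrite xy ler_wpM2l// lef_pV2 ?posrE ?mulr_gt0 ?exprn_gt0//.
  have -> : 4 * u ^+ 2 = (2 * u) * (2 * u) by ring.
  by rewrite ler_pM// ltW.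
have xyu : x - y <= 4 * d / u ^+ 2.
  rewrite xy [4 * d]mulrC -mulrA ler_wpM2l//.
  have -> : 4 / u ^+ 2 = ((u / 2) * (u / 2))^-1 by field; rewrite gt_eqF.
  rewrite lef_pV2 ?posrE ?mulr_gt0 ?invr_gt0//.
  by rewrite ler_pM ?divr_ge0 ?(ltW u0)// ltW.
have Sl : (2 * u) ^- j <= \sum_(i < j.+1) x ^+ (j - i) * y ^+ i.
  rewrite big_ord_recl /= subn0 expr0 mulr1 -exprVn.
  apply: ler_wpDr; first by apply: sumr_ge0 => i _; rewrite mulr_ge0 ?exprn_ge0.
  by rewrite lerXn2r ?nnegrE.
have Su : \sum_(i < j.+1) x ^+ (j - i) * y ^+ i <= j.+1%:R * (2 / u) ^+ j.
  have -> : j.+1%:R * (2 / u) ^+ j = \sum_(i < j.+1) (2 / u) ^+ j.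
    by rewrite sumr_const card_ord -[RHS]mulr_natl.
  apply: ler_sum => i _.
  have ij : (i <= j)%N by rewrite -ltnS.
  rewrite -[in leRHS](subnK ij) exprD.
  by rewrite ler_pM ?exprn_ge0// lerXn2r ?nnegrE.
apply/andP; split.
  apply: le_trans (_ : d / (4 * u ^+ 2) * (2 * u) ^- j <= _).
    rewrite le_eqVlt; apply/orP; left; apply/eqP.
    rewrite -mulrA -invfM; congr (_ / _).
    by rewrite exprMn !exprS; ring.
  apply: ler_pM => //; last by rewrite invr_ge0 exprn_ge0// mulr_ge0// ltW.
  by rewrite divr_ge0// mulr_ge0// exprn_ge0// ltW.
apply: le_trans (_ : 4 * d / u ^+ 2 * (j.+1%:R * (2 / u) ^+ j) <= _).
  by apply: ler_pM.
rewrite le_eqVlt; apply/orP; left; apply/eqP.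
rewrite expr_div_n !exprS; field.
by rewrite expf_neq0 ?gt_eqF.
Qed.

Lemma phase_dilate J (a : 'I_J -> R) (d k : nat) :
  phase a (d * k) = phase (fun j => a j * invpow R j.+1 d) k.
Proof.
apply: eq_bigr => j _; rewrite /invpow natrM exprMn invfM.
by rewrite mulrA.
Qed.

Lemma phaseB J (a b : 'I_J -> R) t : phase a t - phase b t = phase (fun j => a j - b j) t.
Proof. by rewrite /phase -sumrB; apply: eq_bigr => j _; rewrite mulrBl. Qed.

(** The class of phases is stable under the operations of [vaughan_bound]:
    replacing [k] by [d * k] multiplies the coefficient of order [j] by
    [d ^ -(j + 1)], and the correlation along the progressions of ratios [c1] and
    [c2] has the coefficients [a j * (c1 ^ -(j + 1) - c2 ^ -(j + 1))], which keep
    their relative sizes up to a constant when [c1] and [c2] are far apart. In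
    both cases [power_sum_le] applies. The scale [X = Y ^ E] leaves room for the
    losses, which are powers of [Y]. *)
Lemma prime_phase_sum (J B : nat) : exists (E : nat) (W : nat) (C : R), (0 < E)%N /\ 0 < C /\
  forall (a : 'I_J -> R) (j0 : 'I_J) (N N' Y : nat),
  (W <= Y)%N -> (N <= N')%N -> (N' <= 2 * N)%N -> ((Y ^ E) ^ 3 <= N)%N ->
  let T := `|a j0| / N%:R ^+ j0.+1 in
  (Y ^ E)%:R <= T -> T <= (Y ^ E)%:R ^+ B ->
  (forall j, j != j0 -> `|a j| / N%:R ^+ j.+1 <= T / (Y ^ E)%:R) ->
  cnorm (\sum_(N.+1 <= p < N'.+1 | prime p) (ln p%:R)%:C%C * cexp (phase a p)) <=
    C * (1 + ln (2 * N)%:R) ^+ 4 * N%:R / Y%:R.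
Proof.
have [D0 [C0 [C02 hps]]] := power_sum_le R J B.+1.
pose E := (2 * D0 + 4)%N.
(* All the constants depending on [J] in the comparison of coefficients. *)
pose P := (2 ^ J.+2 * J.+1)%N.
pose W := (Num.truncn C0 + 2 ^ B.+2 * P ^ 2)%N.+1.
exists E, W, (42 * C0); split; first by rewrite /E addnS.
split; first by lra.
move=> a j0 N N' Y WY NN' N'N; set X := (Y ^ E)%N => XN T XT TX dom.
have hW : (Num.truncn C0 < W)%N by rewrite ltnS leq_addr.
have P0 : (0 < P)%N by rewrite muln_gt0 expn_gt0.
have P2 : (2 ^ J <= P)%N.
  by apply: leq_trans (_ : 2 ^ J.+2 <= _)%N; [rewrite leq_exp2l//; lia | rewrite leq_pmulr].
have WP : (2 ^ B.+2 * P ^ 2 <= Y)%N.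
  by apply: leq_trans WY; apply: leqW; rewrite leq_addl.
have PY2 : (P ^ 2 <= Y)%N by apply: leq_trans WP; rewrite leq_pmull// expn_gt0.
have PY : (P <= Y)%N by apply: leq_trans PY2; rewrite leq_pmulr.
have Y0 : (0 < Y)%N by apply: leq_trans WY.
have YR : (0 : R) < Y%:R by rewrite ltr0n.
have C0Y : C0 <= Y%:R.
  apply: ltW; apply: lt_le_trans (truncnS_gt _) _; rewrite ler_nat.
  exact: leq_trans hW WY.
have C0Y2 : C0 <= (Y ^ 2)%:R.
  by apply: le_trans C0Y _; rewrite ler_nat leq_pmulr.
have XE : X = (Y ^ (2 * D0) * Y ^ 4)%N by rewrite /X /E expnD.
have XD : (Y ^ (2 * D0) <= X)%N by rewrite XE leq_pmulr// expn_gt0 Y0.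
have X0 : (0 < X)%N by rewrite expn_gt0 Y0.
have XY4 : (Y ^ 4 <= X)%N by rewrite XE leq_pmull// expn_gt0 Y0.
have YX : (2 * Y ^ 2 <= X)%N.
  apply: leq_trans XY4; rewrite (expnD Y 2 2) leq_mul2r; apply/orP; right.
  apply: leq_trans (leq_trans WP (_ : Y <= Y ^ 2)%N); last by rewrite leq_pmulr.
  by rewrite expnS -mulnA leq_pmulr// muln_gt0 !expn_gt0 P0.
have XN1 : (X <= N)%N by apply: leq_trans XN; rewrite -{1}[X]expn1 leq_pexp2l.
have N0 : (0 < N)%N by apply: leq_trans XN1.
have NR : (0 : R) < N%:R by rewrite ltr0n.
have XR : (0 : R) < X%:R by rewrite ltr0n.
have T0 : 0 < T by apply: lt_le_trans XT.
have C00 : 0 < C0 by lra.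
pose g n : R[i] := cexp (phase a n).
have g1 n : cnorm (g n) <= 1 by rewrite cnorm_cexp.
have natX1 k : (Y ^ 2)%:R ^+ k = (Y ^ (2 * k))%:R :> R by rewrite -natrX -expnM.
(* The dilated phase, on an interval starting at [N / d]. *)
have typeI d u v : (0 < d <= X ^ 2)%N -> (N < d * u)%N -> (d * v <= N' + d)%N ->
    cnorm (\sum_(u <= k < v) g (d * k)%N) <= (2 * C0) * (N%:R / d%:R) / Y%:R ^+ 2.
  move=> /andP[d0 dX] Ndu dvN.
  have dR : (0 : R) < d%:R by rewrite ltr0n.
  pose M := (N %/ d).+1.
  have NdM : (N < d * M)%N by rewrite mulnC ltn_ceil.
  have MNd : M%:R <= 2 * (N%:R / d%:R) :> R.
    rewrite mulrA ler_pdivlMr// -!natrM ler_nat [(M * d)%N]mulSn mul2n -addnn leq_add ?leq_divM//.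
    apply: leq_trans dX _; apply: leq_trans XN.
    by rewrite leq_pexp2l.
  have dM2 : (d * M)%:R <= 2 * N%:R :> R.
    by rewrite mulnC natrM -ler_pdivlMr// -mulrA.
  have XM : (X <= M)%N.
    rewrite /M ltnW// ltnS leq_divRL//; apply: leq_trans XN.
    by rewrite expnS leq_mul.
  have dMR : (0 : R) < (d * M)%:R by rewrite ltr0n muln_gt0 d0.
  pose z j := a j * invpow R j.+1 d.
  have zE j : `|z j| / M%:R ^+ j.+1 = `|a j| / (d * M)%:R ^+ j.+1.
    rewrite /z normrM /invpow natrM exprMn invfM [`|_^-1|]ger0_norm ?mulrA//.
    by rewrite invr_ge0 exprn_ge0.
  have zu j : `|z j| / M%:R ^+ j.+1 <= `|a j| / N%:R ^+ j.+1.
    rewrite zE ler_wpM2l// lef_pV2 ?posrE ?exprn_gt0//.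
    by rewrite lerXn2r ?nnegrE// ler_nat ltnW.
  have zl : T / 2 ^+ J <= `|z j0| / M%:R ^+ j0.+1.
    rewrite zE /T -mulrA ler_wpM2l// -invfM lef_pV2 ?posrE ?mulr_gt0 ?exprn_gt0//.
    apply: le_trans (_ : (2 * N%:R) ^+ j0.+1 <= _).
      by rewrite lerXn2r ?nnegrE// mulr_ge0.
    rewrite exprMn mulrC ler_wpM2l ?exprn_ge0//.
    by rewrite ler_weXn2l// ler1n.
  have JY : 2 ^+ J <= Y%:R :> R.
    by rewrite -natrX ler_nat (leq_trans P2).
  have -> : \sum_(u <= k < v) g (d * k)%N = \sum_(u <= k < v) cexp (phase z k).
    by apply: eq_bigr => k _; rewrite /g phase_dilate.
  apply: le_trans (hps z j0 M (Y ^ 2)%N u v C0Y2 _ _ _ _ _ _) _.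
  - by rewrite -expnM; apply: leq_trans XM.
  - by rewrite ltn_divLR// mulnC.
  - rewrite leqNgt; apply/negP => h.
    have : (d * (2 * M).+1 <= N' + d)%N by apply: leq_trans dvN; rewrite leq_mul2l h orbT.
    rewrite mulnS addnC leq_add2r leqNgt => /negP; apply.
    by apply: leq_ltn_trans N'N _; rewrite mulnCA ltn_pmul2l.
  - rewrite natX1; apply: le_trans zl; apply: le_trans (_ : X%:R / 2 ^+ J <= _); last first.
      by rewrite ler_wpM2r// invr_ge0 exprn_ge0.
    rewrite ler_pdivlMr ?exprn_gt0// XE natrM ler_wpM2l//.
    by apply: le_trans JY _; rewrite ler_nat -{1}[Y]expn1 leq_pexp2l.
  - apply: le_trans (zu j0) _; apply: le_trans TX _.
    apply: le_trans (_ : X%:R ^+ B.+1 <= _).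
      by apply: ler_weXn2l => //; rewrite ler1n.
    by rewrite lerXn2r ?nnegrE// ler_nat.
  - move=> j jj0; apply: le_trans (zu j) _; apply: le_trans (dom j jj0) _.
    apply: le_trans (_ : T / 2 ^+ J / (Y ^ 2)%:R <= _); last first.
      by rewrite ler_wpM2r ?invr_ge0.
    rewrite -mulrA -invfM ler_wpM2l ?(ltW T0)//.
    rewrite lef_pV2 ?posrE ?mulr_gt0 ?exprn_gt0 ?ltr0n ?expn_gt0 ?Y0//.
    apply: le_trans (_ : Y%:R * (Y ^ 2)%:R <= _); first by rewrite ler_wpM2r.
    rewrite -natrM -expnS ler_nat; apply: leq_trans XY4.
    by rewrite leq_pexp2l.
  rewrite natrX ler_wpM2r ?invr_ge0 ?exprn_ge0//.
  by rewrite [2 * C0]mulrC -[leRHS]mulrA ler_wpM2l// ltW.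
(* The phase of the correlation. Relative to the phase of [g] at the scale [N],
   its coefficients are multiplied by [q = delta / w] up to the constant [P],
   where [w] is the common size of [c1] and [c2] and [delta] their distance. *)
have typeII K c1 c2 u v : (X < 2 * K)%N -> (X < c1)%N -> (X < c2)%N ->
    (N < c1 * (2 * K))%N -> (c1 * K <= N')%N -> (N < c2 * (2 * K))%N -> (c2 * K <= N')%N ->
    (N <= (c1 - c2 + (c2 - c1)) * (Y ^ 2 * K))%N -> (K <= u)%N -> (v <= 2 * K)%N ->
    cnorm (\sum_(u <= k < v) g (c1 * k)%N * conjc (g (c2 * k)%N)) <= (2 * C0) * K%:R / Y%:R ^+ 2.
  move=> XK Xc1 Xc2 Nc1 c1N Nc2 c2N dist Ku vK.
  have K0 : (0 < K)%N by rewrite -(ltn_pmul2l (isT : 0 < 2)%N) muln0 (leq_ltn_trans _ XK).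
  have KR : (0 : R) < K%:R by rewrite ltr0n.
  pose w : R := N%:R / K%:R.
  have w0 : 0 < w by rewrite divr_gt0.
  have cl c : (N < c * (2 * K))%N -> w / 2 < c%:R.
    rewrite /w -mulrA -invfM -natrM [(K * 2)%N]mulnC ltr_pdivrMr ?ltr0n ?muln_gt0//.
    by rewrite -natrM ltr_nat.
  have cu c : (c * K <= N')%N -> c%:R <= 2 * w.
    move=> h; rewrite /w mulrA ler_pdivlMr// -!natrM ler_nat.
    exact: leq_trans h N'N.
  pose delta : R := (c1 - c2 + (c2 - c1))%:R.
  have bnd j := invpow_diff_bounds j w0 (cl _ Nc1) (cu _ c1N) (cl _ Nc2) (cu _ c2N).
  rewrite -/delta in bnd.
  have dl : w / (Y ^ 2)%:R <= delta.
    rewrite /w -mulrA -invfM mulrC -natrM mulrC.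
    rewrite ler_pdivrMr ?ltr0n ?muln_gt0 ?expn_gt0 ?Y0 ?K0// -natrM ler_nat.
    by rewrite [(K * _)%N]mulnC.
  have delta0 : 0 <= delta by [].
  have du : delta <= 2 * w.
    rewrite /delta; have [c12|/ltnW c12] := leqP c1 c2.
      have -> : (c1 - c2 = 0)%N by apply/eqP.
      by rewrite add0n; apply: le_trans (cu _ c2N); rewrite ler_nat leq_subr.
    have -> : (c2 - c1 = 0)%N by apply/eqP.
    by rewrite addn0; apply: le_trans (cu _ c1N); rewrite ler_nat leq_subr.
  pose z j := a j * invpow R j.+1 c1 - a j * invpow R j.+1 c2.
  have wK k : w ^+ k * K%:R ^+ k = N%:R ^+ k.
    by rewrite -exprMn /w divfK// gt_eqF.
  pose q := delta / w.
  have zl (j : 'I_J) : `|a j| / N%:R ^+ j.+1 * (q / P%:R) <= `|z j| / K%:R ^+ j.+1.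
    have /andP[h _] := bnd j.
    rewrite /z -mulrBr normrM.
    apply: le_trans (_ : `|a j| * (delta / (w ^+ j.+2 * 2 ^+ j.+2)) / K%:R ^+ j.+1 <= _); last first.
      by rewrite ler_wpM2r ?invr_ge0 ?exprn_ge0// ler_wpM2l.
    have -> : `|a j| * (delta / (w ^+ j.+2 * 2 ^+ j.+2)) / K%:R ^+ j.+1 =
       `|a j| / N%:R ^+ j.+1 * (q / 2 ^+ j.+2).
      rewrite -wK /q (exprS w j.+1); field.
      by rewrite !expf_neq0 ?gt_eqF// divr_gt0.
    rewrite ler_wpM2l ?divr_ge0 ?exprn_ge0// ler_wpM2l ?divr_ge0 ?(ltW w0)//.
    rewrite lef_pV2 ?posrE ?exprn_gt0 ?ltr0n// -natrX ler_nat.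
    apply: leq_trans (_ : 2 ^ J.+2 <= _)%N; last by rewrite leq_pmulr.
    by rewrite leq_exp2l// !ltnS; apply: ltnW.
  have zu (j : 'I_J) : `|z j| / K%:R ^+ j.+1 <= `|a j| / N%:R ^+ j.+1 * (q * P%:R).
    have /andP[_ h] := bnd j.
    rewrite /z -mulrBr normrM.
    apply: le_trans (_ : `|a j| * (j.+1%:R * 2 ^+ j.+2 * delta / w ^+ j.+2) / K%:R ^+ j.+1 <= _).
      by rewrite ler_wpM2r ?invr_ge0 ?exprn_ge0// ler_wpM2l.
    have -> : `|a j| * (j.+1%:R * 2 ^+ j.+2 * delta / w ^+ j.+2) / K%:R ^+ j.+1 =
       `|a j| / N%:R ^+ j.+1 * (q * (2 ^+ j.+2 * j.+1%:R)).
      rewrite -wK /q (exprS w j.+1); field.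
      by rewrite !expf_neq0 ?gt_eqF// divr_gt0.
    rewrite ler_wpM2l ?divr_ge0 ?exprn_ge0// ler_wpM2l ?divr_ge0 ?(ltW w0)//.
    rewrite -natrX -natrM ler_nat leq_mul// ?leq_exp2l// ?ltnS; exact: ltnW.
  have q0 : 0 <= q by rewrite divr_ge0// ltW.
  have ql : ((Y ^ 2)%:R)^-1 <= q by rewrite /q ler_pdivlMr// mulrC.
  have qu : q <= 2 by rewrite /q ler_pdivrMr.
  have PR : (0 : R) < P%:R by rewrite ltr0n.
  have Y2R : (0 : R) < (Y ^ 2)%:R by rewrite ltr0n expn_gt0 Y0.
  have -> : \sum_(u <= k < v) g (c1 * k)%N * conjc (g (c2 * k)%N) =
     \sum_(u <= k < v) cexp (phase z k).
    by apply: eq_bigr => k _; rewrite /g -cexpN -cexpD !phase_dilate phaseB.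
  apply: le_trans (hps z j0 K (Y ^ 2)%N u v C0Y2 _ _ _ _ _ _) _ => //.
  - rewrite -expnM -(leq_pmul2l (isT : 0 < 2)%N); apply: leq_trans (ltnW XK).
    rewrite XE mulnC leq_mul2l; apply/orP; right; apply: leq_trans (_ : Y ^ 2 <= _)%N.
      apply: leq_trans (leq_trans WP (_ : Y <= Y ^ 2)%N); last by rewrite leq_pmulr.
      by rewrite expnS -mulnA leq_pmulr// muln_gt0 !expn_gt0 P0.
    by rewrite leq_pexp2l.
  - rewrite natX1; apply: le_trans (zl j0); rewrite -/T.
    apply: le_trans (_ : X%:R * (((Y ^ 2)%:R)^-1 / P%:R) <= _); last first.
      by rewrite ler_pM ?mulr_ge0 ?invr_ge0// ler_wpM2r ?invr_ge0.
    rewrite -invfM ler_pdivlMr ?mulr_gt0// XE natrM ler_wpM2l//.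
    rewrite -natrM ler_nat (expnD Y 2 2) leq_mul2l; apply/orP; right.
    by apply: leq_trans PY _; rewrite leq_pmulr.
  - apply: le_trans (zu j0) _; rewrite -/T.
    apply: le_trans (_ : X%:R ^+ B * (2 * P%:R) <= _).
      by apply: ler_pM => //; [exact: ltW | exact: mulr_ge0 | exact: ler_wpM2r].
    apply: le_trans (_ : (X%:R / 2) ^+ B.+1 <= _); last first.
      rewrite lerXn2r ?nnegrE ?divr_ge0// ler_pdivrMr// -natrM ler_nat mulnC.
      exact: ltnW.
    rewrite expr_div_n ler_pdivlMr ?exprn_gt0// [X%:R ^+ B.+1]exprSr -mulrA ler_wpM2l ?exprn_ge0//.
    rewrite -natrX -!natrM ler_nat; apply: leq_trans XY4.
    apply: leq_trans (_ : 2 ^ B.+2 * P ^ 2 <= _)%N; last first.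
      by apply: leq_trans WP _; rewrite -{1}[Y]expn1 leq_pexp2l.
    rewrite mulnAC -expnS leq_mul2l; apply/orP; right.
    by rewrite leq_pmulr.
  - move=> j jj0; apply: le_trans (zu j) _.
    apply: le_trans (_ : T / X%:R * (q * P%:R) <= _).
      by apply: ler_wpM2r; [exact: mulr_ge0 | exact: dom].
    apply: le_trans (_ : T * (q / P%:R) / (Y ^ 2)%:R <= _); last first.
      by apply: ler_wpM2r; [rewrite invr_ge0 | exact: zl].
    have -> : T / X%:R * (q * P%:R) = T * (q * (P%:R / X%:R)).
      by rewrite -mulrA; congr (_ * _); rewrite mulrCA [_ * P%:R]mulrC.
    have -> : T * (q / P%:R) / (Y ^ 2)%:R = T * (q * (P%:R^-1 / (Y ^ 2)%:R)).
      by rewrite -mulrA; congr (_ * _); rewrite -mulrA.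
    apply: ler_wpM2l; first exact: ltW.
    apply: ler_wpM2l => //.
    rewrite -invfM -[leRHS]mul1r ler_pdivlMr ?mulr_gt0// mulrAC ler_pdivrMr// mul1r.
    rewrite -!natrM ler_nat; apply: leq_trans XY4.
    rewrite mulnA mulnn (expnD Y 2 2) leq_mul2r; apply/orP; right.
    by apply: leq_trans PY2 _; rewrite leq_pmulr.
  rewrite natrX ler_wpM2r ?invr_ge0 ?exprn_ge0// ler_wpM2r//.
  by move: C02; clear; lra.
have CC : 1 <= 2 * C0 by lra.
have vb := vaughan_bound g1 NN' N'N CC Y0 YX XN1 typeI typeII.
have YN' : (Y ^ 2 <= N')%N.
  apply: leq_trans NN'; apply: leq_trans XN1; apply: leq_trans YX.
  by rewrite leq_pmull.
have vp := vonMangoldt_primes N g1 Y0 YN'.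
set l := 1 + _ in vb *.
have l1 : 1 <= l by rewrite lerDl ln_nat_ge0.
rewrite -cnormN in vp.
have vp' : cnorm (- (\sum_(N.+1 <= n < N'.+1) (vonMangoldt R n)%:C%C * g n -
   \sum_(N.+1 <= p < N'.+1 | prime p) (ln p%:R)%:C%C * g p)) <= 2 * l ^+ 4 * (N%:R / Y%:R).
  apply: le_trans vp _.
  have -> : 2 * l ^+ 4 * (N%:R / Y%:R) = (2 * N%:R / Y%:R) * l ^+ 4 by ring.
  apply: ler_pM; rewrite ?divr_ge0 ?ln_nat_ge0//.
    by rewrite ler_wpM2r ?invr_ge0// -natrM ler_nat.
  apply: le_trans (_ : l <= _); last by apply: ler_eXnr.
  exact: ln_le_l.
have -> : \sum_(N.+1 <= p < N'.+1 | prime p) (ln p%:R)%:C%C * cexp (phase a p) =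
   \sum_(N.+1 <= n < N'.+1) (vonMangoldt R n)%:C%C * g n
  + - (\sum_(N.+1 <= n < N'.+1) (vonMangoldt R n)%:C%C * g n -
   \sum_(N.+1 <= p < N'.+1 | prime p) (ln p%:R)%:C%C * g p).
  by rewrite opprB addrC subrK.
apply: le_trans (cnormD _ _) _; apply: le_trans (lerD vb vp') _.
have l40 : 0 <= l ^+ 4 by rewrite exprn_ge0// (le_trans ler01).
have NY : 0 <= N%:R / Y%:R :> R by rewrite divr_ge0.
have -> : 20 * (2 * C0) * l ^+ 4 * N%:R / Y%:R = 40 * C0 * (l ^+ 4 * (N%:R / Y%:R)) by ring.
have -> : 42 * C0 * l ^+ 4 * N%:R / Y%:R = 42 * C0 * (l ^+ 4 * (N%:R / Y%:R)) by ring.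
have -> : 2 * l ^+ 4 * (N%:R / Y%:R) = 2 * (l ^+ 4 * (N%:R / Y%:R)) by rewrite -mulrA.
have : 0 <= l ^+ 4 * (N%:R / Y%:R) by rewrite mulr_ge0.
by move: (l ^+ 4 * _) C02 => w; clear; nra.
Qed.

End PrimePhases.

(** * A trigonometric majorant for an interval *)

Section TrigonometricMajorant.
Variable R : realType.

Lemma cexpX (x : R) n : cexp x ^+ n = cexp (n%:R * x).
Proof.
elim: n => [|n IHn]; first by rewrite expr0 mul0r cexp0.
by rewrite exprS IHn -cexpD -[n.+1%:R]natr1 mulrDl mul1r addrC.
Qed.

Lemma cexp_int (k : int) : cexp (k%:~R : R) = 1.
Proof.
case: k => k; first exact: cexp_nat.
have h : cexp ((Posz k.+1)%:~R : R) = 1 by exact: cexp_nat.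
by rewrite NegzE rmorphN cexpN h conjc1.
Qed.

Lemma cnorm_1Bcexp_dist (d y : R) : 0 <= d -> d <= y -> y <= 1 - d ->
  2 * d <= cnorm (1 - cexp y).
Proof.
move=> d0 dy yd; have [y2|y2] := leP y 2^-1.
  by apply: le_trans (cnorm_1Bcexp_ge _ y2); lra.
have -> : cnorm (1 - cexp y) = cnorm (1 - cexp (1 - y)).
  have -> : 1 - cexp y = conjc (1 - cexp (1 - y)); last exact: cnorm_conj.
  have -> : conjc (1 - cexp (1 - y)) = conjc 1 - conjc (cexp (1 - y)) by exact: rmorphB.
  rewrite -cexpN opprB (_ : conjc 1 = 1 :> R[i]); last exact: rmorph1.
  by rewrite cexpD cexpN (_ : cexp 1 = 1 :> R[i]); [rewrite (_ : conjc 1 = 1 :> R[i]) ?mulr1//; exact: rmorph1 | exact: (cexp_nat R 1)].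
by apply: le_trans (cnorm_1Bcexp_ge _ _); lra.
Qed.

Lemma sum_cexp_grid (Q i j : nat) : (i < Q)%N -> (j < Q)%N ->
  \sum_(q < Q) cexp ((i%:R - j%:R) * (- (q%:R / Q%:R)) : R) = (if i == j then Q else 0%N)%:R.
Proof.
move=> iQ jQ; have Q0 : (0 : R) < Q%:R by rewrite ltr0n (leq_ltn_trans _ iQ).
case: eqVneq => [->|ij].
  rewrite (eq_bigr (fun=> 1)); first by rewrite sumr_const card_ord.
  by move=> q _; rewrite subrr mul0r cexp0.
pose y : R := (j%:R - i%:R) / Q%:R.
have E (q : 'I_Q) : cexp ((i%:R - j%:R) * (- (q%:R / Q%:R)) : R) = cexp y ^+ q.
  by rewrite cexpX; congr cexp; rewrite /y; field; rewrite gt_eqF.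
rewrite (eq_bigr _ (fun q _ => E q)).
have w1 : cexp y != 1.
  have main k : (0 < k < Q)%N -> cexp (k%:R / Q%:R : R) != 1.
    move=> /andP[k0 kQ]; apply/eqP => h.
    have : 2 * Q%:R^-1 <= cnorm (1 - cexp (k%:R / Q%:R : R)).
      apply: cnorm_1Bcexp_dist; first by rewrite invr_ge0 ltW.
        by rewrite ler_peMl ?invr_ge0 ?(ltW Q0)// ler1n.
      by rewrite lerBrDr -{2}[Q%:R^-1]mul1r -mulrDl ler_pdivrMr// mul1r natr1 ler_nat.
    rewrite h subrr cnorm0 pmulr_rle0// leNgt invr_gt0 Q0//.
  move: ij; rewrite neq_ltn => /orP[ij|ji].
    by rewrite /y -natrB ?(ltnW ij)// main// subn_gt0 ij (leq_ltn_trans (leq_subr _ _)).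
  have -> : y = - ((i - j)%:R / Q%:R).
    by rewrite /y natrB ?(ltnW ji)// -mulNr opprB.
  rewrite cexpN; apply/eqP => /(congr1 conjc); rewrite conjcK conjc1 => /eqP; apply/negP.
  by apply: main; rewrite subn_gt0 ji (leq_ltn_trans (leq_subr _ _)).
have : (1 - cexp y) * \sum_(q < Q) cexp y ^+ q = 0.
  have := subrX1 (cexp y) Q; rewrite cexpX.
  have -> : Q%:R * y = (j%:Z - i%:Z)%:~R.
    by rewrite /y mulrCA mulfV ?gt_eqF// mulr1 rmorphB.
  rewrite cexp_int subrr => h.
  by rewrite -opprB mulNr -h oppr0.
by move=> /eqP; rewrite mulf_eq0 subr_eq0 eq_sym (negPf w1) => /eqP.
Qed.

(** This is [cos (pi x) ^ (2 N)]: nonnegative, a trigonometric polynomial of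
    degree [N], and concentrated near the integers. *)
Definition fejer (N : nat) (x : R) : R := (cnorm (1 + cexp x) / 2) ^+ (2 * N).

Lemma fejer_ge0 N x : 0 <= fejer N x.
Proof. by rewrite exprn_ge0// divr_ge0// cnorm_ge0. Qed.

Lemma fejer0 N : fejer N 0 = 1.
Proof.
rewrite /fejer cexp0; have -> : 1 + 1 = (2 : R)%:C%C by rewrite rmorph_nat mulr2n.
by rewrite cnorm_real ger0_norm// divff ?expr1n// pnatr_eq0.
Qed.

Definition fejer_coef (N i j : nat) : R := ('C(N, i) * 'C(N, j))%:R / 4 ^+ N.

Lemma fejerE N x : (fejer N x)%:C%C =
  \sum_(i < N.+1) \sum_(j < N.+1) (fejer_coef N i j)%:C%C * cexp ((i%:R - j%:R) * x).
Proof.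
have E : (1 + cexp x) ^+ N = \sum_(i < N.+1) ('C(N, i)%:R : R)%:C%C * cexp (i%:R * x).
  rewrite exprDn; apply: eq_bigr => i _.
  by rewrite expr1n mul1r cexpX rmorph_nat [RHS]mulr_natl.
have -> : (fejer N x)%:C%C = (4 ^- N : R)%:C%C * ((1 + cexp x) ^+ N * conjc ((1 + cexp x) ^+ N)).
  rewrite -cnorm_sqr -rmorphM /=; congr (_ %:C%C).
  have -> : cnorm ((1 + cexp x) ^+ N) = cnorm (1 + cexp x) ^+ N.
    by elim: (N) => [|n IHn]; rewrite ?expr0 ?cnorm1// !exprS cnormM IHn.
  rewrite /fejer expr_div_n [LHS]mulrC -exprM mulnC; congr (_^-1 * _).
  by rewrite mulnC exprM expr2 -natrM.
rewrite {1}E E conjc_sum mulr_suml mulr_sumr; apply: eq_bigr => i _.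
rewrite [in LHS]mulr_sumr [LHS]mulr_sumr; apply: eq_bigr => j _.
rewrite conjcM conjc_real -cexpN mulrBl cexpD /fejer_coef natrM !rmorphM /=.
by ring.
Qed.

(** The frequencies have absolute value at most [N], so averaging over a grid of
    [N.+1] points kills all of them but 0. *)
Lemma sum_fejer_grid (N : nat) (x : R) :
  \sum_(q < N.+1) fejer N (x - q%:R / N.+1%:R) = N.+1%:R * \sum_(i < N.+1) fejer_coef N i i.
Proof.
apply: complexI; rewrite rmorph_sum /=.
transitivity (\sum_(i < N.+1) \sum_(j < N.+1) (fejer_coef N i j)%:C%C *
    (cexp ((i%:R - j%:R) * x) * \sum_(q < N.+1) cexp ((i%:R - j%:R) * (- (q%:R / N.+1%:R)) : R))).
  rewrite (eq_bigr _ (fun (q : 'I_N.+1) _ => fejerE N (x - q%:R / N.+1%:R))) exchange_big /=.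
  apply: eq_bigr => i _; rewrite exchange_big /=; apply: eq_bigr => j _.
  rewrite -[LHS]mulr_sumr; congr (_ * _); rewrite mulr_sumr; apply: eq_bigr => q _.
  by rewrite mulrDr cexpD.
rewrite rmorphM rmorph_sum [RHS]mulr_sumr; apply: eq_bigr => i _.
rewrite (bigD1 i)//= [X in _ + X]big1 ?addr0 => [|j ji].
  by rewrite sum_cexp_grid// eqxx subrr mul0r cexp0 mul1r rmorph_nat mulrC.
rewrite sum_cexp_grid// val_eqE eq_sym (negPf ji) /=.
by rewrite mulr0n !mulr0.
Qed.

Lemma fejer_far N (d y : R) : 0 <= d -> d <= y -> y <= 1 - d ->
  fejer N y <= (1 - d ^+ 2) ^+ N.
Proof.
move=> d0 dy yd; rewrite /fejer exprM.
have h : (cnorm (1 + cexp y) / 2) ^+ 2 <= 1 - d ^+ 2.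
  have := cnorm_1Bcexp_dist d0 dy yd; rewrite -(@ler_pXn2r _ 2)// ?nnegrE ?cnorm_ge0 ?mulr_ge0//.
  rewrite expr_div_n !cnormE2 /= => h.
  rewrite ler_pdivrMr ?exprn_gt0//.
  have := cos2Dsin2 (2 * pi * y); move: h.
  move: (cos _) (sin _) => c s h1 h2.
  by move: h1 h2; clear; nra.
by rewrite lerXn2r ?nnegrE ?sqr_ge0// (le_trans _ h)// sqr_ge0.
Qed.

Lemma fejerN N x : fejer N (- x) = fejer N x.
Proof.
rewrite /fejer cexpN; have -> : 1 + conjc (cexp x) = conjc (1 + cexp x).
  by case: (cexp x) => a b; apply/eqP; rewrite eq_complex /=; apply/andP; split; apply/eqP; ring.
by rewrite cnorm_conj.
Qed.

Lemma fejerD_nat N x (k : nat) : fejer N (x + k%:R) = fejer N x.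
Proof. by rewrite /fejer cexpD cexp_nat mulr1. Qed.

Lemma bernoulli (s : R) (M : nat) : 0 <= s -> M%:R * s <= (1 + s) ^+ M.
Proof.
move=> s0; apply: le_trans (_ : 1 + M%:R * s <= _); first by rewrite lerDr.
elim: M => [|M IHM]; first by rewrite mul0r addr0 expr0.
rewrite exprS -[M.+1%:R]natr1.
apply: le_trans (_ : (1 + s) * (1 + M%:R * s) <= _).
  have : 0 <= M%:R * s by rewrite mulr_ge0.
  by move: (M%:R : R) s0 => m; clear; nra.
by rewrite ler_wpM2l// addr_ge0.
Qed.

(** [(1 - s) (1 + s) <= 1] and the Bernoulli inequality turn the geometric decay
    into a polynomial one that beats the factor [N.+1]. *)
Lemma small_tail (d : R) : 0 < d -> d < 1 ->
  exists N : nat, 2 / N.+1%:R + N.+1%:R * (1 - d ^+ 2) ^+ N <= d.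
Proof.
move=> d0 d1; pose s := d ^+ 2.
have s0 : 0 < s by rewrite exprn_gt0.
pose M := (Num.truncn ((2 + 3 / s ^+ 2) / d)).+1.
have M0 : (0 : R) < M%:R by rewrite ltr0n.
have hM : (2 + 3 / s ^+ 2) / M%:R <= d.
  rewrite ler_pdivrMr// [d * _]mulrC -ler_pdivrMr//.
  exact: ltW (truncnS_gt _).
exists (2 * M)%N; apply: le_trans hM; rewrite [leRHS]mulrDl; apply: lerD.
  rewrite ler_wpM2l// lef_pV2 ?posrE ?ltr0n// ler_nat.
  by apply: leqW; rewrite leq_pmull.
have h : (1 - s) * (1 + s) <= 1 by rewrite -subr_sqr expr1n gerBl sqr_ge0.
have s1 : 0 <= 1 - s.
  by rewrite subr_ge0 /s expr2 -[leRHS]mulr1 ler_pM// ltW.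
have hb := bernoulli M (ltW s0).
have Ms0 : 0 < M%:R * s by rewrite mulr_gt0.
have e1 : (1 - s) ^+ (2 * M) * (M%:R * s) ^+ 2 <= 1.
  apply: le_trans (_ : (1 - s) ^+ (2 * M) * ((1 + s) ^+ M) ^+ 2 <= _).
    rewrite ler_wpM2l ?exprn_ge0// lerXn2r ?nnegrE ?exprn_ge0 ?addr_ge0 ?(ltW s0)//.
    exact: ltW.
  rewrite -exprM mulnC -exprMn; apply: exprn_ile1 => //.
  by rewrite mulr_ge0// addr_ge0// ltW.
have M3 : (2 * M).+1%:R <= 3 * M%:R :> R by rewrite -natrM ler_nat; lia.
rewrite -ler_pdivlMr ?exprn_gt0// in e1.
apply: le_trans (ler_pM _ _ M3 e1) _ => //; first by rewrite exprn_ge0.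
rewrite le_eqVlt; apply/orP; left; apply/eqP.
by field; rewrite !gt_eqF.
Qed.

(** Sum the kernel over the grid points that are not far from [[0, 1 / L]]. The
    sum over the whole grid is the constant [Z], and the far points contribute
    little on [[0, 1 / L]]; adding a small constant there makes the normalized sum
    at least 1. The mean value is close to the proportion of the points that were
    kept. *)
Lemma trig_majorant (L : nat) (eta : R) : (0 < L)%N -> 0 < eta ->
  exists (T : finType) (freq : T -> int) (b : T -> R[i]) (Br : R -> R) (c : R),
  [/\ forall x, \sum_t b t * cexp ((freq t)%:~R * x) = (Br x)%:C%C,
      forall x, 0 <= Br x,
      forall x (k : nat), k%:R <= x -> x < k%:R + L%:R^-1 -> 1 <= Br x &
      \sum_(t | freq t == 0) b t = c%:C%C /\ 0 <= c <= (1 + eta) / L%:R].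
Proof.
move=> L0 eta0; have LR : (0 : R) < L%:R by rewrite ltr0n.
pose d : R := Num.min (eta / (3 * L%:R)) 2^-1.
have d0 : 0 < d by rewrite lt_min invr_gt0 divr_gt0 ?mulr_gt0/=.
have d1 : d < 1 by rewrite gt_min; apply/orP; right; lra.
have deta : 3 * d <= eta / L%:R.
  rewrite -ler_pdivlMl// mulrC -mulrA -invfM [L%:R * 3]mulrC.
  by rewrite ge_min lexx.
have [N hN] := small_tail d0 d1.
pose Q := N.+1; rewrite -/Q in hN.
have QR : (0 : R) < Q%:R by rewrite ltr0n.
pose K0 : R := \sum_(i < Q) fejer_coef N i i.
pose Z : R := Q%:R * K0.
have ZE x : \sum_(q < Q) fejer N (x - q%:R / Q%:R) = Z by apply: sum_fejer_grid.
have Z1 : 1 <= Z.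
  rewrite -(ZE 0) big_ord_recl mul0r subr0 fejer0 lerDl.
  by apply: sumr_ge0 => q _; apply: fejer_ge0.
have Z0 : 0 < Z by apply: lt_le_trans Z1.
pose far (q : 'I_Q) := (L%:R^-1 + d <= q%:R / Q%:R) && (q%:R / Q%:R <= 1 - d).
pose kap : R := Q%:R * (1 - d ^+ 2) ^+ N.
have kap0 : 0 <= kap.
  by rewrite mulr_ge0// exprn_ge0// subr_ge0 expr2 -[leRHS]mulr1 ler_pM// ltW.
pose Br x : R := kap + (\sum_(q < Q | ~~ far q) fejer N (x - q%:R / Q%:R)) / Z.
pose b (t : 'I_1 + 'I_Q * 'I_Q) : R[i] := match t with
  | inl _ => kap%:C%C
  | inr (i, j) => (fejer_coef N i j / Z)%:C%C *
      \sum_(q < Q | ~~ far q) cexp ((i%:R - j%:R) * (- (q%:R / Q%:R)) : R)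
  end.
pose freq (t : 'I_1 + 'I_Q * 'I_Q) : int := match t with
  | inl _ => 0
  | inr (i, j) => (i : nat)%:Z - (j : nat)%:Z
  end.
pose F : R := \sum_(q < Q | ~~ far q) 1.
exists ('I_1 + 'I_Q * 'I_Q)%type, freq, b, Br, (kap + F / Q%:R).
have Br0 x : 0 <= Br x.
  by rewrite addr_ge0// divr_ge0 ?sumr_ge0 ?(ltW Z0)// => q _; apply: fejer_ge0.
split => //.
- move=> x; rewrite big_sumType /= big_ord1 mul0r cexp0 mulr1 rmorphD /=; congr (_ + _).
  transitivity (\sum_(i < Q) \sum_(j < Q) b (inr (i, j)) * cexp ((freq (inr (i, j)))%:~R * x)).
    by rewrite pair_bigA; apply: eq_bigr => -[i j].
  have -> : ((\sum_(q < Q | ~~ far q) fejer N (x - q%:R / Q%:R)) / Z)%:C%C =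
    (Z^-1)%:C%C * \sum_(i < Q) \sum_(j < Q) (fejer_coef N i j)%:C%C *
       \sum_(q < Q | ~~ far q) cexp ((i%:R - j%:R) * (x - q%:R / Q%:R)).
    rewrite [LHS]rmorphM [LHS]mulrC rmorph_sum; congr (_ * _).
    transitivity (\sum_(q < Q | ~~ far q) \sum_(i < Q) \sum_(j < Q)
        (fejer_coef N i j)%:C%C * cexp ((i%:R - j%:R) * (x - q%:R / Q%:R))).
      by apply: eq_bigr => q _; rewrite -fejerE.
    rewrite exchange_big; apply: eq_bigr => i _.
    rewrite exchange_big; apply: eq_bigr => j _.
    by rewrite [RHS]mulr_sumr.
  rewrite [RHS]mulr_sumr; apply: eq_bigr => i _.
  rewrite [RHS]mulr_sumr; apply: eq_bigr => j _.
  rewrite /= [(_ / Z)%:C%C]rmorphM [_%:C%C * _%:C%C]mulrC -!mulrA; congr (_ * (_ * _)).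
  rewrite mulr_suml; apply: eq_bigr => q _.
  by rewrite -cexpD rmorphB /= -!pmulrn -mulrDr [- _ + x]addrC.
- move=> x k kx xk.
  have -> : 1 = Z / Z :> R by rewrite divff ?gt_eqF.
  rewrite -{1}(ZE x) (bigID far) /= mulrDl lerD2r.
  rewrite ler_pdivrMr//; apply: le_trans (_ : kap <= _); last by rewrite ler_peMr.
  have -> : kap = \sum_(q < Q) (1 - d ^+ 2) ^+ N.
    by rewrite sumr_const card_ord -[RHS]mulr_natl.
  rewrite big_mkcond /=.
  apply: ler_sum => q _; case: ifP => [/andP[q1 q2]|_]; last first.
    by rewrite exprn_ge0// subr_ge0 expr2 -[leRHS]mulr1 ler_pM// ltW.
  have -> : fejer N (x - q%:R / Q%:R) = fejer N (q%:R / Q%:R - (x - k%:R)).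
    by rewrite -fejerN -(fejerD_nat N _ k); congr (fejer N _); ring.
  by apply: fejer_far; lra.
rewrite big_mkcond big_sumType /= big_ord1 rmorphD /=; split.
  congr (_ + _).
  transitivity (\sum_(i < Q) \sum_(j < Q) (if freq (inr (i, j)) == 0 then b (inr (i, j)) else 0)).
    by rewrite pair_bigA; apply: eq_bigr => -[i j].
  have -> : F / Q%:R = \sum_(i < Q) fejer_coef N i i / Z * F.
    have K00 : K0 != 0 by apply/eqP => h; move: Z0; rewrite /Z h mulr0 ltxx.
    rewrite -[RHS]mulr_suml -[X in X * F]mulr_suml -/K0 /Z; field.
    by rewrite K00 ?gt_eqF.
  rewrite rmorph_sum; apply: eq_bigr => i _.
  rewrite (bigD1 i)//= subrr eqxx [X in _ + X]big1 ?addr0 => [|j ji].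
    rewrite [RHS]rmorphM; congr (_ * _); rewrite [RHS]rmorph_sum; apply: eq_bigr => q _.
    by rewrite subrr mul0r cexp0.
  by rewrite subr_eq0 eqz_nat val_eqE eq_sym (negPf ji).
have F0 : 0 <= F by rewrite /F sumr_ge0.
apply/andP; split; first by rewrite addr_ge0// divr_ge0.
(* The points kept lie in [[0, 1 / L + d)] or in [(1 - d, 1)]. *)
have Fle : F <= (Q%:R * (L%:R^-1 + d) + 1) + (Q%:R * d + 1).
  apply: le_trans (_ : \sum_(q < Q) (q%:R < Q%:R * (L%:R^-1 + d))%R%:R +
    \sum_(q < Q) ((rev_ord q)%:R < Q%:R * d)%R%:R <= _); last first.
    apply: lerD; first by apply: sum_nat_lt_le; rewrite mulr_ge0// addr_ge0 ?invr_ge0 ?(ltW d0).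
    rewrite (reindex_inj rev_ord_inj).
    under eq_bigr => q _ do rewrite rev_ordK.
    by apply: sum_nat_lt_le; rewrite mulr_ge0// ltW.
  rewrite /F big_mkcond -big_split /=; apply: ler_sum => q _.
  case: ifPn => [|_]; last by rewrite addr_ge0.
  rewrite negb_and -!ltNge => /orP[h|h].
    rewrite ltr_pdivrMr// mulrC in h.
    by rewrite h lerDl.
  rewrite ltr_pdivlMr// in h.
  have -> : (Q - q.+1)%:R < Q%:R * d.
    rewrite natrB// -[q.+1%:R]natr1; move: h; rewrite mulrBl mul1r [d * _]mulrC.
    by move: (Q%:R * d) (Q%:R) (q%:R) => z u v; clear; lra.
  by rewrite lerDr.
apply: le_trans (_ : kap + (L%:R^-1 + 2 * d + 2 / Q%:R) <= _).
  rewrite lerD2l ler_pdivrMr//; apply: le_trans Fle _.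
  rewrite le_eqVlt; apply/orP; left; apply/eqP.
  by field; rewrite !gt_eqF.
rewrite mulrDl mul1r; move: hN deta; rewrite -/kap.
by move: (eta / L%:R) (2 / Q%:R : R) (L%:R^-1 : R) => u v w; clear; lra.
Qed.

End TrigonometricMajorant.

(** * Residues of truncated exponents over a block of primes *)

Section ResidueCount.

Lemma val_sum_ord (L : nat) (I : finType) (r : I -> 'I_L.+1) :
  (\sum_i r i)%R = ((\sum_i r i) %% L.+1)%N :> nat.
Proof.
elim/big_rec2: _ => [|i x y _ IH]; first by rewrite mod0n.
by rewrite /= IH modnDmr.
Qed.

(** Shifting one coordinate by all residues makes the sum of the coordinates
    run through all residues. *)
Lemma sum_residue_count (R : fieldType) (L J : nat) (G : 'I_L.+1 -> R) :
  L.+1%:R != 0 :> R ->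
  \sum_(r : {ffun 'I_J.+1 -> 'I_L.+1}) G (\sum_j r j)%R = L.+1%:R ^+ J * \sum_v G v.
Proof.
move=> L0; apply: (mulfI L0).
rewrite mulrA -exprS.
have -> : L.+1%:R * \sum_(r : {ffun 'I_J.+1 -> 'I_L.+1}) G (\sum_j r j)%R =
    \sum_(s : 'I_L.+1) \sum_(r : {ffun 'I_J.+1 -> 'I_L.+1}) G (\sum_j r j)%R.
  by rewrite sumr_const card_ord -[RHS]mulr_natl.
pose shift s (r : {ffun 'I_J.+1 -> 'I_L.+1}) := [ffun j => if j == ord0 then r j + s else r j].
have shiftK s : cancel (shift s) (shift (- s)).
  by move=> r; apply/ffunP => j; rewrite !ffunE; case: eqP => // _; rewrite addrK.
have shiftS s r : \sum_j shift s r j = \sum_j r j + s.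
  rewrite !big_ord_recl ffunE eqxx /= addrAC; congr (_ + _ + _).
  by apply: eq_bigr => j _; rewrite ffunE.
transitivity (\sum_(s : 'I_L.+1) \sum_(r : {ffun 'I_J.+1 -> 'I_L.+1}) G (\sum_j r j + s)).
  apply: eq_bigr => s _.
  rewrite (reindex (shift s)); last first.
    exists (shift (- s)) => r _; first exact: shiftK.
    by have := shiftK (- s) r; rewrite opprK.
  by apply: eq_bigr => r _; rewrite shiftS.
rewrite exchange_big /=.
rewrite (eq_bigr (fun=> \sum_v G v)) => [|r _].
  by rewrite sumr_const card_ffun !card_ord -[LHS]mulr_natl natrX.
rewrite (reindex (fun v => v - \sum_j r j)); last first.
  by exists (fun s => \sum_j r j + s) => s _; [rewrite addrC subrK | rewrite addrC addKr].
by apply: eq_bigr => v _; rewrite addrC subrK.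
Qed.

End ResidueCount.

Section PrimeResidues.
Variable R : realType.

(** The exponent of [p] in [n!], truncated to the powers up to [p ^ J]. *)
Definition truncated_legendre (n J p : nat) : nat := (\sum_(j < J) n %/ p ^ j.+1)%N.

Lemma expr1D_small (J : nat) (eps : R) : 0 < eps ->
  exists2 eta : R, 0 < eta & (1 + eta) ^+ J <= 1 + eps.
Proof.
move=> eps0; pose eta : R := Num.min 1 (eps / 3 ^+ J).
have p3 k : 1 <= 3 ^+ k :> R by rewrite exprn_ege1// ler1n.
have eta0 : 0 < eta by rewrite lt_min ltr01 divr_gt0// exprn_gt0.
have eta1 : eta <= 1 by rewrite ge_min lexx.
exists eta => //; apply: le_trans (_ : 1 + 3 ^+ J * eta <= _).
  elim: (J) => [|k IHk]; first by rewrite !expr0 mul1r lerDl ltW.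
  rewrite !exprS; apply: le_trans (_ : (1 + eta) * (1 + 3 ^+ k * eta) <= _).
    by rewrite ler_wpM2l// addr_ge0// ltW.
  have := p3 k; move: (3 ^+ k) => t t1.
  have : t * eta * eta <= t * eta * 1.
    by rewrite ler_wpM2l// mulr_ge0 ?(ltW eta0)// (le_trans ler01).
  by move: eta0 t1; clear; nra.
rewrite lerD2l -ler_pdivlMl ?exprn_gt0// mulrC.
by rewrite ge_min lexx orbT.
Qed.

(** The residue [r] of [n %/ m] modulo [L] is read off [n / (L m)]: its fractional
    part lies in [[r / L, (r + 1) / L)]. *)
Lemma residue_interval (L n m : nat) (r : nat) : (0 < L)%N -> (0 < m)%N ->
  (n %/ m %% L = r)%N -> exists k : nat,
  k%:R <= n%:R / L%:R * invpow R 1 m - r%:R / L%:R < k%:R + L%:R^-1.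
Proof.
move=> L0 m0 rE; exists (n %/ m %/ L)%N.
have LR : (0 : R) < L%:R by rewrite ltr0n.
have mR : (0 : R) < m%:R by rewrite ltr0n.
set k := (_ %/ L)%N; have E : (n %/ m = k * L + r)%N by rewrite -rE -divn_eq.
have h1 : (k * L + r)%:R <= n%:R / m%:R :> R.
  by rewrite ler_pdivlMr// -natrM ler_nat -E leq_divM.
have h2 : n%:R / m%:R < (k * L + r)%:R + 1 :> R.
  by rewrite natr1 ltr_pdivrMr// -natrM ltr_nat -E ltn_ceil.
have -> : n%:R / L%:R * invpow R 1 m - r%:R / L%:R = (n%:R / m%:R - r%:R) / L%:R.
  by rewrite /invpow expr1; field; rewrite !gt_eqF.
rewrite natrD natrM in h1; rewrite natrD natrM in h2.
apply/andP; split; first by rewrite ler_pdivlMr//; lra.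
rewrite ltr_pdivrMr// mulrDl mulVf ?gt_eqF//; lra.
Qed.

Lemma cexp_sum (I : finType) (F : I -> R) : \prod_i cexp (F i) = cexp (\sum_i F i).
Proof.
by elim/big_rec2: _ => [|i x y _ ->]; rewrite ?cexp0 ?cexpD.
Qed.

Lemma prod_ge1 (I : finType) (F : I -> R) : (forall i, 1 <= F i) -> 1 <= \prod_i F i.
Proof. by move=> F1; elim/big_rec: _ => // i x _ x1; apply: mulr_ege1. Qed.

(** Split according to the residues [r j] of the [n %/ p ^ j.+1], whose sum must
    lie in [A], and majorize each indicator by [trig_majorant]. In the expansion
    of the product, the frequencies that are all zero give the main term, the
    number of admissible [r] being known from [sum_residue_count]. Any other
    family of frequencies is a phase dominated by its nonzero term of least order,
    to which [prime_phase_sum] applies. *)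
Lemma residue_majorized (L J : nat) (A : pred nat) (eps : R) :
  (0 < L)%N -> (0 < J)%N -> 0 < eps -> forall B : nat,
  exists (E W : nat) (C : R), (0 < E)%N /\ 0 < C /\
  forall n N N' Y : nat,
  (W <= Y)%N -> (N <= N')%N -> (N' <= 2 * N)%N -> ((Y ^ E) ^ 3 <= N)%N ->
  (N ^ J * (Y ^ E) ^ 2 <= n)%N -> (n <= (Y ^ E) ^ B)%N ->
  \sum_(N.+1 <= p < N'.+1 | prime p)
     ln p%:R * (A (truncated_legendre n J p %% L)%N)%:R <=
  (\sum_(v < L) (A v)%:R) / L%:R * (1 + eps) * \sum_(N.+1 <= p < N'.+1 | prime p) ln p%:R
  + C * (1 + ln (2 * N)%:R) ^+ 4 * N%:R / Y%:R.
Proof.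
move=> L0 J0 eps0 B.
have [eta eta0 etaJ] := expr1D_small J eps0.
have [T [freq [b [Br [c [BrE Br0 Br1 [cE /andP[c0 cL]]]]]]]] := trig_majorant L0 eta0.
have [E [W [C [E0 [C0 hps]]]]] := prime_phase_sum R J B.+1.
pose Fm : nat := \max_t `|freq t|%N.
pose rs := {ffun 'I_J -> 'I_L}.
pose ts := {ffun 'I_J -> T}.
pose good (r : rs) := A ((\sum_j r j) %% L)%N.
pose wt : R := \sum_(r : rs | good r) \sum_(t : ts) cnorm (\prod_j b (t j)).
have wt0 : 0 <= wt by apply: sumr_ge0 => r _; apply: sumr_ge0 => t _; apply: cnorm_ge0.
exists E, (W + Fm + L).+1, ((wt + 1) * C); split => //; split.
  by rewrite mulr_gt0// ltr_wpDl.
move=> n N N' Y WY NN' N'N; set X := (Y ^ E)%N => XN NJ nX.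
have FmT t : (`|freq t| <= Fm)%N by apply: leq_bigmax.
have WY' : (W <= Y)%N by apply: leq_trans WY; rewrite -addnA leqW// leq_addr.
have FY : (Fm <= Y)%N by apply: leq_trans WY; rewrite leqW// -addnA addnCA leq_addr.
have LY : (L <= Y)%N by apply: leq_trans WY; rewrite leqW// leq_addl.
have Y0 : (0 < Y)%N by apply: leq_trans WY.
have YX : (Y <= X)%N by rewrite -{1}[Y]expn1 leq_pexp2l.
have X0 : (0 < X)%N by rewrite expn_gt0 Y0.
have XX : (X ^ 2 <= N)%N by apply: leq_trans XN; rewrite leq_pexp2l.
have N0 : (0 < N)%N by apply: leq_trans XX; rewrite expn_gt0 X0.
have LR : (0 : R) < L%:R by rewrite ltr0n.
have NR : (0 : R) < N%:R by rewrite ltr0n.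
have XR : (0 : R) < X%:R by rewrite ltr0n.
have YR : (0 : R) < Y%:R by rewrite ltr0n.
have N1 : 1 <= N%:R :> R by rewrite ler1n.
have XNR : X%:R ^+ 2 <= N%:R :> R by rewrite -natrX ler_nat.
set TH := \sum_(N.+1 <= p < N'.+1 | prime p) ln p%:R.
have TH0 : 0 <= TH by apply: sumr_ge0 => p _; apply: ln_nat_ge0.
pose x (j : 'I_J) p : R := n%:R / L%:R * invpow R j.+1 p.
pose S : R := \sum_(N.+1 <= p < N'.+1 | prime p)
   ln p%:R * \sum_(r : rs | good r) \prod_j Br (x j p - (r j)%:R / L%:R).
have LS : \sum_(N.+1 <= p < N'.+1 | prime p)
     ln p%:R * (A (truncated_legendre n J p %% L)%N)%:R <= S.
  apply: ler_sum => p pp; rewrite ler_wpM2l ?ln_nat_ge0//.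
  have p0 := prime_gt0 pp.
  have Pge0 (r : rs) : 0 <= \prod_j Br (x j p - (r j)%:R / L%:R) by apply: prodr_ge0.
  have [hA|_] := boolP (A (truncated_legendre n J p %% L)%N); last by apply: sumr_ge0.
  pose r0 : rs := [ffun j : 'I_J => Ordinal (ltn_pmod (n %/ p ^ j.+1) L0)].
  have gr0 : good r0.
    rewrite /good (eq_bigr (fun j : 'I_J => (n %/ p ^ j.+1) %% L)%N); last first.
      by move=> j _; rewrite ffunE.
    by rewrite modn_summ.
  rewrite (bigD1 r0)//=; apply: ler_wpDr; first by apply: sumr_ge0.
  apply: prod_ge1 => j; rewrite ffunE /=.
  have pj0 : (0 < p ^ j.+1)%N by rewrite expn_gt0 p0.
  have [k /andP[k1 k2]] := residue_interval L0 pj0 (erefl (n %/ p ^ j.+1 %% L)%N).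
  have xE : x j p = n%:R / L%:R * invpow R 1 (p ^ j.+1).
    by rewrite /x /invpow expr1 natrX.
  by rewrite xE; apply: Br1 k1 k2.
apply: le_trans LS _.
pose a (t : ts) (j : 'I_J) : R := (freq (t j))%:~R * (n%:R / L%:R).
pose th (r : rs) (t : ts) : R := \sum_j (freq (t j))%:~R * - ((r j)%:R / L%:R).
pose St (t : ts) : R[i] := \sum_(N.+1 <= p < N'.+1 | prime p) (ln p%:R)%:C%C * cexp (phase (a t) p).
have SE : S%:C%C = \sum_(r : rs | good r) \sum_(t : ts) (\prod_j b (t j)) * cexp (th r t) * St t.
  rewrite /S rmorph_sum.
  transitivity (\sum_(N.+1 <= p < N'.+1 | prime p) \sum_(r : rs | good r) \sum_(t : ts)
      (\prod_j b (t j)) * cexp (th r t) * ((ln p%:R)%:C%C * cexp (phase (a t) p))).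
    apply: eq_bigr => p _; rewrite [LHS]rmorphM rmorph_sum [LHS]mulr_sumr; apply: eq_bigr => r _.
    rewrite [X in _ * X]rmorph_prod.
    rewrite (eq_bigr (fun j => \sum_t b t * cexp ((freq t)%:~R * (x j p - (r j)%:R / L%:R)))); last first.
      by move=> j _; rewrite BrE.
    rewrite bigA_distr_bigA [LHS]mulr_sumr; apply: eq_bigr => t _.
    rewrite big_split /= cexp_sum.
    have -> : \sum_i (freq (t i))%:~R * (x i p - (r i)%:R / L%:R) = th r t + phase (a t) p.
      rewrite /th /phase -big_split /=; apply: eq_bigr => j _.
      by rewrite /a /x; ring.
    by rewrite cexpD; ring.
  rewrite exchange_big; apply: eq_bigr => r _; rewrite exchange_big; apply: eq_bigr => t _.
  by rewrite [RHS]mulr_sumr.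
pose zero (t : ts) := [forall j, freq (t j) == 0].
pose Ng : R := \sum_(r : rs | good r) 1.
pose Err : R[i] := \sum_(r : rs | good r) \sum_(t : ts | ~~ zero t) (\prod_j b (t j)) * cexp (th r t) * St t.
have SE2 : S%:C%C = (Ng * (c ^+ J * TH))%:C%C + Err.
  rewrite SE (eq_bigr (fun r => (c ^+ J * TH)%:C%C +
     \sum_(t : ts | ~~ zero t) (\prod_j b (t j)) * cexp (th r t) * St t)); last first.
    move=> r _; rewrite (bigID zero) /=; congr (_ + _).
    rewrite (eq_bigr (fun t : ts => (\prod_j b (t j)) * TH%:C%C)); last first.
      move=> t /forallP z.
      have -> : th r t = 0 by rewrite /th big1// => j _; rewrite (eqP (z j)) mul0r.
      rewrite cexp0 mulr1; congr (_ * _); rewrite /TH rmorph_sum; apply: eq_bigr => p _.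
      rewrite (_ : phase (a t) p = 0) ?cexp0 ?mulr1//.
      by rewrite /phase big1// => j _; rewrite /a (eqP (z j)) !mul0r.
    rewrite -[LHS]mulr_suml [RHS]rmorphM; congr (_ * _).
    transitivity ((\sum_(t | freq t == 0) b t) ^+ J); last by rewrite cE -rmorphXn.
    have -> : (\sum_(t | freq t == 0) b t) ^+ J = \prod_(j < J) \sum_(t | freq t == 0) b t.
      by rewrite prodr_const card_ord.
    rewrite bigA_distr_big; apply: eq_bigl => t.
    by apply/forallP/ffun_onP => h j; exact: h.
  rewrite big_split /=; congr (_ + _).
  rewrite [RHS]rmorphM [X in _ = X * _]rmorph_sum [RHS]mulr_suml.
  by apply: eq_bigr => r _; rewrite rmorph1 mul1r.
have Errle : cnorm Err <= wt * (C * (1 + ln (2 * N)%:R) ^+ 4 * N%:R / Y%:R).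
  apply: le_trans (cnorm_sum _ _ _) _; rewrite mulr_suml; apply: ler_sum => r _.
  apply: le_trans (cnorm_sum _ _ _) _; rewrite mulr_suml big_mkcond.
  have EE0 : 0 <= C * (1 + ln (2 * N)%:R) ^+ 4 * N%:R / Y%:R.
    by rewrite divr_ge0 ?mulr_ge0 ?exprn_ge0 ?addr_ge0 ?ln_nat_ge0 ?(ltW C0).
  apply: ler_sum => t _; case: ifPn => [|_]; last by rewrite mulr_ge0 ?cnorm_ge0.
  rewrite negb_forall => /existsP[j1 j1P].
  rewrite !cnormM cnorm_cexp mulr1 ler_wpM2l ?cnorm_ge0//.
  (* The least [j] with a nonzero frequency dominates, since each further power of
     [p] divides the term by at least [N]. *)
  case: (@arg_minnP _ j1 (fun j => freq (t j) != 0) (fun j : 'I_J => j : nat) j1P) => j0 j0P j0min.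
  pose ff j : R := `|(freq (t j))%:~R|.
  have ffE j : ff j = (`|freq (t j)|%N)%:R by rewrite /ff -intr_norm pmulrn abszE.
  have ff1 : 1 <= ff j0 by rewrite ffE ler1n absz_gt0.
  have ffF j : ff j <= Fm%:R by rewrite ffE ler_nat.
  have ff0 j : 0 <= ff j by rewrite ffE.
  have aE j : `|a t j| = ff j * (n%:R / L%:R).
    by rewrite normrM [X in _ * X]ger0_norm// divr_ge0.
  have nL0 : 0 <= n%:R / L%:R :> R by rewrite divr_ge0.
  have Np k : 0 < N%:R ^+ k :> R by rewrite exprn_gt0.
  have FX : Fm%:R <= X%:R :> R by rewrite ler_nat (leq_trans FY).
  apply: (hps (a t) j0) => //.
  - rewrite ler_pdivlMr// aE.
    apply: le_trans (_ : n%:R / L%:R <= _); last by rewrite ler_peMl.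
    rewrite ler_pdivlMr//.
    apply: le_trans (_ : (N ^ J * X ^ 2)%:R <= _); last by rewrite ler_nat.
    have LX : L%:R <= X%:R :> R by rewrite ler_nat (leq_trans LY).
    have NJ' : N%:R ^+ j0.+1 <= N%:R ^+ J :> R by rewrite ler_weXn2l.
    have -> : (N ^ J * X ^ 2)%:R = X%:R * N%:R ^+ J * X%:R :> R.
      by rewrite -natrX -!natrM; congr (_%:R); rewrite -(mulnn X) mulnA [(X * N ^ J)%N]mulnC.
    by apply: ler_pM => //; [rewrite mulr_ge0// ltW | rewrite ler_wpM2l// ltW].
  - rewrite ler_pdivrMr// aE.
    apply: le_trans (_ : X%:R * X%:R ^+ B <= _).
      apply: ler_pM => //.
        exact: le_trans (ffF _) FX.
      rewrite ler_pdivrMr//; apply: le_trans (_ : X%:R ^+ B <= _).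
        by rewrite -natrX ler_nat.
      by rewrite ler_peMr ?exprn_ge0// ler1n.
    by rewrite -exprS ler_peMr ?exprn_ge0// exprn_ege1.
  move=> j jj0; have [fj|fj] := eqVneq (freq (t j)) 0.
    rewrite /a fj mul0r normr0 mul0r mulr_ge0 ?invr_ge0//.
    by rewrite divr_ge0// ltW.
  have j0j : (j0 < j)%N by rewrite ltn_neqAle eq_sym val_eqE jj0 j0min.
  rewrite !aE.
  apply: le_trans (_ : Fm%:R * (n%:R / L%:R) / (N%:R ^+ j0.+1 * N%:R) <= _).
    apply: ler_pM; [exact: mulr_ge0 | by rewrite invr_ge0 ltW | by rewrite ler_wpM2r | ].
    rewrite lef_pV2 ?posrE ?mulr_gt0//.
    by rewrite -exprSr ler_weXn2l.
  have -> : Fm%:R * (n%:R / L%:R) / (N%:R ^+ j0.+1 * N%:R) =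
    (1 * (n%:R / L%:R) / N%:R ^+ j0.+1) * (Fm%:R / N%:R) :> R.
    by field; rewrite !gt_eqF.
  apply: ler_pM.
  - by rewrite divr_ge0 ?mul1r ?(ltW (Np _)).
  - by rewrite divr_ge0// ltW.
  - by rewrite ler_wpM2r ?invr_ge0 ?(ltW (Np _))// ler_wpM2r.
  rewrite ler_pdivrMr// ler_pdivlMl//.
  by apply: le_trans XNR; rewrite expr2 ler_wpM2l// ltW.
have ReS : S <= Ng * (c ^+ J * TH) + cnorm Err.
  have -> : S = complex.Re (S%:C%C) by [].
  rewrite SE2; have -> : complex.Re ((Ng * (c ^+ J * TH))%:C%C + Err) =
    Ng * (c ^+ J * TH) + complex.Re Err by case: (Err).
  by rewrite lerD2l Re_le_cnorm.
apply: le_trans ReS _; apply: lerD.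
  rewrite mulrA ler_wpM2r//.
  (* Among the [L ^ J] families [r], the sum takes each residue equally often. *)
  have NgE : Ng = L%:R ^+ J.-1 * \sum_(v < L) (A v)%:R.
    rewrite /Ng big_mkcond /=; move: LR; clear -L0 J0; case: L L0 @rs @good => // L' _ rs good LR.
    case: J J0 @rs @good => // J' _ rs good.
    have L'0 : L'.+1%:R != 0 :> R by rewrite gt_eqF.
    rewrite /= -(sum_residue_count J' (fun v : 'I_L'.+1 => (A v)%:R : R) L'0).
    apply: eq_bigr => r _; rewrite val_sum_ord /good.
    by case: (A _).
  rewrite NgE.
  apply: le_trans (_ : L%:R ^+ J.-1 * (\sum_(v < L) (A v)%:R) * ((1 + eta) / L%:R) ^+ J <= _).
    rewrite ler_wpM2l ?mulr_ge0 ?exprn_ge0 ?sumr_ge0// lerXn2r ?nnegrE//.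
    exact: le_trans cL.
  have -> : L%:R ^+ J.-1 * (\sum_(v < L) (A v)%:R) * ((1 + eta) / L%:R) ^+ J =
     (\sum_(v < L) (A v)%:R) / L%:R * (1 + eta) ^+ J.
    rewrite expr_div_n -[in L%:R ^+ J](prednK J0) exprS; field.
    by rewrite expf_neq0 ?gt_eqF.
  by rewrite ler_wpM2l ?divr_ge0 ?sumr_ge0.
apply: le_trans Errle _.
have -> : (wt + 1) * C * (1 + ln (2 * N)%:R) ^+ 4 * N%:R / Y%:R =
   (wt + 1) * (C * (1 + ln (2 * N)%:R) ^+ 4 * N%:R / Y%:R) by rewrite !mulrA.
rewrite ler_wpM2r ?lerDl//.
by rewrite divr_ge0 ?mulr_ge0 ?exprn_ge0 ?addr_ge0 ?ln_nat_ge0 ?(ltW C0).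
Qed.

End PrimeResidues.

(** * The prime factorization of factorials *)

Section FactorialEstimates.
Variable R : realType.

Lemma logn_fact_gt (n p : nat) : prime p -> (n < p)%N -> logn p n`! = 0%N.
Proof.
move=> pp np; rewrite logn_fact// big_nat_cond big1// => k /andP[/andP[k1 _] _].
apply: divn_small; apply: leq_trans np _.
by rewrite -{1}[p]expn1 leq_exp2l// prime_gt1.
Qed.

Lemma logn_fact_trunc (n p J : nat) : prime p -> (n < p ^ J.+1)%N ->
  logn p n`! = truncated_legendre n J p.
Proof.
move=> pp np; rewrite logn_fact// /truncated_legendre.
have z k : (J < k)%N -> (n %/ p ^ k = 0)%N.
  move=> Jk; apply: divn_small; apply: leq_trans np _.
  by rewrite leq_exp2l// prime_gt1.
have -> : (\sum_(j < J) n %/ p ^ j.+1 = \sum_(1 <= k < J.+1) n %/ p ^ k)%N.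
  by rewrite big_add1 big_mkord.
have [Jn|nJ] := leqP J n.
  rewrite (@big_cat_nat _ _ _ J.+1)//= [X in (_ + X)%N]big_nat_cond [X in (_ + X)%N]big1 ?addn0//.
  by move=> k /andP[/andP[Jk _] _]; apply: z.
rewrite [RHS](@big_cat_nat _ _ _ n.+1)//=; last by rewrite ltnS ltnW.
rewrite [X in _ = (_ + X)%N]big_nat_cond [X in _ = (_ + X)%N]big1 ?addn0//.
move=> k /andP[/andP[nk _] _]; apply: divn_small; apply: leq_trans nk _.
by apply: ltnW; apply: ltn_expl; apply: prime_gt1.
Qed.

Lemma ln_fact_sum (n N : nat) : (n <= N)%N ->
  ln n`!%:R = \sum_(0 <= p < N.+1 | prime p) (logn p n`!)%:R * ln p%:R :> R.
Proof.
move=> nN; have h k : (n <= k)%N -> \sum_(0 <= p < k.+1 | prime p) (logn p n`!)%:R * ln p%:R =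
    \sum_(0 <= p < n.+1 | prime p) (logn p n`!)%:R * ln p%:R :> R.
  move=> nk; rewrite (@big_cat_nat _ _ _ n.+1)//= [X in _ + X]big_nat_cond.
  rewrite [X in _ + X]big1 ?addr0// => p /andP[/andP[np _] pp].
  by rewrite logn_fact_gt// mul0r.
rewrite h// (ln_prime_sum _ (fact_gt0 n) (leq_maxr n _)).
by apply: h; rewrite leq_maxl.
Qed.

Lemma truncated_legendre_le (n J m : nat) : (1 < m)%N ->
  (truncated_legendre n J m)%:R <= 2 * n%:R / m%:R :> R.
Proof.
move=> m1; have m2 : (2 : R) <= m%:R by rewrite ler_nat.
have m0 : (0 : R) < m%:R by lra.
rewrite natr_sum.
apply: le_trans (_ : \sum_(j < J) n%:R / m%:R * (2^-1) ^+ j <= _).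
  apply: ler_sum => j _; apply: le_trans (_ : n%:R / m%:R ^+ j.+1 <= _).
    by rewrite ler_pdivlMr ?exprn_gt0// -natrX -natrM ler_nat leq_divM.
  rewrite -mulrA ler_wpM2l// exprS invfM ler_wpM2l ?invr_ge0 ?(ltW m0)//.
  by rewrite -exprVn lerXn2r ?nnegrE ?invr_ge0 ?(ltW m0)// lef_pV2 ?posrE.
rewrite -mulr_sumr.
have -> : 2 * n%:R / m%:R = n%:R / m%:R * 2 :> R by ring.
rewrite ler_wpM2l ?divr_ge0 ?(ltW m0)//.
have -> : \sum_(j < J) 2^-1 ^+ j = 2 - 2 * 2^-1 ^+ J :> R.
  elim: J => [|J IHJ]; first by rewrite big_ord0 expr0; ring.
  by rewrite big_ord_recr /= IHJ exprS; field.
by rewrite gerBl mulr_ge0// exprn_ge0// invr_ge0.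
Qed.

Lemma logn_fact_le (n p : nat) : prime p -> (logn p n`!)%:R <= 2 * n%:R / p%:R :> R.
Proof.
move=> pp; rewrite (@logn_fact_trunc n p n pp).
  exact: truncated_legendre_le (prime_gt1 pp).
by apply: ltnW; apply: ltn_expl; apply: prime_gt1.
Qed.

Lemma central_bin_le (N : nat) : ('C(2 * N, N) <= 2 ^ (2 * N))%N.
Proof.
have -> : (2 ^ (2 * N) = \sum_(i < (2 * N).+1) 'C(2 * N, i))%N.
  rewrite (_ : 2 = 1 + 1)%N// expnDn; apply: eq_bigr => i _.
  by rewrite !exp1n !muln1.
have hN : (N < (2 * N).+1)%N by rewrite ltnS leq_pmull.
by rewrite (bigD1 (Ordinal hN))//= leq_addr.
Qed.

(** Every prime in [(N, 2 N]] divides the central binomial coefficient, which is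
    at most [2 ^ (2 N)]. *)
Lemma chebyshev_upper (N : nat) : (0 < N)%N ->
  \sum_(N.+1 <= p < (2 * N).+1 | prime p) ln p%:R <= 2 * N%:R :> R.
Proof.
move=> N0; have B0 : (0 < 'C(2 * N, N))%N by rewrite bin_gt0 leq_pmull.
apply: le_trans (_ : ln 'C(2 * N, N)%:R <= _).
  rewrite (ln_prime_sum _ B0 (leq_maxr (2 * N) _)).
  rewrite [leRHS](@big_cat_nat _ _ _ (2 * N).+1)//=; last by rewrite ltnS leq_maxl.
  rewrite [X in _ <= X + _](@big_cat_nat _ _ _ N.+1)//=; last by rewrite ltnS leq_pmull.
  have pos a b : 0 <= \sum_(a <= p < b | prime p) (logn p 'C(2 * N, N))%:R * ln p%:R :> R.
    by apply: sumr_ge0 => p _; rewrite mulr_ge0 ?ln_nat_ge0.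
  apply: ler_wpDr; first exact: pos.
  apply: ler_wpDl; first exact: pos.
  rewrite big_nat_cond [leRHS]big_nat_cond; apply: ler_sum => p /andP[/andP[Np pN] pp].
  rewrite ler_peMl ?ln_nat_ge0// ler1n logn_gt0 mem_primes pp B0 /=.
  have : (p %| 'C(2 * N, N) * (N`! * (2 * N - N)`!))%N.
    rewrite bin_fact ?leq_pmull//; apply: dvdn_fact.
    by rewrite prime_gt0.
  have pN' : ~~ (p %| N`!)%N.
    apply/negP => h; have : (0 < logn p N`!)%N by rewrite logn_gt0 mem_primes pp fact_gt0.
    by rewrite logn_fact_gt.
  rewrite mul2n -addnn addnK !Euclid_dvdM// (negPf pN') !orbF.
  by rewrite addnn -mul2n.
apply: le_trans (_ : ln (2 ^ (2 * N))%:R <= _).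
  by rewrite ler_ln ?posrE ?ltr0n ?expn_gt0// ler_nat central_bin_le.
rewrite natrX lnXn// -[leLHS]mulr_natl natrM -[leRHS]mulr1 ler_wpM2l ?mulr_ge0//.
have -> : 2 = 1 + 1 :> R by ring.
by apply: le_ln1Dx; lra.
Qed.

(** Pair [i] with [n + 1 - i] in [n! ^ 2]: each of the [n] products is at least
    [n]. *)
Lemma ln_fact_ge (n : nat) : (0 < n)%N -> n%:R * ln n%:R <= 2 * ln n`!%:R :> R.
Proof.
move=> n0; have h : (n ^ n <= n`! ^ 2)%N.
  have E : (n`! ^ 2 = \prod_(1 <= i < n.+1) (i * (n.+1 - i)))%N.
    rewrite big_split /= -fact_prod -mulnn; congr (_ * _)%N; rewrite fact_prod.
    rewrite big_nat_rev /=; apply: eq_big_nat => i /andP[i1 iN].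
    by rewrite add1n subSS.
  rewrite E -[X in (n ^ X <= _)%N](subn1 n.+1) -prod_nat_const_nat.
  rewrite big_nat_cond [X in (_ <= X)%N]big_nat_cond.
  elim/big_ind2: _ => // [a b c d ab cd|i /andP[/andP[i1 iN] _]]; first exact: leq_mul.
  (* [i * (k + 1) >= i + k] as [i >= 1]. *)
  have [k ->] : exists k, n = (i + k)%N by exists (n - i)%N; rewrite subnKC.
  rewrite -addnS addKn; clear -i1; nia.
rewrite mulr_natl -lnXn ?ltr0n// -natrX mulr_natl -lnXn ?ltr0n ?fact_gt0// -natrX.
by rewrite ler_ln ?posrE ?ltr0n ?ler_nat ?expn_gt0 ?n0 ?fact_gt0.
Qed.

(** Summation by parts against nonnegative decreasing weights. *)
Lemma abel_decreasing (w x : nat -> R) (a b : nat) (E : R) :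
  (forall k, (a <= k < b)%N -> 0 <= w k) ->
  (forall j k, (a <= j)%N -> (j <= k < b)%N -> w k <= w j) ->
  (forall j, (a < j <= b)%N -> \sum_(a <= k < j) x k <= E) ->
  (a < b)%N -> \sum_(a <= k < b) w k * x k <= w a * E.
Proof.
move=> w0 wdec hE ab.
have [n bE] : exists n, b = (a + n.+1)%N by exists (b - a).-1; lia.
rewrite {}bE {ab} in w0 wdec hE *; elim: n w w0 wdec hE => [|n IHn] w w0 wdec hE.
  have := hE (a + 1)%N; rewrite addn1 !big_nat1 ltnSn => /(_ isT).
  by apply: ler_wpM2l; apply: w0; clear; lia.
pose c := w (a + n.+1)%N.
have cw : (a <= a + n.+1 < a + n.+2)%N by rewrite leq_addr !addnS ltnSn.
have -> : \sum_(a <= k < a + n.+2) w k * x k =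
   c * (\sum_(a <= k < a + n.+2) x k) + \sum_(a <= k < a + n.+1) (w k - c) * x k.
  have -> : \sum_(a <= k < a + n.+1) (w k - c) * x k = \sum_(a <= k < a + n.+2) (w k - c) * x k.
    by rewrite [in RHS](addnS a n.+1) [RHS]big_nat_recr ?leq_addr//= subrr mul0r addr0.
  by rewrite mulr_sumr -big_split /=; apply: eq_bigr => k _; ring.
have -> : w a * E = c * E + (w a - c) * E by ring.
apply: lerD.
  apply: ler_wpM2l; first exact: w0.
  by apply: hE; rewrite leqnn andbT addnS ltnS leq_addr.
apply: (IHn (fun k => w k - c)).
- move=> k /andP[ak kn]; rewrite subr_ge0; apply: wdec => //.
  by rewrite ltnW//= !addnS ltnSn.
- move=> j k aj /andP[jk kn]; rewrite lerD2r; apply: wdec => //.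
  by rewrite jk (ltn_trans kn)// !addnS ltnSn.
- by move=> j /andP[aj jn]; apply: hE; rewrite aj (leq_trans jn)// !addnS leqnSn.
Qed.

End FactorialEstimates.

(** * Uniformity and counting *)

Section LegendreResidues.
Variable R : realType.

(** Blocks of all sizes must be treated with the same scale. Since [Y] is
    arbitrary in [residue_majorized], its scale [Y ^ E] may be replaced by a power
    of itself, so the product of the exponents serves for all [J <= Jm]. *)
Lemma residue_majorized_uniform (L Jm : nat) (A : pred nat) (eps : R) (B : nat) :
  (0 < L)%N -> 0 < eps ->
  exists (E W : nat) (C : R), (0 < E)%N /\ 0 < C /\
  forall J n N N' Y : nat, (0 < J <= Jm)%N ->
  (W <= Y)%N -> (N <= N')%N -> (N' <= 2 * N)%N -> ((Y ^ E) ^ 3 <= N)%N ->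
  (N ^ J * (Y ^ E) ^ 2 <= n)%N -> (n <= (Y ^ E) ^ B)%N ->
  \sum_(N.+1 <= p < N'.+1 | prime p)
     ln p%:R * (A (truncated_legendre n J p %% L)%N)%:R <=
  (\sum_(v < L) (A v)%:R) / L%:R * (1 + eps) * \sum_(N.+1 <= p < N'.+1 | prime p) ln p%:R
  + C * (1 + ln (2 * N)%:R) ^+ 4 * N%:R / Y%:R.
Proof.
move=> L0 eps0; elim: Jm => [|Jm [E1 [W1 [C1 [E10 [C10 h1]]]]]].
  by exists 1%N, 0%N, 1; split => //; split => // J n N N' Y; case: J.
have [E2 [W2 [C2 [E20 [C20 h2]]]]] := residue_majorized A L0 (ltn0Sn Jm) eps0 B.
exists (E1 * E2)%N, (W1 + W2).+1, (C1 + C2); split; first by rewrite muln_gt0 E10.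
split; first by rewrite addr_gt0.
move=> J n N N' Y /andP[J0 JJ] WY NN' N'N XN NJ nX.
have Y0 : (0 < Y)%N by apply: leq_trans WY.
have e0 : 0 <= (1 + ln (2 * N)%:R) ^+ 4 * N%:R :> R.
  by rewrite mulr_ge0 ?exprn_ge0 ?addr_ge0 ?ln_nat_ge0.
have small k : (0 < k)%N -> (Y <= Y ^ k)%N.
  by move=> k0; rewrite -{1}[Y]expn1 leq_pexp2l.
have errle (C : R) k : 0 < C -> C <= C1 + C2 -> (0 < k)%N ->
   C * (1 + ln (2 * N)%:R) ^+ 4 * N%:R / (Y ^ k)%:R <=
     (C1 + C2) * (1 + ln (2 * N)%:R) ^+ 4 * N%:R / Y%:R.
  move=> C0 CC k0.
  have ee x y : x * (1 + ln (2 * N)%:R) ^+ 4 * N%:R / y = x * ((1 + ln (2 * N)%:R) ^+ 4 * N%:R) / y :> R.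
    by rewrite mulrA.
  rewrite !ee; apply: ler_pM; [by rewrite mulr_ge0 ?(ltW C0) | by rewrite invr_ge0 | by rewrite ler_wpM2r | ].
  by rewrite lef_pV2 ?posrE ?ltr0n ?expn_gt0 ?Y0// ler_nat small.
move: JJ; rewrite leq_eqVlt => /predU1P[JE|]; last rewrite ltnS => JJ.
- rewrite {}JE in NJ *; rewrite expnM in XN NJ nX.
  have WY2 : (W2 <= Y ^ E1)%N.
    by apply: leq_trans (small _ E10); apply: leq_trans WY; rewrite leqW// leq_addl.
  apply: le_trans (h2 n N N' _ WY2 NN' N'N XN NJ nX) _.
  by rewrite lerD2l errle// lerDr ltW.
rewrite (mulnC E1) expnM in XN NJ nX.
have WY1 : (W1 <= Y ^ E2)%N.
  by apply: leq_trans (small _ E20); apply: leq_trans WY; rewrite leqW// leq_addr.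
have JJ' : (0 < J <= Jm)%N by rewrite J0.
apply: le_trans (h1 J n N N' _ JJ' WY1 NN' N'N XN NJ nX) _.
by rewrite lerD2l errle// lerDl ltW.
Qed.

Lemma ln_power_growth (K : R) : exists Y0 : nat, forall Y : nat, (Y0 <= Y)%N ->
  K * (1 + ln Y%:R) ^+ 5 <= Y%:R.
Proof.
(* Compare with the term of degree 6 of the exponential of [t = ln Y]; [720] is
   [6!] and [32] bounds the loss in [(1 + t) ^ 5 <= (2 t) ^ 5]. *)
pose t0 : R := 32 * 720 * `|K| + 1.
exists (Num.truncn (expR t0)).+1 => Y hY.
have Y0 : (0 : R) < Y%:R by rewrite ltr0n; apply: leq_trans hY.
have t0Y : t0 <= ln Y%:R.
  rewrite -[t0]expRK ler_ln ?posrE ?expR_gt0//; apply: le_trans (ltW (truncnS_gt _)) _.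
  by rewrite ler_nat.
set t := ln Y%:R in t0Y *.
have t1 : 1 <= t by apply: le_trans t0Y; rewrite lerDr !mulr_ge0.
have t00 : 0 <= t by lra.
have h : 1 + t ^+ 6 / 6`!%:R <= Y%:R.
  by rewrite -[Y%:R]lnK ?posrE//; apply: expR_ge1Dxn.
apply: le_trans (_ : t ^+ 6 / 6`!%:R <= _); last by apply: le_trans h; rewrite lerDr.
apply: le_trans (_ : `|K| * (2 * t) ^+ 5 <= _).
  apply: le_trans (_ : `|K| * (1 + t) ^+ 5 <= _).
    by rewrite ler_wpM2r ?ler_norm// exprn_ge0// addr_ge0.
  by rewrite ler_wpM2l// lerXn2r ?nnegrE ?addr_ge0 ?mulr_ge0//; lra.
rewrite ler_pdivlMr ?ltr0n ?fact_gt0// exprMn.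
have -> : 6`!%:R = 720 :> R by [].
have -> : `|K| * (2 ^+ 5 * t ^+ 5) * 720 = 32 * 720 * `|K| * t ^+ 5 by ring.
rewrite [t ^+ 6]exprS ler_wpM2r ?exprn_ge0//; apply: le_trans t0Y.
by rewrite lerDl.
Qed.

Lemma window_count (P : pred nat) (I s : nat) :
  (forall i j, P i -> P j -> (j < i + s)%N) -> (\sum_(i < I) P i <= s)%N.
Proof.
move=> hP; have [/existsP [i0 Pi0]|] := boolP [exists i : 'I_I, P i]; last first.
  by rewrite negb_exists => /forallP h; rewrite big1// => i _; rewrite (negPf (h i)).
have exP : exists i, P i by exists i0.
case: (ex_minnP exP) => m Pm mmin.
apply: leq_trans (_ : \sum_(0 <= i < I | m <= i < m + s) 1 <= _)%N.
  rewrite big_mkord [leqRHS]big_mkcond /=; apply: leq_sum => i _.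
  case Pi: (P i) => //.
  by rewrite (mmin _ Pi) (hP _ _ Pm Pi).
rewrite (sum_nat_cap 0 I m (m + s) (fun=> 1%N)) sum_nat_const_nat muln1.
rewrite leq_subLR max0n; apply: leq_trans (geq_minr _ _) _.
by rewrite leq_add2r.
Qed.

End LegendreResidues.

(** * Good and bad dyadic blocks *)

Section LegendreEquidistribution.
Variable R : realType.

(** The weight [v_p(n!)] decreases with [p] and is at most [2 n / N] in the block,
    so the bound for the partial sums passes to the weighted sum by summation by
    parts. The hypothesis bounds the partial sums of the indicator minus [kap]. *)
Lemma good_block (L : nat) (A : pred nat) (n N J : nat) (kap e : R) :
  (1 < N)%N -> 0 <= e -> (n <= N ^ J.+1)%N ->
  (forall N', (N <= N')%N -> (N' <= 2 * N)%N ->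
     \sum_(N.+1 <= p < N'.+1 | prime p)
       ln p%:R * (A (truncated_legendre n J p %% L)%N)%:R <=
     kap * \sum_(N.+1 <= p < N'.+1 | prime p) ln p%:R + e) ->
  \sum_(N.+1 <= p < (2 * N).+1 | prime p)
     (logn p n`!)%:R * ln p%:R * ((A (logn p n`! %% L)%N)%:R - kap) <= 2 * n%:R / N%:R * e.
Proof.
move=> N1 e0 nN hE; have N0 : (0 < N)%N by apply: ltnW.
pose w k : R := (truncated_legendre n J k)%:R.
pose x k : R := if prime k then ln k%:R * ((A (truncated_legendre n J k %% L)%N)%:R - kap) else 0.
have -> : \sum_(N.+1 <= p < (2 * N).+1 | prime p)
     (logn p n`!)%:R * ln p%:R * ((A (logn p n`! %% L)%N)%:R - kap) =
   \sum_(N.+1 <= k < (2 * N).+1) w k * x k.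
  rewrite [LHS]big_mkcond; apply: eq_big_nat => p /andP[Np _].
  rewrite /w /x; case: ifP => pp; last by rewrite mulr0.
  rewrite (@logn_fact_trunc n p J pp) ?mulrA//.
  by apply: leq_ltn_trans nN _; rewrite ltn_exp2r.
apply: le_trans (_ : w N.+1 * e <= _).
  apply: abel_decreasing.
  - by move=> k _; rewrite /w.
  - move=> j k Nj /andP[jk _]; rewrite ler_nat; apply: leq_sum => i _.
    have j0 : (0 < j)%N by apply: leq_trans Nj.
    by apply: leq_div2l; rewrite ?expn_gt0 ?j0// leq_exp2r.
  - case=> // j /andP[Nj jN]; rewrite !ltnS in Nj jN.
    rewrite -big_mkcond /=.
    have -> : \sum_(N.+1 <= i < j.+1 | prime i)
        ln i%:R * ((A (truncated_legendre n J i %% L)%N)%:R - kap) =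
      \sum_(N.+1 <= p < j.+1 | prime p) ln p%:R * (A (truncated_legendre n J p %% L)%N)%:R
      - kap * \sum_(N.+1 <= p < j.+1 | prime p) ln p%:R.
      by rewrite mulr_sumr -sumrB; apply: eq_bigr => p _; ring.
    by rewrite lerBlDl; apply: hE => //; apply: ltnW.
  by rewrite ltnS mul2n -addnn -{1}[N]addn0 ltn_add2l.
rewrite ler_wpM2r//; apply: le_trans (truncated_legendre_le R n J _) _; first exact: ltnW.
rewrite ler_wpM2l ?mulr_ge0// lef_pV2 ?posrE ?ltr0n//.
by rewrite ler_nat.
Qed.

(** Here [v_p(n!) <= 2 n / N], and the block contains at most [O(N)] of [ln p]. *)
Lemma any_block (L : nat) (A : pred nat) (n N : nat) (kap : R) : (0 < N)%N -> 0 <= kap ->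
  \sum_(N.+1 <= p < (2 * N).+1 | prime p)
     (logn p n`!)%:R * ln p%:R * ((A (logn p n`! %% L)%N)%:R - kap) <= 4 * n%:R.
Proof.
move=> N0 kap0; have NR : (0 : R) < N%:R by rewrite ltr0n.
apply: le_trans (_ : 2 * n%:R / N%:R * \sum_(N.+1 <= p < (2 * N).+1 | prime p) ln p%:R <= _).
  rewrite mulr_sumr big_nat_cond [leRHS]big_nat_cond.
  apply: ler_sum => p /andP[/andP[Np _] pp].
  have a1 : (A (logn p n`! %% L)%N)%:R - kap <= 1.
    by rewrite lerBlDr (le_trans (_ : _ <= 1)) ?lerDl// lern1; case: (A _).
  apply: le_trans (_ : (logn p n`!)%:R * ln p%:R * 1 <= _).
    by rewrite ler_wpM2l// mulr_ge0 ?ln_nat_ge0.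
  rewrite mulr1 ler_wpM2r ?ln_nat_ge0//; apply: le_trans (logn_fact_le R n pp) _.
  rewrite ler_wpM2l ?mulr_ge0// lef_pV2 ?posrE ?ltr0n ?(prime_gt0 pp)//.
  by rewrite ler_nat ltnW.
apply: le_trans (_ : 2 * n%:R / N%:R * (2 * N%:R) <= _).
  by apply: ler_wpM2l; [rewrite divr_ge0 ?mulr_ge0 | exact: chebyshev_upper].
rewrite le_eqVlt; apply/orP; left; apply/eqP; field.
by rewrite gt_eqF.
Qed.

(** The block above [2 ^ i] is good when [n] lies between two consecutive powers
    of [2 ^ i], and above the lower one by a factor [X ^ 2] at least. A bad index
    is either such that [2 ^ i < X ^ a], or in one of the windows of length
    [O(ln X)] that correspond to [n] just above [(2 ^ i) ^ J]. *)
Definition good_index (X a Jm n i : nat) : bool :=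
  (X ^ a <= 2 ^ i)%N &&
  [exists J : 'I_Jm, ((2 ^ i) ^ J.+1 * X ^ 2 <= n)%N && (n <= (2 ^ i) ^ J.+2)%N].

Lemma bad_index_count (X a n : nat) :
  (1 < X)%N -> (0 < a)%N -> (n < X ^ (2 * a ^ 2))%N -> (0 < n)%N ->
  (\sum_(i < (trunc_log 2 n).+1) ~~ good_index X a (2 * a) n i <=
     (trunc_log 2 (X ^ a)).+1 + 2 * a * (trunc_log 2 (X ^ 2)).+1)%N.
Proof.
move=> X1 a0 nX n0.
have X0 : (0 < X)%N by apply: ltnW.
pose P1 i := (2 ^ i < X ^ a)%N.
pose P2 J i := ((2 ^ i) ^ J <= n)%N && (n < (2 ^ i) ^ J * X ^ 2)%N.
apply: leq_trans (_ : \sum_(i < (trunc_log 2 n).+1) (P1 i + \sum_(J < 2 * a) P2 J.+1 i) <= _)%N.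
  apply: leq_sum => i _; rewrite /good_index negb_and -ltnNge -/(P1 i).
  case: (boolP (P1 i)) => //= nP1; rewrite add0n.
  case: existsP => //= nex; rewrite -leqNgt in nP1.
  have i2 : (2 ^ i <= n)%N.
    apply: leq_trans (trunc_logP (isT : 1 < 2)%N n0).
    by rewrite leq_exp2l// -ltnS.
  have q1 : (1 < 2 ^ i)%N.
    have XX : (X ^ 1 <= X ^ a)%N by rewrite leq_exp2l.
    exact: leq_trans X1 (leq_trans XX nP1).
  pose J := trunc_log (2 ^ i) n.
  have /andP[J1 J2] := trunc_log_bounds q1 n0; rewrite -/J in J1 J2.
  have J0 : (0 < J)%N by rewrite lt0n; apply/eqP => z; move: J2; rewrite z expn1 ltnNge i2.
  (* As [2 ^ i >= X ^ a] and [n < X ^ (2 a ^ 2)], the exponent [J] is at most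
     [2 a]. *)
  have Ja : (J.-1 < 2 * a)%N.
    have h : (X ^ (a * J) < X ^ (2 * a ^ 2))%N.
      apply: leq_ltn_trans nX; apply: leq_trans J1.
      by rewrite expnM leq_exp2r.
    rewrite prednK//; move: h; rewrite ltn_exp2l// -mulnn mulnCA ltn_pmul2l// => h.
    exact: ltnW.
  rewrite (bigD1 (Ordinal Ja))//= prednK// /P2 J1 /=.
  case: (ltnP n ((2 ^ i) ^ J * X ^ 2)) => // h; case: nex; exists (Ordinal Ja); rewrite /= prednK// h.
  exact: ltnW.
rewrite big_split /= leq_add//.
  apply: window_count => i j _; rewrite /P1 => h.
  by rewrite addnC ltn_addr// ltnS trunc_log_max// ltnW.
rewrite exchange_big /=.
have -> : (2 * a * (trunc_log 2 (X ^ 2)).+1 = \sum_(J < 2 * a) (trunc_log 2 (X ^ 2)).+1)%N.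
  by rewrite sum_nat_const card_ord.
apply: leq_sum => J _; apply: window_count => i j /andP[_ h1] /andP[h2 _].
set s := (trunc_log 2 (X ^ 2)).+1.
have Xs : (X ^ 2 < 2 ^ s)%N by apply: trunc_log_ltn.
have h : (2 ^ (j * J.+1) < 2 ^ (i * J.+1 + s))%N.
  rewrite expnD !expnM; apply: leq_ltn_trans h2 _; apply: ltn_trans h1 _.
  by rewrite ltn_pmul2l// !expn_gt0.
rewrite ltn_exp2l// in h; rewrite ltnNge; apply/negP => ji.
have : ((i + s) * J.+1 <= j * J.+1)%N by rewrite leq_mul2r ji orbT.
rewrite leqNgt => /negP; apply; apply: leq_trans h _.
by rewrite mulnDl leq_add2l leq_pmulr.
Qed.

Lemma trunc_log2_le (m : nat) : (0 < m)%N -> (trunc_log 2 m)%:R <= 2 * ln m%:R :> R.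
Proof.
move=> m0; have t : (trunc_log 2 m)%:R * ln 2 <= ln m%:R :> R.
  rewrite mulr_natl -lnXn// -natrX ler_ln ?posrE ?ltr0n ?expn_gt0//.
  by rewrite ler_nat trunc_logP.
have t' := le_trans (ler_wpM2l (ler0n R (trunc_log 2 m)) (ln2_ge_half R)) t.
by move: t'; move: (ln m%:R : R) ((trunc_log 2 m)%:R : R) => u v; clear; lra.
Qed.

End LegendreEquidistribution.

(** * Equidistribution of the exponents of a factorial *)

Section LegendreEquidistributionMain.
Variable R : realType.

(** The blocks are shifted by one, so that they are [(2 ^ i, 2 ^ i.+1]]; primes
    above [n] have weight zero, which allows the last block to overshoot. *)
Lemma dyadic_excess (g : nat -> R) (kap : R) (n : nat) : (0 < n)%N ->
  \sum_(0 <= p < n.+1 | prime p) (logn p n`!)%:R * ln p%:R * g p =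
  kap * ln n`!%:R + \sum_(i < (trunc_log 2 n).+1)
    \sum_((2 ^ i).+1 <= p < (2 * 2 ^ i).+1 | prime p)
      (logn p n`!)%:R * ln p%:R * (g p - kap).
Proof.
move=> n0; set I := (trunc_log 2 n).+1.
have nI : (n < 2 ^ I)%N by apply: trunc_log_ltn.
have -> : \sum_(0 <= p < n.+1 | prime p) (logn p n`!)%:R * ln p%:R * g p =
  \sum_(0 <= p < (2 ^ I).+1 | prime p) (logn p n`!)%:R * ln p%:R * g p.
  rewrite [RHS](@big_cat_nat _ _ _ n.+1)//=; last exact: ltnW.
  rewrite [X in _ + X]big_nat_cond [X in _ + X]big1 ?addr0// => p /andP[/andP[np _] pp].
  by rewrite logn_fact_gt// !mul0r.
rewrite (@ln_fact_sum R n (2 ^ I) (ltnW nI)) mulr_sumr.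
pose w p : R := if prime p then (logn p n`!)%:R * ln p%:R * (g p - kap) else 0.
have -> : \sum_(i < I) \sum_((2 ^ i).+1 <= p < (2 * 2 ^ i).+1 | prime p)
      (logn p n`!)%:R * ln p%:R * (g p - kap) = \sum_(0 <= p < (2 ^ I).+1) w p.
  transitivity (\sum_(1 <= k < 2 ^ I) w k.+1).
    rewrite sum_dyadic; apply: eq_bigr => i _.
    by rewrite big_add1 /= big_mkcond.
  have I1 : (1 <= 2 ^ I)%N by rewrite expn_gt0.
  by rewrite [RHS]big_ltn// [in RHS]big_ltn// [in RHS]big_add1 /= /w /= !add0r.
rewrite -big_mkcond -big_split /=; apply: eq_bigr => p _; ring.
Qed.

Lemma good_index_block (L : nat) (A : pred nat) (kap C : R) (X a n i Y B : nat) :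
  (1 < X)%N -> (3 <= a)%N -> (0 < Y)%N -> 0 <= C -> (n <= X ^ B)%N ->
  (forall J N N', (0 < J <= 2 * a)%N ->
    (N <= N')%N -> (N' <= 2 * N)%N -> (X ^ 3 <= N)%N ->
    (N ^ J * X ^ 2 <= n)%N -> (n <= X ^ B)%N ->
    \sum_(N.+1 <= p < N'.+1 | prime p)
       ln p%:R * (A (truncated_legendre n J p %% L)%N)%:R <=
    kap * \sum_(N.+1 <= p < N'.+1 | prime p) ln p%:R
    + C * (1 + ln (2 * N)%:R) ^+ 4 * N%:R / Y%:R) ->
  good_index X a (2 * a) n i -> (2 ^ i <= n)%N ->
  \sum_((2 ^ i).+1 <= p < (2 * 2 ^ i).+1 | prime p)
     (logn p n`!)%:R * ln p%:R * ((A (logn p n`! %% L)%N)%:R - kap) <=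
  2 * n%:R * C * (2 + ln n%:R) ^+ 4 / Y%:R.
Proof.
move=> X1 a3 Y0 C0 nB hE /andP[Xa /existsP[J /andP[hJ1 hJ2]]] iN.
set N := (2 ^ i)%N in Xa hJ1 hJ2 iN *.
have YR : (0 : R) < Y%:R by rewrite ltr0n.
have N1 : (1 < N)%N.
  by apply: leq_trans Xa; rewrite -(exp1n a) ltn_exp2r// (leq_trans _ a3).
have N0 : (0 < N)%N by apply: ltnW.
have NR : (0 : R) < N%:R by rewrite ltr0n.
have n0 : (0 < n)%N by apply: leq_trans iN.
have X3 : (X ^ 3 <= N)%N by apply: leq_trans Xa; rewrite leq_exp2l.
have l0 : 0 <= ln (2 * N)%:R :> R by apply: ln_nat_ge0.
apply: le_trans (@good_block R L A n N J.+1 kap (C * (1 + ln (2 * N)%:R) ^+ 4 * N%:R / Y%:R) _ _ _ _) _ => //.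
- by rewrite divr_ge0 ?mulr_ge0 ?exprn_ge0// addr_ge0.
- by move=> N' h1 h2; apply: hE => //=; apply: ltn_ord.
have lN : 1 + ln (2 * N)%:R <= 2 + ln n%:R :> R.
  rewrite natrM lnM ?posrE ?ltr0n//.
  have : ln 2 <= 1 :> R by have := @le_ln1Dx R 1; rewrite -[1+1]/2%:R; apply; lra.
  have : ln N%:R <= ln n%:R :> R by rewrite ler_ln ?posrE ?ltr0n// ler_nat.
  by move: (ln N%:R : R) (ln n%:R : R) (ln 2 : R) => u v w; clear; lra.
have l4 : (1 + ln (2 * N)%:R) ^+ 4 <= (2 + ln n%:R) ^+ 4 :> R.
  by rewrite lerXn2r ?nnegrE// ?addr_ge0// ln_nat_ge0.
have -> : 2 * n%:R / N%:R * (C * (1 + ln (2 * N)%:R) ^+ 4 * N%:R / Y%:R) =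
   2 * n%:R * C * (1 + ln (2 * N)%:R) ^+ 4 / Y%:R.
  by field; rewrite !gt_eqF.
by rewrite ler_pM2r ?invr_gt0// ler_wpM2l// !mulr_ge0.
Qed.

(** The largest [Y] with [Y ^ Z <= n]. *)
Lemma scale_exists (Z W n : nat) : (0 < Z)%N -> (2 <= W)%N -> (W ^ Z <= n)%N ->
  exists Y : nat, [/\ (W <= Y)%N, (Y ^ Z <= n)%N, (n < (Y ^ 2) ^ Z)%N &
    2 + ln n%:R <= (2 + Z%:R) * (1 + ln Y%:R) :> R].
Proof.
move=> Z0 W2 Wn.
have ex : exists Y, (W <= Y)%N && (Y ^ Z <= n)%N by exists W; rewrite leqnn.
have ub Y : (W <= Y)%N && (Y ^ Z <= n)%N -> (Y <= n)%N.
  by case/andP=> _; apply: leq_trans; rewrite -{1}[Y]expn1; case: Y => // Y; rewrite leq_pexp2l.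
case: (ex_maxnP ex ub) => Y /andP[WY Yn] Ymax.
have Y2 : (2 <= Y)%N by apply: leq_trans WY.
have nY : (n < Y.+1 ^ Z)%N.
  rewrite ltnNge; apply/negP => h; have := Ymax Y.+1; rewrite h (leqW WY) => /(_ isT).
  by rewrite ltnn.
have YY : (Y.+1 <= Y ^ 2)%N by rewrite expnS expn1; clear -Y2; nia.
have n0 : (0 < n)%N by apply: leq_trans Yn; rewrite expn_gt0 (ltnW Y2).
exists Y; split => //; first by apply: leq_trans nY _; rewrite leq_exp2r.
have Y0 : (0 < Y)%N by apply: ltnW.
have h1 : ln n%:R <= Z%:R * ln Y.+1%:R :> R.
  rewrite [leRHS]mulr_natl -lnXn ?ltr0n// -natrX ler_ln ?posrE ?ltr0n ?expn_gt0//.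
  by rewrite ler_nat ltnW.
have h2 : ln Y.+1%:R <= 1 + ln Y%:R :> R.
  apply: le_trans (_ : ln (2 * Y%:R) <= _).
    rewrite ler_ln ?posrE ?mulr_gt0 ?ltr0n// -natrM ler_nat.
    by clear -Y2; nia.
  rewrite lnM ?posrE ?ltr0n// lerD2r.
  by have := @le_ln1Dx R 1; rewrite -[1 + 1]/2%:R; apply; lra.
have h3 : 0 <= ln Y%:R :> R by apply: ln_nat_ge0.
have h4 : (0 : R) <= Z%:R by [].
have h5 := ler_wpM2l h4 h2.
move: (ln n%:R : R) (ln Y.+1%:R : R) (ln Y%:R : R) (Z%:R : R) h1 h3 h4 h5 => a b c z h1 h3 h4 h5.
have := mulr_ge0 h4 h3; clear -h1 h3 h4 h5; nra.
Qed.

Lemma bad_index_count_ln (X a n : nat) :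
  (1 < X)%N -> (0 < a)%N -> (X ^ (a ^ 2) <= n)%N -> (n < X ^ (2 * a ^ 2))%N ->
  (\sum_(i < (trunc_log 2 n).+1) ~~ good_index X a (2 * a) n i)%:R <=
  10 / a%:R * ln n%:R + 2 * a%:R + 1 :> R.
Proof.
move=> X1 a0 Xn nX; have X0 : (0 < X)%N by apply: ltnW.
have n0 : (0 < n)%N by apply: leq_trans Xn; rewrite expn_gt0 X0.
apply: le_trans (_ : ((trunc_log 2 (X ^ a)).+1 + 2 * a * (trunc_log 2 (X ^ 2)).+1)%:R <= _).
  by rewrite ler_nat; apply: bad_index_count.
have aR : (0 : R) < a%:R by rewrite ltr0n.
have t1 : (trunc_log 2 (X ^ a))%:R <= 2 * (a%:R * ln X%:R) :> R.
  apply: le_trans (trunc_log2_le R _) _; first by rewrite expn_gt0 X0.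
  by rewrite natrX lnXn ?ltr0n// -[_ *+ a]mulr_natl.
have t2 : (trunc_log 2 (X ^ 2))%:R <= 2 * (2 * ln X%:R) :> R.
  apply: le_trans (trunc_log2_le R _) _; first by rewrite expn_gt0 X0.
  by rewrite natrX lnXn ?ltr0n// -[ln _ *+ 2]mulr_natl.
have t3 : a%:R ^+ 2 * ln X%:R <= ln n%:R :> R.
  rewrite -[a%:R ^+ 2]natrX [leLHS]mulr_natl -lnXn ?ltr0n// -natrX.
  by rewrite ler_ln ?posrE ?ltr0n ?expn_gt0 ?X0// ler_nat.
have t4 : a%:R * ln X%:R <= ln n%:R / a%:R :> R.
  by rewrite ler_pdivlMr// mulrAC -expr2.
rewrite natrD -natr1 natrM -[(trunc_log 2 (X ^ 2)).+1%:R]natr1 [(2 * a)%:R]natrM.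
have t5 := ler_wpM2l (ltW aR) t2.
have -> : 10 / a%:R * ln n%:R = 10 * (ln n%:R / a%:R) :> R by rewrite -mulrA [_^-1 * _]mulrC.
move: (ln n%:R / a%:R) t1 t4 t5 => q; move: (ln X%:R : R) => x.
move: ((trunc_log 2 (X ^ a))%:R : R) ((trunc_log 2 (X ^ 2))%:R : R) (a%:R : R) => u v b.
by clear; lra.
Qed.

(** Decompose into dyadic blocks. With the scale [X = Y ^ E], roughly between
    [n ^ (1 / (2 a ^ 2))] and [n ^ (1 / a ^ 2)], the proportion of bad blocks is
    [O(1 / a)], and each of them costs [O(n)]; the good blocks together cost at
    most [n], because [Y] beats the logarithms. Finally [n ln n = O(ln n!)]. *)
Theorem legendre_residues (L : nat) (A : pred nat) (eps : R) : (0 < L)%N -> 0 < eps ->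
  exists n0 : nat, forall n, (n0 <= n)%N ->
  \sum_(0 <= p < n.+1 | prime p)
     (logn p n`!)%:R * ln p%:R * (A (logn p n`! %% L)%N)%:R <=
  ((\sum_(v < L) (A v)%:R) / L%:R + eps) * ln n`!%:R.
Proof.
move=> L0 e0; set cA := (\sum_(v < L) (A v)%:R) / L%:R.
have LR : (0 : R) < L%:R by rewrite ltr0n.
have cA0 : 0 <= cA by rewrite divr_ge0// sumr_ge0.
have cA1 : cA <= 1.
  rewrite ler_pdivrMr// mul1r; apply: le_trans (_ : \sum_(v < L) 1 <= _); last first.
    by rewrite sumr_const card_ord.
  by apply: ler_sum => v _; rewrite lern1; case: (A v).
pose kap := cA * (1 + eps / 2).
have kap0 : 0 <= kap by rewrite mulr_ge0// addr_ge0// divr_ge0// ltW.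
have kap1 : kap <= cA + eps / 2.
  by rewrite /kap mulrDr mulr1 lerD2l -[leRHS]mul1r ler_wpM2r// divr_ge0// ltW.
(* [a >= 3] gives [X ^ 3 <= X ^ a], and [320 / eps] makes the bad blocks cost less
   than [eps / 2]. *)
pose a := maxn 3 (Num.truncn (320 / eps)).+1.
have a3 : (3 <= a)%N by rewrite leq_maxl.
have a0 : (0 < a)%N by apply: leq_trans a3.
have ae : 320 / eps <= a%:R.
  apply: ltW; apply: lt_le_trans (truncnS_gt _) _.
  by rewrite ler_nat leq_maxr.
have [E [W [C [E0 [C0 hE]]]]] :=
  @residue_majorized_uniform R L (2 * a) A (eps / 2) (2 * a ^ 2) L0 (divr_gt0 e0 (ltr0Sn _ 1)).
pose Z := (E * a ^ 2)%N.
have Z0 : (0 < Z)%N by rewrite muln_gt0 E0 expn_gt0 a0.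
have [Yg hYg] := ln_power_growth (4 * C * (2 + Z%:R) ^+ 5).
pose W' := maxn 2 (maxn W Yg).
pose n1 := (Num.truncn (expR (8 * (8 * a%:R + 5) / eps))).+1.
exists (maxn (W' ^ Z) n1) => n; rewrite geq_max => /andP[nW nn1].
have [Y [WY Yn nY lnY]] := scale_exists Z0 (leq_maxl _ _ : 2 <= W')%N nW.
move: WY; rewrite !geq_max => /and3P[Y2 WY YgY].
have Y0 : (0 < Y)%N by apply: ltnW.
have YR : (0 : R) < Y%:R by rewrite ltr0n.
have n0 : (0 < n)%N by apply: leq_trans Yn; rewrite expn_gt0 Y0.
have nR : (0 : R) < n%:R by rewrite ltr0n.
pose X := (Y ^ E)%N.
have X1 : (1 < X)%N.
  have h : (Y ^ 1 <= Y ^ E)%N by rewrite leq_exp2l.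
  exact: leq_trans Y2 h.
have Xn : (X ^ (a ^ 2) <= n)%N by rewrite -expnM.
have nX : (n < X ^ (2 * a ^ 2))%N.
  by rewrite -expnM mulnCA expnM.
rewrite (@dyadic_excess (fun p => (A (logn p n`! %% L)%N)%:R) kap n n0).
set Lam := 2 + ln n%:R in lnY; have Lam0 : 0 <= Lam by apply: addr_ge0 => //; apply: ln_nat_ge0.
pose u := 2 * n%:R * C * Lam ^+ 4 / Y%:R.
have u0 : 0 <= u by rewrite divr_ge0// !mulr_ge0 ?exprn_ge0// ltW.
set I := (trunc_log 2 n).+1.
have blocks (i : 'I_I) : \sum_((2 ^ i).+1 <= p < (2 * 2 ^ i).+1 | prime p)
      (logn p n`!)%:R * ln p%:R * ((A (logn p n`! %% L)%N)%:R - kap) <=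
      4 * n%:R * (~~ good_index X a (2 * a) n i)%:R + u.
  case: (boolP (good_index X a (2 * a) n i)) => gi; last first.
    by rewrite mulr1; apply: ler_wpDr => //; apply: any_block => //; rewrite expn_gt0.
  rewrite mulr0 add0r; apply: (@good_index_block L A kap C X a n i Y (2 * a ^ 2)) => //.
  - exact: ltW.
  - exact: ltnW.
  - by move=> J N N' hJ; apply: hE.
  - apply: leq_trans (trunc_logP (isT : 1 < 2)%N n0).
    by rewrite leq_exp2l// -ltnS.
apply: le_trans (lerD (lexx _) (ler_sum _ (fun i _ => blocks i))) _.
rewrite big_split /= sumr_const card_ord -mulr_sumr -natr_sum.
(* The total error of the good blocks. *)
have uI : u *+ I <= n%:R.
  have I2 : I%:R <= 2 * Lam :> R.
    have := trunc_log2_le R n0; rewrite /I -[(trunc_log 2 n).+1%:R]natr1 /Lam.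
    by move: (ln n%:R : R) ((trunc_log 2 n)%:R : R) => x y; clear; lra.
  rewrite -[leLHS]mulr_natr; apply: le_trans (ler_wpM2l u0 I2) _.
  have -> : u * (2 * Lam) = n%:R / Y%:R * (4 * C * Lam ^+ 5) by rewrite /u; field; rewrite gt_eqF.
  rewrite [leLHS]mulrAC ler_pdivrMr// ler_pM2l//.
  apply: le_trans (hYg Y YgY); rewrite -[leRHS]mulrA; apply: ler_wpM2l; first by rewrite mulr_ge0// ltW.
  by rewrite -exprMn lerXn2r// ?nnegrE// (le_trans Lam0).
have bad := bad_index_count_ln X1 a0 Xn nX.
have lnn : 8 * (8 * a%:R + 5) / eps <= ln n%:R :> R.
  rewrite -[leLHS]expRK ler_ln ?posrE ?expR_gt0//.
  by apply: ltW; apply: lt_le_trans (truncnS_gt _) _; rewrite ler_nat.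
have lf := ln_fact_ge R n0.
have lf0 : 0 <= ln n`!%:R :> R by apply: ln_nat_ge0.
have aR : (0 : R) < a%:R by rewrite ltr0n.
have l0 : 0 <= ln n%:R :> R by apply: ln_nat_ge0.
have k1 : 10 / a%:R <= eps / 32.
  rewrite ler_pdivrMr// in ae; rewrite ler_pdivrMr//.
  by clear -ae; move: (a%:R : R) ae => b ae; nra.
have k2 : 8 * a%:R + 5 <= eps / 8 * ln n%:R.
  by rewrite ler_pdivrMr// in lnn; clear -lnn; lra.
have k3 : 4 * n%:R * (\sum_(i < I) ~~ good_index X a (2 * a) n i)%:R + n%:R <= eps / 2 * ln n`!%:R.
  have k4 := ler_wpM2r l0 k1.
  have k5 : 4 * (\sum_(i < I) ~~ good_index X a (2 * a) n i)%:R + 1 <= eps / 4 * ln n%:R.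
    move: bad k2 k4; rewrite -/I.
    move: ((\sum_(i < I) ~~ good_index X a (2 * a) n i)%:R : R) (10 / a%:R * ln n%:R).
    move: (ln n%:R : R) (a%:R : R) => l b q r.
    by clear; lra.
  have k6 := ler_wpM2l (ltW nR) k5.
  have k7 := ler_wpM2l (ltW e0) lf.
  move: k6 k7; move: ((\sum_(i < I) ~~ good_index X a (2 * a) n i)%:R : R).
  move: (ln n%:R : R) (ln n`!%:R : R) (n%:R : R) => l f m q.
  by clear; nra.
have k8 := ler_wpM2r lf0 kap1.
apply: le_trans (lerD (lexx _) (lerD (lexx _) uI)) _.
apply: le_trans (lerD k8 k3) _.
by rewrite -mulrDl; apply: ler_wpM2r => //; clear; lra.
Qed.

End LegendreEquidistributionMain.

(** * Values of integer polynomials *)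

(** Clear the denominators in a Bezout identity over the rationals. *)
Lemma int_bezout (p q : {poly int}) : coprimep (polyQ p) (polyQ q) ->
  exists u v D, D != 0 /\ u * p + v * q = D%:P.
Proof.
move=> /Bezout_eq1_coprimepP[[u v] /= uv].
have [u1 [a a0 ua]] := rat_poly_scale u; have [v1 [b b0 vb]] := rat_poly_scale v.
exists (b *: u1), (a *: v1), (a * b); split; first by rewrite mulf_neq0.
have inj : injective polyQ by apply: map_inj_poly => //; apply: intr_inj.
have a0' : a%:~R != 0 :> rat by rewrite intr_eq0.
have b0' : b%:~R != 0 :> rat by rewrite intr_eq0.
apply: inj; rewrite /polyQ rmorphD !rmorphM /= !map_polyZ !map_polyC /= -polyCM.
have -> : ((a%:~R * b%:~R : rat))%:P = (a%:~R * b%:~R) *: (u * polyQ p + v * polyQ q).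
  by rewrite uv alg_polyC.
rewrite ua vb scalerDr -!scalerAl !scalerA.
by congr (_ *: _ + _ *: _); field.
Qed.

Lemma dvdn_horner_bezout (p q u v : {poly int}) (D x : int) (l : nat) :
  u * p + v * q = D%:P -> (l %| `|p.[x]|)%N -> (l %| `|q.[x]|)%N -> (l %| `|D|)%N.
Proof.
move=> E; rewrite -![(l %| _)%N]/(`|l%:Z| %| _)%N -!dvdzE => lp lq.
have -> : D = u.[x] * p.[x] + v.[x] * q.[x] by rewrite -!hornerM -hornerD E hornerC.
by rewrite rpredD// dvdz_mull.
Qed.

(** By Bezout over [Z], the values of coprime polynomials share no large prime. *)
Lemma coprime_values (s : nat) (f : 'I_s -> {poly int}) :
  (forall i j, i != j -> coprimep (polyQ (f i)) (polyQ (f j))) ->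
  exists B : nat, forall (i j : 'I_s) (p : nat) (x : int), (B < p)%N ->
    (p %| `|(f i).[x]|)%N -> (p %| `|(f j).[x]|)%N -> i = j.
Proof.
move=> cop.
have ex (ij : 'I_s * 'I_s) : exists b : nat, forall (p : nat) (x : int), (b < p)%N ->
    (p %| `|(f ij.1).[x]|)%N -> (p %| `|(f ij.2).[x]|)%N -> ij.1 = ij.2.
  case: ij => i j /=; case: (eqVneq i j) => [->|ij]; first by exists 0%N.
  have [u [v [D [D0 E]]]] := int_bezout (cop _ _ ij).
  exists `|D|%N => p x Dp pi pj; have := dvdn_horner_bezout E pi pj.
  by move/dvdn_leq; rewrite absz_gt0 D0 leqNgt Dp => /(_ isT).
have [b hb] := fin_all_exists ex.
exists (\sum_ij b ij)%N => i j p x Bp; apply: (hb (i, j)).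
by apply: leq_ltn_trans Bp; rewrite (bigD1 (i, j)) //= leq_addr.
Qed.

Lemma poly_product_values (s : nat) (P : {poly int}) (c : rat)
    (f : 'I_s -> {poly int}) (m : 'I_s -> nat) : c != 0 ->
  polyQ P = c *: \prod_(i < s) polyQ (f i) ^+ m i ->
  exists c1 c2 : nat, [/\ (0 < c1)%N, (0 < c2)%N & forall x,
    (c2 * `|P.[x]| = c1 * \prod_(i < s) `|(f i).[x]| ^ m i)%N].
Proof.
move=> c0 E; exists `|numq c|%N, `|denq c|%N.
rewrite !absz_gt0 numq_eq0 c0 denq_neq0; split => // x.
have inj : injective polyQ by apply: map_inj_poly => //; apply: intr_inj.
have : denq c *: P = numq c *: \prod_(i < s) f i ^+ m i.
  apply: inj; rewrite /polyQ !map_polyZ /= -!/(polyQ _) E scalerA.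
  rewrite {2}/polyQ rmorph_prod /=; congr (_ *: _).
    by rewrite mulrC -{1}[c]divq_num_den divfK// intr_eq0 denq_neq0.
  by apply: eq_bigr => i _; rewrite rmorphXn.
move/(congr1 (fun p : {poly int} => `|p.[x]|%N)).
rewrite !hornerZ !abszM horner_prod => ->; congr (_ * _)%N.
rewrite (big_morph absz abszM (erefl : `|1%:Z|%N = 1%N)).
by apply: eq_bigr => i _; rewrite horner_exp abszX.
Qed.

Lemma int_sum_pow_le (a : nat -> int) (d : nat) (x : int) : (0 < `|x|)%N ->
  (`|(\sum_(i < d.+1) a i * x ^+ i)%R| <= (\sum_(i < d.+1) `|a i|) * `|x| ^ d)%N.
Proof.
move=> x0; apply: leq_trans (_ : \sum_(i < d.+1) `|(a i * x ^+ i)%R| <= _)%N.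
  elim/big_ind2: _ => // u b v e ub ve.
  apply: leq_trans (leq_add ub ve).
  by rewrite -lez_nat PoszD !abszE ler_normD.
rewrite big_distrl /=; apply: leq_sum => i _.
by rewrite abszM abszX leq_mul2l leq_pexp2l ?orbT// -ltnS.
Qed.

Lemma value_upper (p : {poly int}) : (1 <= degp p)%N ->
  exists C : nat, (0 < C)%N /\ forall x : int, (0 < `|x|)%N ->
  (`|p.[x]| <= C * `|x| ^ degp p)%N.
Proof.
rewrite /degp => d1.
have [e E] : exists e, size p = e.+1 by move: d1; case: (size p) => // e _; exists e.
rewrite E /=; exists (\sum_(i < e.+1) `|(p`_i)%R|).+1%N; split=> // x x0.
rewrite horner_coef E; apply: leq_trans (int_sum_pow_le _ _ x0) _.
by rewrite leq_mul2r leqnSn orbT.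
Qed.

(** For large [|x|] the leading term, at least [|x| ^ d], is twice as large as the
    rest. *)
Lemma value_lower (p : {poly int}) : (1 <= degp p)%N ->
  exists x0 : nat, forall x : int, (x0 < `|x|)%N ->
  (`|x| ^ degp p <= 2 * `|p.[x]|)%N.
Proof.
rewrite /degp => d1.
have [e E] : exists e, size p = e.+2 by move: d1; case: (size p) => // -[|e] // _; exists e.
rewrite E /=; set C := (\sum_(i < e.+1) `|(p`_i)%R|)%N; exists (2 * C)%N => x x0.
have x1 : (0 < `|x|)%N by apply: leq_ltn_trans x0.
have p1 : (1 <= `|(p`_e.+1)%R|)%N.
  by rewrite absz_gt0 -[e.+1]/(e.+2.-1) -E -lead_coefE lead_coef_eq0 -size_poly_eq0 E.
have split : p.[x] - \sum_(i < e.+1) p`_i * x ^+ i = p`_e.+1 * x ^+ e.+1.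
  by rewrite horner_coef E big_ord_recr /= addrAC subrr add0r.
have tri : (`|(p`_e.+1 * x ^+ e.+1)%R| <= `|p.[x]| + `|(\sum_(i < e.+1) p`_i * x ^+ i)%R|)%N.
  by rewrite -split -lez_nat PoszD !abszE ler_normB.
have := int_sum_pow_le (fun i => p`_i) e x1; rewrite -/C /= => up.
rewrite abszM abszX in tri.
have h1 : (1 * `|x| ^ e.+1 <= `|(p`_e.+1)%R| * `|x| ^ e.+1)%N by rewrite leq_mul2r p1 orbT.
have h2 : (2 * C * `|x| ^ e <= `|x| ^ e.+1)%N by rewrite expnS leq_mul2r (ltnW x0) orbT.
move: tri up h1 h2; move: (`|x| ^ e.+1)%N (`|x| ^ e)%N => X Y.
move: `|p.[x]|%N `|(\sum_(i < e.+1) p`_i * x ^+ i)%R|%N (`|(p`_e.+1)%R| * X)%N.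
by clear=> a b c; rewrite mul1n -mulnA; move: (C * Y)%N => D; lia.
Qed.

(** * Factorials divisible by polynomial values *)

Section ValuesDividingFactorials.
Variables (s : nat) (m F : 'I_s -> nat).
Hypothesis m1 : forall i, (1 <= m i)%N.
Hypothesis F0 : forall i, (0 < F i)%N.

Lemma prod_pow_gt0 : (0 < \prod_(i < s) F i ^ m i)%N.
Proof. by apply: prodn_gt0 => i; rewrite expn_gt0 F0. Qed.

Lemma dvdn_prod_pow (i : 'I_s) : (F i %| \prod_(j < s) F j ^ m j)%N.
Proof. by rewrite (bigD1 i)//= dvdn_mulr// dvdn_exp// m1. Qed.

Lemma logn_prod_pow (p : nat) :
  logn p (\prod_(i < s) F i ^ m i) = (\sum_(i < s) m i * logn p (F i))%N.
Proof.
suff : (0 < \prod_(i < s) F i ^ m i)%N /\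
  logn p (\prod_(i < s) F i ^ m i) = (\sum_(i < s) m i * logn p (F i))%N by case.
elim/big_ind2: _ => [|x1 x2 y1 y2 [x0 <-] [y0 <-]|i _]; first by rewrite logn1.
  by rewrite muln_gt0 x0 y0 lognM.
by rewrite expn_gt0 F0 lognX.
Qed.

Lemma sum_logn_le (I : {set 'I_s}) (c1 c2 N p : nat) :
  (0 < c1)%N -> (0 < c2)%N -> (0 < N)%N -> (c2 * N = c1 * \prod_(i < s) F i ^ m i)%N ->
  (\sum_(i in I) m i * logn p (F i) <= logn p c2 + logn p N)%N.
Proof.
move=> c10 c20 N0 E; rewrite -lognM// E lognM// ?prod_pow_gt0// logn_prod_pow.
rewrite [X in (_ <= _ + X)%N](bigID (mem I)) /= addnCA leq_addr//.
Qed.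

(** A large prime divides a single [F i], so its valuation in [N] is a
    multiple of [m i]. *)
Lemma sum_logn_residue (I : {set 'I_s}) (c1 c2 N p L : nat) :
  (forall i, m i %| L)%N -> (0 < c1)%N -> (0 < c2)%N -> (0 < N)%N ->
  (c2 * N = c1 * \prod_(i < s) F i ^ m i)%N -> (c1 < p)%N -> (c2 < p)%N ->
  (forall i j, p %| F i -> p %| F j -> i = j)%N ->
  (\sum_(i in I) m i * logn p (F i) <=
   logn p N * [exists i in I, (m i %| logn p N %% L)])%N.
Proof.
move=> mL c10 c20 N0 E c1p c2p one.
have nolog c : (0 < c)%N -> (c < p)%N -> logn p c = 0%N.
  move=> c0 cp; apply/eqP; rewrite -leqn0 leqNgt logn_gt0 mem_primes.
  by apply/negP => /and3P[_ _ /dvdn_leq h]; move: (h c0); rewrite leqNgt cp.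
have EN : logn p N = (\sum_(i < s) m i * logn p (F i))%N.
  have := congr1 (logn p) E; rewrite !lognM// ?prod_pow_gt0//.
  by rewrite (nolog _ c10 c1p) (nolog _ c20 c2p) !add0n logn_prod_pow.
case: (boolP [exists i in I, (p %| F i)%N]) => [/existsP[i /andP[iI pi]]|none]; last first.
  rewrite big1 // => i iI; apply/eqP; rewrite muln_eq0 orbC; apply/orP; left.
  rewrite -leqn0 leqNgt logn_gt0 mem_primes; apply/negP => /and3P[_ _ pF].
  by move/negP: none; apply; apply/existsP; exists i; rewrite iI.
have single (Q : pred 'I_s) : Q i -> (\sum_(j | Q j) m j * logn p (F j) = m i * logn p (F i))%N.
  move=> Qi; rewrite (bigD1 i)//= big1 ?addn0// => j /andP[_ ji].
  apply/eqP; rewrite muln_eq0 orbC; apply/orP; left.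
  rewrite -leqn0 leqNgt logn_gt0 mem_primes; apply/negP => /and3P[_ _ pF].
  by move/eqP: ji; apply; apply: one.
rewrite (single (mem I) iI) {1}EN (single xpredT isT).
suff -> : [exists i in I, (m i %| logn p N %% L)%N] by rewrite muln1.
apply/existsP; exists i; rewrite iI /=.
by rewrite /dvdn modn_dvdm// EN (single xpredT isT) modnMr.
Qed.

(** Decompose [ln (F i)] over the primes. For [p > B] the combined exponents of
    the [F i] are bounded by [sum_logn_residue], and for [p <= B] by the exponents
    in [c2] and in [n!]; with [ln p <= p], these contribute at most [B * B + 2 n]
    for each [p]. *)
Lemma ln_values_le (R : realType) (I : {set 'I_s}) (c1 c2 B n L : nat) :
  (forall i, m i %| L)%N -> (0 < c1)%N -> (0 < c2)%N -> (0 < n)%N ->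
  (c2 * n`! = c1 * \prod_(i < s) F i ^ m i)%N -> (c1 <= B)%N -> (c2 <= B)%N ->
  (forall i j p, (B < p)%N -> p %| F i -> p %| F j -> i = j)%N ->
  \sum_(i in I) (m i)%:R * ln (F i)%:R <=
  \sum_(0 <= p < n.+1 | prime p) (logn p n`!)%:R * ln p%:R *
     [exists i in I, (m i %| logn p n`! %% L)%N]%:R
  + B.+1%:R * (B%:R * B%:R + 2 * n%:R) :> R.
Proof.
move=> mL c10 c20 n0 E c1B c2B one; set N := n`! in E *.
have N0 : (0 < N)%N by apply: fact_gt0.
pose M := (c2 * N + n + B)%N.
pose A p : R := [exists i in I, (m i %| logn p N %% L)%N]%:R.
have FM i : (F i <= M)%N.
  rewrite /M -addnA; apply: (@leq_trans (c2 * N)); last exact: leq_addr.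
  rewrite E; apply: dvdn_leq; first by rewrite muln_gt0 c10 prod_pow_gt0.
  by apply: dvdn_mull; apply: dvdn_prod_pow.
have -> : \sum_(i in I) (m i)%:R * ln (F i)%:R =
   \sum_(0 <= p < M.+1 | prime p) (\sum_(i in I) m i * logn p (F i))%:R * ln p%:R :> R.
  transitivity (\sum_(i in I) \sum_(0 <= p < M.+1 | prime p) (m i * logn p (F i))%:R * ln p%:R : R).
    apply: eq_bigr => i _; rewrite (ln_prime_sum R (F0 i) (FM i)) mulr_sumr.
    by apply: eq_bigr => p _; rewrite natrM mulrA.
  by rewrite exchange_big /=; apply: eq_bigr => p _; rewrite natr_sum mulr_suml.
apply: le_trans (_ : \sum_(0 <= p < M.+1 | prime p) ((logn p N)%:R * ln p%:R * A p +
    (p <= B)%:R * (B%:R * B%:R + 2 * n%:R)) <= _).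
  apply: ler_sum => p pp.
  have lp := ln_nat_ge0 R p; have An0 : 0 <= A p by rewrite /A.
  case: (leqP p B) => pB; last first.
    rewrite mul0r addr0 mulrAC -natrM ler_wpM2r// ler_nat.
    apply: (@sum_logn_residue I c1 c2) => //.
    - exact: leq_ltn_trans pB.
    - exact: leq_ltn_trans pB.
    - by move=> i j; apply: one.
  rewrite mul1r; apply: ler_wpDl; first by rewrite !mulr_ge0.
  apply: le_trans (_ : (logn p c2 + logn p N)%:R * ln p%:R <= _).
    by rewrite ler_wpM2r// ler_nat; apply: (@sum_logn_le I c1 c2).
  have p0 : (0 : R) < p%:R by rewrite ltr0n prime_gt0.
  have lnp : ln p%:R <= p%:R :> R.
    by apply: ltW; apply: ln_sublinear.
  rewrite natrD mulrDl lerD//.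
    rewrite ler_pM// ?(le_trans lnp)// ler_nat//.
    by apply: leq_trans c2B; apply: ltnW; apply: ltn_logl.
  apply: le_trans (ler_wpM2r lp (logn_fact_le R n pp)) _.
  rewrite -[leLHS]mulrA -[leRHS]mulr1; apply: ler_wpM2l; first by rewrite mulr_ge0.
  by rewrite mulrC ler_pdivrMr// mul1r.
rewrite big_split /= lerD//.
  rewrite (@big_cat_nat _ _ _ n.+1)//=; last by rewrite ltnS /M addnAC leq_addl.
  rewrite [X in _ + X]big_nat_cond [X in _ + X]big1 ?addr0// => p /andP[/andP[np _] pp].
  by rewrite logn_fact_gt// !mul0r.
rewrite -mulr_suml ler_wpM2r ?addr_ge0 ?mulr_ge0//.
rewrite (@big_cat_nat _ _ _ B.+1)//=; last by rewrite ltnS /M leq_addl.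
rewrite [X in _ + X]big_nat_cond [X in _ + X]big1 ?addr0; last first.
  by move=> p /andP[/andP[Bp _] _]; rewrite leqNgt Bp.
rewrite big_mkcond; apply: le_trans (_ : \sum_(0 <= p < B.+1) 1 <= _).
  by apply: ler_sum => p _; case: ifP => // _; rewrite lern1 leq_b1.
by rewrite sumr_const_nat subn0.
Qed.

End ValuesDividingFactorials.

(** * Consequences of having infinitely many solutions *)

Lemma fact_ge (n : nat) : (n <= n`!)%N.
Proof. by case: n => // n; rewrite factS leq_pmulr// fact_gt0. Qed.

Lemma bounded_solutions_finite (A : set (int * nat)) (B N : nat) :
  (forall xn, A xn -> (`|xn.1| <= B)%N /\ (xn.2 < N)%N) -> finite_set A.
Proof.
move=> h; pose g (ij : 'I_(2 * B).+1 * 'I_N) : int * nat := ((ij.1 : nat)%:Z - B%:Z, (ij.2 : nat)).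
apply: (@sub_finite_set _ _ (g @` setT)%classic); last by apply: finite_image; apply: finite_finset.
case=> x n /h /= [xB nN].
have xb : (`|(x + B%:Z)%R| < (2 * B).+1)%N by clear -xB; lia.
exists (Ordinal xb, Ordinal nN) => //; rewrite /g /=; congr pair.
by clear -xB; lia.
Qed.

(** Bounding [n] bounds [|x|] by the growth of [P], so [n] takes arbitrarily large
    values; bounding [|x|] bounds [P.[x] = n!], hence [n]. *)
Lemma large_solutions (P : {poly int}) (K x0 : nat) :
  (forall x, P.[x] != 0 -> (x0 < `|x|)%N -> (`|x| <= K * `|P.[x]|)%N) ->
  infinite_set (fact_solutions P) ->
  forall N, exists x n, [/\ (N <= n)%N, (N <= `|x|)%N & P.[x] = n`!%:Z].
Proof.
move=> grow inf N.
have big N' : exists x n, (N' <= n)%N /\ P.[x] = n`!%:Z.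
  apply: boolp.contrapT => none; apply: inf.
  apply: (@bounded_solutions_finite _ (x0 + K * N'`!) N') => -[x n] [/= n1 Pn].
  have nN : (n < N')%N.
    by rewrite ltnNge; apply/negP => h; apply: none; exists x, n.
  split=> //; case: (leqP `|x| x0) => [h|h]; first by apply: leq_trans h (leq_addr _ _).
  have P0 : P.[x] != 0 by rewrite Pn -lt0n fact_gt0.
  apply: leq_trans (grow x P0 h) _; rewrite Pn /= addnC -[X in (X <= _)%N]addn0 leq_add//.
  by rewrite leq_mul2l leq_fact ?orbT// ltnW.
pose M := (\sum_(i < (2 * N).+1) `|P.[(i : nat)%:Z - N%:Z]|)%N.
have [x [n [nM Pn]]] := big (N + M.+1)%N.
exists x, n; split=> //; first by apply: leq_trans nM; apply: leq_addr.
rewrite leqNgt; apply/negP => xN.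
have xb : (`|(x + N%:Z)%R| < (2 * N).+1)%N by clear -xN; lia.
have : (n`! <= M)%N.
  rewrite /M (bigD1 (Ordinal xb))//=.
  have -> : `|(x + N%:Z)%R|%N%:Z - N%:Z = x by clear -xN; lia.
  by rewrite Pn leq_addr.
have := fact_ge n; clear -nM; lia.
Qed.

(** Linear terms are negligible since [ln n!] is of order [n ln n]. *)
Lemma linear_le_ln_fact (R : realType) (K eps : R) : 0 <= K -> 0 < eps ->
  exists n1 : nat, forall n, (n1 <= n)%N -> K + K * n%:R <= eps * ln n`!%:R.
Proof.
move=> K0 e0; exists (Num.truncn (expR (4 * K / eps))).+1 => n nn.
have n0 : (0 < n)%N by apply: leq_trans nn.
have lnn : 4 * K / eps <= ln n%:R :> R.
  rewrite -[leLHS]expRK ler_ln ?posrE ?expR_gt0 ?ltr0n//.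
  by apply: ltW; apply: lt_le_trans (truncnS_gt _) _; rewrite ler_nat.
rewrite ler_pdivrMr// in lnn.
have n1 : (1 : R) <= n%:R by rewrite ler1n.
have lf := ler_wpM2l (ltW e0) (ln_fact_ge R n0).
have h1 := ler_wpM2l K0 n1.
have h2 := ler_wpM2l (ler0n R n) lnn.
move: lf h1 h2; move: (n%:R : R) (ln n%:R : R) (ln n`!%:R : R) => x l f.
clear; nra.
Qed.

(** * The inequality between degrees and residues *)

Lemma dvdn_lcm_fam (s : nat) (m : 'I_s -> nat) (i : 'I_s) : (m i %| lcm_fam m)%N.
Proof. by rewrite /lcm_fam (bigD1 i)//= dvdn_lcml. Qed.

Lemma lcm_fam_gt0 (s : nat) (m : 'I_s -> nat) :
  (forall i, (1 <= m i)%N) -> (0 < lcm_fam m)%N.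
Proof.
move=> m1; rewrite /lcm_fam; elim/big_ind: _ => // x y x0 y0.
by rewrite lcmn_gt0 x0.
Qed.

Lemma card_resid_set (R : realType) (s : nat) (m : 'I_s -> nat) (I : {set 'I_s}) :
  #|resid_set m I|%:R =
  \sum_(v < lcm_fam m) [exists i in I, (m i %| v)%N]%:R :> R.
Proof.
rewrite -sum1_card natr_sum big_mkcond; apply: eq_bigr => v _.
by rewrite inE; case: ifP.
Qed.

(** Take a solution with [n] and [|x|] large. From above,
    [ln n! <= d ln |x| + O(1)]; from below, [wdeg I * ln |x|] is at most the sum
    of the [m i ln |f_i(x)|] up to [O(1)]; and [ln_values_le] with
    [legendre_residues] bounds this sum by [(|R(I)| / L + eps) ln n! + O(n)].
    Eliminate [ln |x|]. *)
Lemma residue_weight_le (R : realType) (s : nat) (P : {poly int}) (c : rat)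
    (f : 'I_s -> {poly int}) (m : 'I_s -> nat) (I : {set 'I_s}) (eps : R) :
  (1 <= s)%N -> c != 0 ->
  (forall i, (1 <= degp (f i))%N) ->
  (forall i j, i != j -> coprimep (polyQ (f i)) (polyQ (f j))) ->
  (forall i, (1 <= m i)%N) ->
  polyQ P = c *: \prod_(i < s) polyQ (f i) ^+ m i ->
  infinite_set (fact_solutions P) -> 0 < eps ->
  (wdeg f m I)%:R <= (\sum_(i < s) m i * degp (f i))%:R *
    (#|resid_set m I|%:R / (lcm_fam m)%:R + eps) + eps :> R.
Proof.
move=> s1 c0 hf hcop m1 hP inf e0.
set d := (\sum_(i < s) m i * degp (f i))%N; set L := lcm_fam m.
have [c1 [c2 [c10 c20 hval]]] := poly_product_values c0 hP.
have [B0 hB0] := coprime_values hcop.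
have [C hC] := fin_all_exists (fun i => value_upper (hf i)).
have [y0 hy0] := fin_all_exists (fun i => value_lower (hf i)).
have F0 x : P.[x] != 0 -> forall i, (0 < `|(f i).[x]|)%N.
  move=> Px i; have := hval x; rewrite lt0n; case: eqP => // fi0.
  rewrite [X in (c1 * X)%N](bigD1 i)//= fi0 exp0n// mul0n muln0 => /eqP.
  by rewrite muln_eq0 absz_eq0 (negbTE Px) eqn0Ngt c20.
pose y := (\sum_i y0 i)%N.
have low x i : (y < `|x|)%N -> (`|x| ^ degp (f i) <= 2 * `|(f i).[x]|)%N.
  move=> h; apply: hy0; apply: leq_ltn_trans h.
  by rewrite /y (bigD1 i)//= leq_addr.
(* One factor alone is at least [|x| / 2], which is enough growth to force [n] and
   [|x|] to be unbounded together. *)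
have grow x : P.[x] != 0 -> (y < `|x|)%N -> (`|x| <= 2 * c2 * `|P.[x]|)%N.
  move=> Px xy; pose i0 := Ordinal s1.
  have x0 : (0 < `|x|)%N by apply: leq_ltn_trans xy.
  apply: leq_trans (_ : `|x| ^ degp (f i0) <= _)%N.
    by rewrite -{1}[`|x|%N]expn1 leq_pexp2l.
  apply: leq_trans (low _ _ xy) _; rewrite -mulnA hval leq_mul2l /=.
  apply: dvdn_leq; first by rewrite muln_gt0 c10; apply: (prod_pow_gt0 m (F0 x Px)).
  by apply: dvdn_mull; apply: (dvdn_prod_pow (fun i => `|(f i).[x]|%N) m1).
pose CC := (c1 * \prod_(i < s) C i ^ m i)%N.
have CC0 : (0 < CC)%N.
  by rewrite muln_gt0 c10; apply: prodn_gt0 => i; rewrite expn_gt0 (hC i).1.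
pose B := (B0 + c1 + c2)%N.
pose w : R := (wdeg f m I)%:R.
(* Collects all the error terms, multiplied by the factors of the final
   elimination. *)
pose K : R := w * ln CC%:R + d%:R * ((\sum_(i in I) m i)%:R + B.+1%:R * (B%:R * B%:R + 2)).
have K0 : 0 <= K.
  apply: addr_ge0; first by apply: mulr_ge0 => //; apply: ln_nat_ge0.
  apply: mulr_ge0 => //; apply: addr_ge0 => //; apply: mulr_ge0 => //.
  by apply: addr_ge0 => //; apply: mulr_ge0.
have [n1 hn1] := linear_le_ln_fact K0 e0.
pose A : pred nat := fun v => [exists i in I, (m i %| v)%N].
have [n0 hn0] := legendre_residues A (lcm_fam_gt0 m1) e0.
have [x [n [nN xN Pn]]] := large_solutions grow inf (n0 + n1 + y + 2)%N.
have Px : P.[x] != 0 by rewrite Pn -lt0n fact_gt0.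
have n2 : (1 < n)%N by clear -nN; lia.
have ngt0 : (0 < n)%N by apply: ltnW.
have x0 : (0 < `|x|)%N by clear -xN; lia.
have xy : (y < `|x|)%N by clear -xN; lia.
have Fx := F0 x Px.
have E : (c2 * n`! = c1 * \prod_(i < s) `|(f i).[x]| ^ m i)%N by rewrite -hval Pn.
have xR : (0 : R) < `|x|%N%:R by rewrite ltr0n.
have cA : (\sum_(v < L) (A v)%:R) / L%:R = #|resid_set m I|%:R / L%:R :> R.
  by rewrite card_resid_set.
have up : ln n`!%:R <= ln CC%:R + d%:R * ln `|x|%N%:R :> R.
  rewrite [X in _ + X]mulr_natl -lnXn// -natrX -lnM ?posrE ?ltr0n ?expn_gt0 ?x0//.
  have pos : (0 < CC * `|x| ^ d)%N by rewrite muln_gt0 CC0 expn_gt0 x0.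
  rewrite -natrM ler_ln ?posrE ?ltr0n ?pos ?fact_gt0// ler_nat.
  apply: leq_trans (_ : c2 * n`! <= _)%N; first by rewrite leq_pmull.
  rewrite E /CC -mulnA leq_mul2l; apply/orP; right.
  rewrite /d expn_sum -big_split /=; apply: leq_prod => i _.
  by rewrite [(m i * degp (f i))%N]mulnC expnM -expnMn leq_exp2r// (hC i).2.
have lowI : w * ln `|x|%N%:R <= \sum_(i in I) (m i)%:R * ln `|(f i).[x]|%N%:R
    + (\sum_(i in I) m i)%:R.
  rewrite /w /wdeg !natr_sum mulr_suml -big_split /=; apply: ler_sum => i _.
  rewrite natrM -mulrA -[X in _ <= _ + X]mulr1 -mulrDr; apply: ler_wpM2l => //.
  rewrite [leLHS]mulr_natl -lnXn// -natrX.
  apply: le_trans (_ : ln (2 * `|(f i).[x]|%N%:R) <= _).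
    rewrite ler_ln ?posrE ?mulr_gt0 ?ltr0n ?expn_gt0 ?x0 ?Fx//.
    by rewrite -natrM ler_nat low.
  rewrite lnM ?posrE ?ltr0n ?Fx// addrC lerD2l.
  by have := @le_ln1Dx R 1; rewrite -[1 + 1]/2%:R; apply; lra.
have mid := @ln_values_le s m (fun i => `|(f i).[x]|%N) m1 Fx R I c1 c2 B n L
   (dvdn_lcm_fam m) c10 c20 ngt0 E.
have {}mid := mid _ _ _.
have h0 : (c1 <= B)%N by rewrite /B; clear; lia.
have h1 : (c2 <= B)%N by rewrite /B; clear; lia.
have h2 : forall i j p, (B < p)%N -> (p %| `|(f i).[x]|)%N -> (p %| `|(f j).[x]|)%N -> i = j.
  by move=> i j p Bp; apply: hB0; apply: leq_ltn_trans Bp; rewrite /B -addnA leq_addr.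
have {h0 h1 h2}mid := mid h0 h1 h2.
have leg : \sum_(0 <= p < n.+1 | prime p)
     (logn p n`!)%:R * ln p%:R * [exists i in I, (m i %| logn p n`! %% L)%N]%:R <=
  (#|resid_set m I|%:R / L%:R + eps) * ln n`!%:R :> R.
  by rewrite -cA; apply: hn0; clear -nN; lia.
have small : K + K * n%:R <= eps * ln n`!%:R by apply: hn1; clear -nN; lia.
have lf : 0 < ln n`!%:R :> R.
  by rewrite ln_gt0// ltr1n (leq_trans n2)// fact_ge.
rewrite -(ler_pM2r lf) mulrDl.
have w0 : 0 <= w by [].
have u1 := ler_wpM2l w0 up.
have dR : (0 : R) <= d%:R by [].
have u2 := ler_wpM2l dR (le_trans lowI (lerD (le_trans mid (lerD leg (lexx _))) (lexx _))).
have nR : (1 : R) <= n%:R by rewrite ler1n.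
rewrite -/w.
have u3 : w * ln CC%:R + d%:R * ((\sum_(i in I) m i)%:R + B.+1%:R * (B%:R * B%:R + 2 * n%:R)) <= K + K * n%:R.
  have q0 : 0 <= B%:R * B%:R :> R by rewrite mulr_ge0.
  have b0 : 0 <= B.+1%:R :> R by [].
  have S0 : 0 <= (\sum_(i in I) m i)%:R :> R by [].
  have a0 : 0 <= w * ln CC%:R by rewrite mulr_ge0// ln_nat_ge0.
  have h1 := mulr_ge0 a0 (ler0n R n).
  have h2 : (\sum_(i in I) m i)%:R + B.+1%:R * (B%:R * B%:R + 2 * n%:R) <=
      ((\sum_(i in I) m i)%:R + B.+1%:R * (B%:R * B%:R + 2)) * (1 + n%:R) :> R.
    have h3 := mulr_ge0 S0 (ler0n R n).
    have h4 := mulr_ge0 (mulr_ge0 b0 q0) (ler0n R n).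
    move: S0 b0 q0 h3 h4; move: ((\sum_(i in I) m i)%:R : R) (B.+1%:R : R) (B%:R * B%:R : R) (n%:R : R).
    by clear=> S b q v; nra.
  have h3 := ler_wpM2l dR h2.
  move: h1 h3 => {h2}; rewrite /K.
  move: (w * ln CC%:R) ((\sum_(i in I) m i)%:R + B.+1%:R * (B%:R * B%:R + 2 * n%:R) : R).
  move: ((\sum_(i in I) m i)%:R + B.+1%:R * (B%:R * B%:R + 2) : R) (n%:R : R) (d%:R : R).
  by clear=> t v e a b; nra.
move: u1 u2 (le_trans u3 small); clear -R; clearbody w.
move: (ln `|x|%N%:R : R) (ln n`!%:R : R) (ln CC%:R : R) (B.+1%:R * (B%:R * B%:R + 2 * n%:R) : R).
move: ((\sum_(i in I) m i)%:R : R) (#|resid_set m I|%:R / L%:R + eps) (d%:R : R) w.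
by clear=> S r e v lx f a b; nra.
Qed.

(** Clearing denominators removes the choice of a real field: here the analytic
    estimate is specialized to one, and [eps] tends to 0. *)
Lemma residue_weight_nat (s : nat) (P : {poly int}) (c : rat)
    (f : 'I_s -> {poly int}) (m : 'I_s -> nat) (I : {set 'I_s}) :
  (1 <= s)%N -> c != 0 ->
  (forall i, (1 <= degp (f i))%N) ->
  (forall i j, i != j -> coprimep (polyQ (f i)) (polyQ (f j))) ->
  (forall i, (1 <= m i)%N) ->
  polyQ P = c *: \prod_(i < s) polyQ (f i) ^+ m i ->
  infinite_set (fact_solutions P) ->
  (wdeg f m I * lcm_fam m <= (\sum_(i < s) m i * degp (f i)) * #|resid_set m I|)%N.
Proof.
move=> s1 c0 hf hcop m1 hP inf.
set d := (\sum_(i < s) m i * degp (f i))%N.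
have le eps := @residue_weight_le Rdefinitions.R s P c f m I eps s1 c0 hf hcop m1 hP inf.
have LR : (0 : Rdefinitions.R) < (lcm_fam m)%:R by rewrite ltr0n lcm_fam_gt0.
rewrite -(ler_nat Rdefinitions.R) !natrM -ler_pdivlMr//.
apply/ler_addgt0Pr => e e0.
have d1 : 0 < d%:R + 1 :> Rdefinitions.R by rewrite ltr_wpDl.
apply: le_trans (le _ (divr_gt0 e0 d1)) _; rewrite -/d -mulrA mulrDr -addrA lerD2l.
rewrite le_eqVlt; apply/orP; left; apply/eqP; field.
by rewrite gt_eqF.
Qed.

Theorem theorem6p1 (s : nat) (P : {poly int}) (c : rat)
    (f : 'I_s -> {poly int}) (m : 'I_s -> nat)
    (hs : (1 <= s)%N) (hc : c != 0)
    (hf : forall i, (1 <= degp (f i))%N)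
    (hcop : forall i j, i != j -> coprimep (polyQ (f i)) (polyQ (f j)))
    (hm : forall i, (1 <= m i)%N)
    (hP : polyQ P = c *: \prod_(i < s) polyQ (f i) ^+ m i) :
  let d := (\sum_(i < s) m i * degp (f i))%N in
  let L := lcm_fam m in
  (infinite_set (fact_solutions P) ->
     forall I : {set 'I_s},
       (wdeg f m I)%:R / d%:R <= #|resid_set m I|%:R / L%:R :> rat) /\
  ((exists I : {set 'I_s},
      d%:R^-1 * (wdeg f m I)%:R > #|resid_set m I|%:R / L%:R :> rat) ->
     finite_set (fact_solutions P)).
Proof.
move=> d L.
have d0 : (0 < d)%N.
  by rewrite /d (bigD1 (Ordinal hs))//= ltn_addr// muln_gt0 hm hf.
have L0 : (0 < L)%N by apply: lcm_fam_gt0.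
have main : infinite_set (fact_solutions P) -> forall I : {set 'I_s},
    (wdeg f m I)%:R / d%:R <= #|resid_set m I|%:R / L%:R :> rat.
  move=> inf I; rewrite ler_pdivrMr ?ltr0n// mulrAC ler_pdivlMr ?ltr0n// -!natrM ler_nat.
  rewrite [leqRHS]mulnC; exact: (residue_weight_nat I hs hc hf hcop hm hP inf).
split=> // -[I hI]; apply: boolp.contrapT => inf.
by have := main inf I; rewrite leNgt [ltRHS]mulrC hI.
Qed.
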